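(* Let $\mu_x(dz)=g(x,z)\,dz$, $x\in\mathbb{R}^d$, be a family of positive measures on $\mathbb{R}^d$ such that $\sup_{x}\int_{\mathbb{R}^d}|z|^2\,\mu_x(dz)<\infty$ and such that $(x,z)\mapsto g(x,z)$ is continuous at points with $z\neq 0$. For $(x,\xi)\in\mathbb{R}^d\times\mathbb{R}^d$ put $$H(x,\xi)=\int_{\mathbb{R}^d}\bigl(\exp[\langle z,\xi\rangle]-1-\langle z,\xi\rangle\bigr)\,\mu_x(dz),\qquad L(x,\alpha)=\sup_{\xi\in\mathbb{R}^d}\{\langle\alpha,\xi\rangle-H(x,\xi)\}.$$ Assume the following. (i) $H$ is continuous, and there is a (finite) convex function $H_1$ on $\mathbb{R}^d$ such that $H(x,\xi)\le H_1(\xi)$ for all $x,\xi$. (ii) The function $(x,\alpha)\mapsto L(x,\alpha)$ is finite and twice differentiable in $\alpha$. For every $R>0$ there exist $M$ and $m>0$ such that, for all $x\in\mathbb{R}^d$ and all $\alpha$ with $|\alpha|\le R$, one has $L(x,\alpha)\le M$, $\left|\frac{\partial}{\partial\alpha}L(x,\alpha)\right|\le M$, and the Hessian of $L(x,\cdot)$ at $\alpha$ is larger than $m I_d$ (in the sense of symmetric matrices). Moreover $$\sup_{|x-x'|<\delta'}\ \sup_{\alpha\in\mathbb{R}^d}\frac{|L(x',\alpha)-L(x,\alpha)|}{1+L(x,\alpha)}\longrightarrow 0\quad\text{as }\delta'\to 0.$$ (iii) The Legendre transform $L_1(\alpha)=\sup_{\xi}\{\langle\alpha,\xi\rangle-H_1(\xi)\}$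 of $H_1$ satisfies: for every $C>0$ there exists $K_C$ such that $L_1(\alpha)\ge C|\alpha|$ whenever $|\alpha|\ge K_C$. For $h>0$ let $(P^h_t)_{t\ge 0}$ be the Markov semi-group generated by $\frac1h L^h$, where $$L^hf(x)=\int_{\mathbb{R}^d}\bigl(f(x+hz)-f(x)-h\langle z,f'(x)\rangle\bigr)\,\mu_x(dz),$$ and for $x,y\in\mathbb{R}^d$ let $$l(x,y)=\inf_{\phi(0)=x,\ \phi(1)=y}\ \int_0^1 L\Bigl(\phi(t),\frac{d}{dt}\phi(t)\Bigr)\,dt,$$ the infimum being over piecewise $C^1$ curves $\phi:[0,1]\to\mathbb{R}^d$ with the indicated endpoints. Then for every open ball $O$ of $\mathbb{R}^d$ and every $x\in\mathbb{R}^d$, $$\limsup_{h\to 0^+}\ h\,\log P^h_1[1_O](x)\ \le\ -\inf_{y\in O} l(x,y).$$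
   Context: Here $\langle\cdot,\cdot\rangle$ and $|\cdot|$ are the Euclidean inner product and norm on $\mathbb{R}^d$, $f'$ denotes the gradient of $f$, and $1_O$ is the indicator function of $O$. The operator $L^h$ is defined on smooth functions $f:\mathbb{R}^d\to\mathbb{R}$ with bounded derivatives at each order. Standing convention: for each $h>0$ the operator $\frac1h L^h$ generates a Markov semi-group $(P^h_t)_{t\ge0}$ which is a semi-group of probability measures, i.e. $P^h_t[f](x)=\int f(y)\,P^h_t(x,dy)$ with $P^h_t(x,\cdot)$ a probability measure on $\mathbb{R}^d$; thus $P^h_1[1_O](x)=P^h_1(x,O)$. The convention $\log 0=-\infty$ is used. *)

(* Defs.v *)
From HB Require Import structures.
From mathcomp Require Import all_boot all_order all_algebra.
From mathcomp Require Import all_classical all_reals all_analysis.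
From mathcomp Require Import measurable_realfun.
Import Order.TTheory GRing.Theory Num.Theory.
Import numFieldNormedType.Exports.

Set Implicit Arguments.
Unset Strict Implicit.
Unset Printing Implicit Defensive.

Local Open Scope classical_set_scope.
Local Open Scope ring_scope.

(* R^d is 'rV[R]_d. Its library norm is the sup norm, used here only for the
   topology and for differentiability; [enorm] is the Euclidean norm. *)
Section euclidean.
Context {R : realType} {d : nat}.
Implicit Types u v : 'rV[R]_d.

Definition dotrV u v : R := \sum_(i < d) u 0 i * v 0 i.

Definition enorm v : R := Num.sqrt (dotrV v v).

Definition eball (c : 'rV[R]_d) (r : R) : set 'rV[R]_d :=
  [set y | enorm (y - c) < r].

End euclidean.

(* The Borel sigma-algebra of R^d. *)
Definition rV_open (R : realType) (d : nat) : set (set 'rV[R]_d) := open.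

HB.instance Definition _ (R : realType) (d : nat) :=
  @isMeasurable.Build (sigma_display (@rV_open R d)) 'rV[R]_d
    <<s @rV_open R d >>
    (@sigma_algebra0 _ setT _) (@sigma_algebraC _ _)
    (@sigma_algebra_bigcup _ setT _).

(* Lebesgue measure on R^(n+1) is the image under [consrV] of the product of
   the Lebesgue measures on R and R^n; [lebesgue_rV_box] gives its value on
   boxes. *)
Section consrV.
Context {R : realType} {n : nat}.

Definition consrV (p : R * 'rV[R]_n) : 'rV[R]_n.+1 :=
  row_mx (p.1%:M : 'rV[R]_1) p.2.

Definition unconsrV (v : 'rV[R]_n.+1) : R * 'rV[R]_n :=
  (v 0 0, \row_i v 0 (lift ord0 i)).

Lemma consrV0 p : consrV p 0 0 = p.1.
Proof.
have -> : 0 = lshift n (0 : 'I_1) by apply/val_inj.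
by rewrite /consrV (@row_mxEl _ 1 1 n) mxE eqxx.
Qed.

Lemma consrVS p i : consrV p 0 (lift ord0 i) = p.2 0 i.
Proof.
have -> : lift ord0 i = rshift 1 i by apply/val_inj.
by rewrite /consrV (@row_mxEr _ 1 1 n).
Qed.

Lemma consrVK : cancel consrV unconsrV.
Proof.
move=> p; rewrite /unconsrV consrV0 [RHS]surjective_pairing; congr pair.
by apply/rowP => i; rewrite mxE consrVS.
Qed.

Lemma rV_open_measurable k (U : set 'rV[R]_k) : open U -> measurable U.
Proof. exact: sub_gen_smallest. Qed.

Lemma measurable_coord k (i : 'I_k) :
  measurable_fun [set: 'rV[R]_k] (fun v => v 0 i : R).
Proof.
apply: (measurability (RGenOpens.G (R := R)) (RGenOpens.measurableE R)).
move=> _ [_ [a [b ->]] <-].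
rewrite setTI; apply: rV_open_measurable; apply: open_comp => //=.
by move=> v _; exact: coord_continuous.
Qed.

Lemma measurable_unconsrV : measurable_fun [set: 'rV[R]_n.+1] unconsrV.
Proof.
apply: measurable_fun_pair; first exact: measurable_coord.
apply: (measurability (@rV_open R n)) => // _ [U oU <-].
rewrite setTI; apply: rV_open_measurable; apply: open_comp => //= v _ A.
move=> /nbhs_ballP[e /= e0 eA]; apply/nbhs_ballP; exists e => //= w [_ vw].
by apply: eA; split=> // i j; rewrite !mxE; exact: vw.
Qed.

Lemma measurable_consrV : measurable_fun [set: R * 'rV[R]_n] consrV.
Proof.
apply: (measurability (@rV_open R n.+1)) => // _ [U oU <-].
rewrite setTI; set W := _ @^-1` _.
pose I := (rat * 'rV[rat]_n * nat)%type.
pose B (i : I) : set (R * 'rV[R]_n) :=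
  ball (ratr i.1.1 : R) i.2.+1%:R^-1 `*`
  ball (map_mx ratr i.1.2 : 'rV[R]_n) i.2.+1%:R^-1.
pose F (k : nat) := if unpickle k is Some i then
  if `[< B i `<=` W >] then B i else set0 else set0.
have mF k : measurable (F k).
  rewrite /F; case: unpickle => [i|//]; case: ifP => // _.
  apply: measurableX; first exact: measurable_ball.
  by apply: rV_open_measurable; exact: ball_open.
suff -> : W = \bigcup_k F k by exact: bigcupT_measurable.
apply/seteqP; split=> [p Wp|p [k _]]; last first.
  by rewrite /F; case: unpickle => // i; case: ifP => // /asboolP; apply.
have : nbhs (consrV p) U by apply: open_nbhs_nbhs; split.
move=> /nbhs_ballP[e /= e0 eU].
have e20 : 0 < e / 2 by rewrite divr_gt0.
have [N _ /(_ N (leqnn N)) ke] := near_infty_natSinv_lt (PosNum e20).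
set r : R := N.+1%:R^-1 in ke.
have r0 : 0 < r by rewrite invr_gt0.
have rat_near (a : R) : exists q : rat, `|ratr q - a| < r.
  have [|q] := @rat_in_itvoo R (a - r) (a + r).
    by rewrite ltrBlDr -addrA ltrDl addr_gt0.
  by rewrite in_itv/= -ltr_distlC => aq; exists q; rewrite distrC.
have [q pq] := rat_near p.1.
have [w pw] : exists w : 'rV[rat]_n, forall i, `|ratr (w 0 i) - p.2 0 i| < r.
  have /choice[w wP] : forall i, exists q : rat, `|ratr q - p.2 0 i| < r by [].
  by exists (\row_i w i) => i; rewrite mxE.
have tri (a b c : R) : `|b - a| < r -> ball b r c -> ball a e c.
  rewrite -!ball_normE /= => ba bc.
  have -> : a - c = (a - b) + (b - c) by rewrite subrKA.
  rewrite [e]splitr (le_lt_trans (ler_normD _ _))// ltrD//.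
  - by rewrite distrC (lt_trans ba ke).
  - exact: lt_trans bc ke.
have BW : B (q, w, N) `<=` W.
  move=> [y1 y2] [/= yq [_ yw]]; apply: eU; split=> // i j.
  rewrite (ord1 i); case: (unliftP ord0 j) => [j' ->|->].
  - by rewrite !consrVS; apply: tri (pw j') _; have := yw 0 j'; rewrite mxE.
  - by rewrite !consrV0; exact: tri pq yq.
exists (pickle ((q, w, N) : I)); first exact: Logic.I.
rewrite /F pickleK; case: asboolP => // _; split; first exact: pq.
by split=> // i j; rewrite (ord1 i) mxE; exact: pw.
Qed.

End consrV.

Section consrV_measure.
Context {R : realType} {n : nat}.
Variable mu : {sigma_finite_measure set 'rV[R]_n -> \bar R}.

Let nu : {measure set (measurableTypeR R * 'rV[R]_n)%type -> \bar R} :=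
  (@lebesgue_measure R \x mu)%E.

Definition consrV_measure : set 'rV[R]_n.+1 -> \bar R :=
  pushforward nu consrV.

Let mpre A : measurable A -> measurable (@consrV R n @^-1` A).
Proof.
by move=> mA; rewrite -[X in measurable X]setTI; exact: measurable_consrV.
Qed.

Let consrV_measure0 : consrV_measure set0 = 0%E.
Proof. by rewrite /consrV_measure /pushforward preimage_set0 measure0. Qed.

Let consrV_measure_ge0 A : (0 <= consrV_measure A)%E.
Proof. exact: (@measure_ge0 _ _ _ nu). Qed.

Let consrV_measure_sigma_additive : semi_sigma_additive consrV_measure.
Proof.
move=> F mF tF mUF; rewrite /consrV_measure /pushforward preimage_bigcup.
apply: measure_semi_sigma_additive.
- by move=> k; exact: mpre.
- apply/trivIsetP => i j _ _ ij; rewrite -preimage_setI.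
  by move/trivIsetP : tF => /(_ _ _ _ _ ij) ->//; rewrite preimage_set0.
- by rewrite -preimage_bigcup; exact: mpre.
Qed.

HB.instance Definition _ := isMeasure.Build _ _ _ consrV_measure
  consrV_measure0 consrV_measure_ge0 consrV_measure_sigma_additive.

Let consrV_measure_sigma_finite : sigma_finite setT consrV_measure.
Proof.
have /sigma_finiteP[F [TF ndF Foo]] := sigma_finiteT (@lebesgue_measure R).
have /sigma_finiteP[G [TG ndG Goo]] := sigma_finiteT mu.
have nuE k : consrV_measure (unconsrV @^-1` (F k `*` G k)) =
    (lebesgue_measure (F k) * mu (G k))%E.
  rewrite /consrV_measure /pushforward.
  have -> : consrV @^-1` (unconsrV @^-1` (F k `*` G k)) = F k `*` G k.
    by apply/funext => p; rewrite -[in RHS](consrVK p).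
  by apply: product_measure1E; [exact: (Foo k).1|exact: (Goo k).1].
exists (fun k => unconsrV @^-1` (F k `*` G k)).
  apply/esym/seteqP; split=> // v _.
  have [a _ Fa] : (\bigcup_k F k) (unconsrV v).1 by rewrite -TF.
  have [b _ Gb] : (\bigcup_k G k) (unconsrV v).2 by rewrite -TG.
  exists (maxn a b) => //; split.
  - by move: Fa; exact/subsetPset/ndF/leq_maxl.
  - by move: Gb; exact/subsetPset/ndG/leq_maxr.
move=> k; have [mF Fk] := Foo k; have [mG Gk] := Goo k; split.
  rewrite -[X in measurable X]setTI; apply: measurable_unconsrV => //.
  exact: measurableX.
by rewrite nuE lte_mul_pinfty// ge0_fin_numE.
Qed.

HB.instance Definition _ := Measure_isSigmaFinite.Build _ _ _ consrV_measure
  consrV_measure_sigma_finite.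

End consrV_measure.

Fixpoint lebesgue_rV (R : realType) (n : nat) :
    {sigma_finite_measure set 'rV[R]_n -> \bar R} :=
  match n with
  | 0 => \d_(0 : 'rV[R]_0)
  | n'.+1 => consrV_measure (lebesgue_rV R n')
  end.

Lemma lebesgue_rVS (R : realType) (n : nat) (A : set 'rV[R]_n.+1) :
  lebesgue_rV R n.+1 A =
  (@lebesgue_measure R \x lebesgue_rV R n)%E (consrV @^-1` A).
Proof. by []. Qed.

Lemma lebesgue_rV_box (R : realType) (n : nat) (A : 'I_n -> set R) :
  (forall i, measurable (A i)) ->
  lebesgue_rV R n [set v | forall i, A i (v 0 i)] =
    (\prod_(i < n) lebesgue_measure (A i))%E.
Proof.
elim: n A => [|n IH] A mA.
  by rewrite big_ord0 /= diracE mem_set// => -[].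
set B := [set v : 'rV[R]_n | forall i, A (lift ord0 i) (v 0 i)].
have mB : measurable B.
  rewrite (_ : B = \bigcap_(i in [set: 'I_n])
      (fun v : 'rV[R]_n => v 0 i) @^-1` A (lift ord0 i)); last first.
    by apply/seteqP; split=> [v Bv i _|v Bv i]; exact: Bv.
  apply: fin_bigcap_measurable => // i _.
  by rewrite -[X in measurable X]setTI; apply: measurable_coord => //; exact: mA.
rewrite big_ord_recl -(IH (fun i => A (lift ord0 i)))//.
rewrite lebesgue_rVS [X in (_ \x _)%E X](_ : _ = A ord0 `*` B).
  by apply: product_measure1E => //; exact: mA.
apply/seteqP; split=> [p Ap|p [Ap Bp] i] /=.
- split; first by have := Ap ord0; rewrite consrV0.
  by move=> i; have := Ap (lift ord0 i); rewrite consrVS.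
- case: (unliftP ord0 i) => [j ->|->]; last by rewrite consrV0.
  by rewrite consrVS; exact: Bp.
Qed.

Section calculus.
Context {R : realType} {d : nat}.
Implicit Types (f : 'rV[R]_d -> R) (x : 'rV[R]_d).

Definition grad f x : 'rV[R]_d := \row_i 'D_(delta_mx 0 i) f x.

Definition twice_differentiable f :=
  (forall x, differentiable f x) /\ (forall x, differentiable (grad f) x).

(* 'J (grad f) x is the Hessian of f at x. *)
Definition hessian_ge f x (m : R) :=
  forall v : 'rV[R]_d, m * dotrV v v <= dotrV (v *m 'J (grad f) x) v.

Definition iter_partial (s : seq 'I_d) f : 'rV[R]_d -> R :=
  foldr (fun i g => 'D_(delta_mx 0 i) g) f s.

(* Smooth with bounded derivatives at each order; s = [::] is order 0, so f
   itself is bounded. *)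
Definition smooth_bounded f := forall s : seq 'I_d,
  (forall x, differentiable (iter_partial s f) x) /\
  (exists M : R, forall x, `|iter_partial s f x| <= M).

Definition legendre (F : 'rV[R]_d -> \bar R) (a : 'rV[R]_d) : \bar R :=
  ereal_sup [set (dotrV a xi)%:E - F xi | xi in [set: 'rV[R]_d]]%E.

End calculus.

Section jump_family.
Context {R : realType} {d : nat}.
Variable mu : 'rV[R]_d -> {measure set 'rV[R]_d -> \bar R}.

Definition has_density (g : 'rV[R]_d -> 'rV[R]_d -> R) :=
  forall x A, measurable A ->
    mu x A = (\int[lebesgue_rV R d]_(z in A) (g x z)%:E)%E.

(* The integrand is nonnegative, so the integral always exists in [0, +oo]. *)
Definition hamiltonian (x xi : 'rV[R]_d) : \bar R :=
  (\int[mu x]_z (expR (dotrV z xi) - 1 - dotrV z xi)%:E)%E.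

Definition lagrangian (x : 'rV[R]_d) : 'rV[R]_d -> \bar R :=
  legendre (hamiltonian x).

Definition jump_operator (h : R) (f : 'rV[R]_d -> R) (x : 'rV[R]_d) : R :=
  \int[mu x]_z (f (x + h *: z) - f x - h * dotrV z (grad f x)).

End jump_family.

Section lagrangian_cost.
Context {R : realType} {d : nat}.
Variable L : 'rV[R]_d -> 'rV[R]_d -> \bar R.

(* Meaningful for a finite L only. *)
Definition relative_modulus (delta : R) : \bar R :=
  ereal_sup [set r | exists x x' a : 'rV[R]_d, enorm (x - x') < delta /\
    r = (`|fine (L x' a) - fine (L x a)| / (1 + fine (L x a)))%:E].

(* A curve on [0, 1] is a total function of which only the values on [0, 1]
   matter. A C^1 curve on a closed interval is the restriction of a C^1 curve
   on R; as consecutive pieces share their endpoint, phi is continuous. *)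
Definition C1_curve (psi : R -> 'rV[R]_d) :=
  (forall t, derivable psi t 1) /\ continuous (derive1 psi).

Definition piecewise_C1 (phi : R -> 'rV[R]_d) :=
  exists s : seq R, [/\ path <%R 0 s, last 0 s = 1 &
    forall k, (k < size s)%N -> exists2 psi, C1_curve psi &
      forall t, nth 0 (0 :: s) k <= t <= nth 0 s k -> phi t = psi t].

(* The derivative is only meaningful off the finitely many breakpoints. *)
Definition action (phi : R -> 'rV[R]_d) : \bar R :=
  (\int[@lebesgue_measure R]_(t in `[0%R, 1%R]) L (phi t) (derive1 phi t))%E.

Definition cost (x y : 'rV[R]_d) : \bar R :=
  ereal_inf [set action phi | phi in
    [set phi | [/\ piecewise_C1 phi, phi 0 = x & phi 1 = y]]].

End lagrangian_cost.

Section semigroup.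
Context {R : realType} {d : nat}.
Variable Q : R -> R.-pker 'rV[R]_d ~> 'rV[R]_d.

Definition markov_semigroup :=
  (forall x A, measurable A -> Q 0 x A = \d_x A) /\
  (forall s t, 0 <= s -> 0 <= t -> forall x A, measurable A ->
    Q (s + t) x A = (\int[Q s x]_y Q t y A)%E).

Definition semigroup_op (t : R) (f : 'rV[R]_d -> R) (x : 'rV[R]_d) : R :=
  \int[Q t x]_y f y.

(* On the smooth functions with bounded derivatives, A is Dynkin's weak
   infinitesimal generator of Q: the limit of (Q_t f - f) / t as t -> 0+ is
   pointwise and bounded. *)
Definition generated_by (A : ('rV[R]_d -> R) -> 'rV[R]_d -> R) :=
  forall f, smooth_bounded f ->
    (forall x, t^-1 * (semigroup_op t f x - f x) @[t --> 0^'+] --> A f x) /\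
    (exists M : R, forall t x, 0 < t ->
      `|t^-1 * (semigroup_op t f x - f x)| <= M).

End semigroup.

(* Main.v *)
From HB Require Import structures.
Require Import Defs.
From mathcomp Require Import all_boot all_order all_algebra.
From mathcomp Require Import all_classical all_reals all_analysis.
From mathcomp Require Import ring lra measurable_realfun.
Import Order.TTheory GRing.Theory Num.Theory.
Import numFieldNormedType.Exports.

Set Implicit Arguments.
Unset Strict Implicit.
Unset Printing Implicit Defensive.

Local Open Scope classical_set_scope.
Local Open Scope ring_scope.

(** Let I be the infimum of the cost over the ball O. For 0 <= J < I the
probability P^h_1(x, O) is bounded by exp ((- J + eta) / h + K) with K
independent of h, by integrating against the semigroup an exponential of a
subsolution of the Hamilton-Jacobi equation.

Applied to F = exp (W / h), the generator L^h / h gives F H(y, W') / h, up to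
F K times an exponential moment of the jumps when W has bounded first and second
derivatives ([jump_operator_expR_le]); these moments are bounded uniformly in the
position because H <= H1 ([moment_integral]). If dW/ds + H(y, W') <= err, then
exp ((W_s - s err) / h) decreases along the semigroup, up to a factor which is
bounded as h tends to 0 ([supersolution_decay]). A family with W <= - J at x at
the initial time and W close to 0 on O at the final time yields the bound.

The subsolution comes from control. With a Lipschitz terminal cost gg vanishing
on O and equal to J away from O, let v_j be the least action over j steps of
length tau plus the terminal cost ([value]). Then - v_j satisfies the subsolution
inequality in the discrete form
v_(j+1) y - v_j (y + tau a) <= tau L(y, a). The functions v_j are only uniformly
continuous. Two averages repair this while keeping the inequality up to small
errors ([subsolution_step]): a mollification in space, which the uniform relative
continuity of L in the position allows, and an average over m consecutive times,
after which the gradients at times j and j + 1 differ by O(1 / m) and the linear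
interpolation in time is harmless. The differential inequality follows from the
discrete one by taking for a the speed dual to the gradient, namely the mean of
the exponentially tilted jump measure ([lagrangian_duality], [one_step_bound]);
this speed is bounded uniformly in y, hence Taylor remainders are uniform.

It remains to see that v_n y >= J for y close to x and n large. Otherwise a
near-optimal sequence of steps is a polygon from y ending close to O, with a
discretised action below J. Translating it to start at x, and adding a small drift
on the steps of moderate speed so that it ends in O, one gets a genuine curve whose
action is below I ([paths_cost_near]), a contradiction. Here the Lipschitz
continuity of L on bounded sets of speeds controls the drift, and superlinearity
of L shows that at least half of the steps are slow and that no step is long. *)

(** * The l1 norm and first-order expansions *)

Section l1norm.
Context {R : realType} {d : nat}.
Implicit Types u v : 'rV[R]_d.

(** The norm used in all estimates: its exponential is dominated by finitely many
exponentials of linear forms ([moment_le]), and it bounds increments through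
partial derivatives. *)
Definition l1norm v : R := \sum_i `|v 0 i|.

Lemma l1norm_ge0 v : 0 <= l1norm v.
Proof. exact: sumr_ge0. Qed.

Lemma coord_le_l1norm v i : `|v 0 i| <= l1norm v.
Proof. by rewrite /l1norm (bigD1 i)//= lerDl sumr_ge0. Qed.

Lemma l1norm0 : l1norm 0 = 0.
Proof. by rewrite /l1norm big1// => i _; rewrite mxE normr0. Qed.

Lemma l1normD u v : l1norm (u + v) <= l1norm u + l1norm v.
Proof. by rewrite -big_split/=; apply: ler_sum => i _; rewrite mxE ler_normD. Qed.

Lemma l1normZ a v : l1norm (a *: v) = `|a| * l1norm v.
Proof. by rewrite mulr_sumr; apply: eq_bigr => i _; rewrite mxE normrM. Qed.

Lemma l1normN v : l1norm (- v) = l1norm v.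
Proof. by rewrite -scaleN1r l1normZ normrN1 mul1r. Qed.

Lemma le_l1norm u v : (forall i, `|u 0 i| <= `|v 0 i|) -> l1norm u <= l1norm v.
Proof. by move=> uv; apply: ler_sum. Qed.

Lemma l1norm_delta i (t : R) : l1norm (t *: delta_mx 0 i) = `|t|.
Proof.
rewrite l1normZ /l1norm (bigD1 i)//= big1 ?addr0 ?mxE ?eqxx ?normr1 ?mulr1//.
by move=> j /negPf ji; rewrite mxE ji andbF normr0.
Qed.

Lemma coord_le_norm v i : `|v 0 i| <= `|v|.
Proof. by rewrite [`|v|]mx_normrE; exact: (le_bigmax _ (fun i => `|v i.1 i.2|) (0, i)). Qed.

Lemma l1norm_le_norm v : l1norm v <= d%:R * `|v|.
Proof.
apply: (@le_trans _ _ (\sum_(i < d) `|v|)).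
  by apply: ler_sum => i _; exact: coord_le_norm.
by rewrite sumr_const card_ord mulr_natl.
Qed.

Lemma dotrV_le_l1norm u v B : (forall i, `|u 0 i| <= B) ->
  `|dotrV v u| <= B * l1norm v.
Proof.
move=> uB; rewrite /dotrV; apply: (le_trans (ler_norm_sum _ _ _)).
by rewrite mulr_sumr; apply: ler_sum => i _; rewrite normrM mulrC ler_wpM2r.
Qed.

Lemma dotrV_continuous u : continuous (fun v : 'rV[R]_d => dotrV v u).
Proof.
apply: continuous_big => [|i _]; first exact: add_continuous.
move=> v; have c := @coord_continuous R 1 d 0 i v.
by apply: continuousM; [exact: c|exact: cst_continuous].
Qed.

End l1norm.

Section partial_derivatives.
Context {R : realType} {d : nat}.
Implicit Types (f : 'rV[R]_d -> R) (x v : 'rV[R]_d).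

Local Notation e i := (delta_mx 0 i : 'rV[R]_d).

Definition has_partials f := forall i x, derivable f x (e i).

Lemma is_derive_line f x v (t : R) : derivable f (x + t *: v) v ->
  is_derive t 1 (fun s => f (x + s *: v)) ('D_v f (x + t *: v)).
Proof.
move=> /derivableP[df dfE].
have E : (fun h : R => h^-1 *: (((fun s : R => f (x + s *: v)) \o shift t) (h *: 1) - f (x + t *: v)))
  = (fun h => h^-1 *: ((f \o shift (x + t *: v)) (h *: v) - f (x + t *: v))).
  apply/funext => h /=; congr (_ *: (f _ - _)).
  by rewrite scalerDl /GRing.scale/= mulr1 addrCA.
split; first by rewrite /derivable E.
by rewrite /derive E.
Qed.

Lemma mean_value_line f x v (t : R) : (forall s, derivable f (x + s *: v) v) ->
  exists2 th : R, `|th| <= `|t| &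
    f (x + t *: v) - f x = t * 'D_v f (x + th *: v).
Proof.
move=> df.
have dg s := is_derive_line (df s).
have cg a b : {within `[a, b], continuous (fun s : R => f (x + s *: v))}.
  by apply: derivable_within_continuous => s _; have [] := dg s.
have [t0|t0|<-] := ltgtP 0 t; last 1 first.
- by exists 0; rewrite ?normr0// scale0r addr0 subrr mul0r.
- have [c /[!in_itv]/= /andP[c0 ct]] := MVT t0 (fun s _ => dg s) (cg _ _).
  rewrite scale0r addr0 subr0 mulrC => E; exists c => //.
  by rewrite !ger0_norm ?ltW.
- have [c /[!in_itv]/= /andP[c0 ct]] := MVT t0 (fun s _ => dg s) (cg _ _).
  rewrite scale0r addr0 sub0r mulrN => E; exists c.
    by rewrite !ler0_norm ?lerN2 ?ltW.
  by rewrite -[LHS]opprK opprB E opprK mulrC.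
Qed.

(** The coordinates of v are added one at a time, so that only derivatives along
the axes occur. *)
Lemma mean_value_partials f x v : has_partials f ->
  exists q : 'I_d -> 'rV[R]_d, (forall i, l1norm (q i) <= l1norm v) /\
    f (x + v) - f x = \sum_i v 0 i * 'D_(e i) f (x + q i).
Proof.
move=> df.
pose p k : 'rV[R]_d := \row_j (if (j < k)%N then v 0 j else 0).
have pS (i : 'I_d) : p i.+1 = p i + v 0 i *: e i.
  apply/rowP => j; rewrite !mxE eqxx/= ltnS; case: (ltngtP j i) => ji.
  - by rewrite (_ : j == i = false) ?mulr0 ?addr0//; apply/eqP => E; rewrite E ltnn in ji.
  - by rewrite (_ : j == i = false) ?mulr0 ?addr0//; apply/eqP => E; rewrite E ltnn in ji.
  - by move/val_inj: ji => ->; rewrite eqxx mulr1 add0r.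
have step (i : 'I_d) : exists q : 'rV[R]_d, l1norm q <= l1norm v /\
    f (x + p i.+1) - f (x + p i) = v 0 i * 'D_(e i) f (x + q).
  have [th tv E] := mean_value_line (v 0 i) (fun s => df i (x + p i + s *: e i)).
  exists (p i + th *: e i); split; last by rewrite pS !addrA.
  apply: le_l1norm => j; rewrite !mxE eqxx/=; case: ifPn => ji.
    rewrite (_ : j == i = false) ?mulr0 ?addr0//; apply/eqP => E'.
    by rewrite E' ltnn in ji.
  by case: eqP => [->|_]; rewrite add0r ?mulr1// mulr0 normr0.
have [q qP] := choice step.
exists q; split => [i|]; first by case: (qP i).
have <- : \sum_(i < d) (f (x + p i.+1) - f (x + p i)) = f (x + v) - f x.
  rewrite -(big_mkord xpredT (fun i => f (x + p i.+1) - f (x + p i))).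
  rewrite telescope_sumr//; congr (f _ - f _).
    by congr (_ + _); apply/rowP => j; rewrite mxE ltn_ord.
  by rewrite -[RHS]addr0; congr (_ + _); apply/rowP => j; rewrite !mxE.
by apply: eq_bigr => i _; case: (qP i).
Qed.

Lemma partials_bounded_lipschitz f M : has_partials f ->
  (forall i x, `|'D_(e i) f x| <= M) ->
  forall x v, `|f (x + v) - f x| <= M * l1norm v.
Proof.
move=> df fM x v; have [q [_ ->]] := mean_value_partials x v df.
apply: (le_trans (ler_norm_sum _ _ _)); rewrite mulr_sumr.
by apply: ler_sum => i _; rewrite normrM mulrC ler_wpM2r.
Qed.

Lemma dotrV_grad f x v : dotrV v (grad f x) = \sum_i v 0 i * 'D_(e i) f x.
Proof. by apply: eq_bigr => i _; rewrite mxE. Qed.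

Lemma partials_lipschitz_taylor f K : has_partials f ->
  (forall i x v, `|'D_(e i) f (x + v) - 'D_(e i) f x| <= K * l1norm v) ->
  forall x v, `|f (x + v) - f x - dotrV v (grad f x)| <= K * l1norm v ^+ 2.
Proof.
move=> df fK x v; have [q [qv ->]] := mean_value_partials x v df.
rewrite dotrV_grad -sumrB; apply: (le_trans (ler_norm_sum _ _ _)).
rewrite expr2 mulrA mulr_sumr; apply: ler_sum => i _.
rewrite -mulrBr normrM mulrC ler_wpM2r//.
have K0 : 0 <= K.
  have := fK i x (1 *: e i); rewrite l1norm_delta normr1 mulr1.
  exact: le_trans (normr_ge0 _).
by rewrite (le_trans (fK _ _ _))// ler_wpM2l.
Qed.

(** Total differentiability is obtained from partial derivatives alone, through a
quadratic remainder. *)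
Lemma taylor_differentiable f x K : (forall v,
    `|f (x + v) - f x - dotrV v (grad f x)| <= K * l1norm v ^+ 2) ->
  differentiable f x.
Proof.
move=> fK.
pose A v := dotrV v (grad f x).
have Alin : linear A.
  move=> a u w; rewrite /A /dotrV scaler_sumr -big_split/=.
  by apply: eq_bigr => i _; rewrite !mxE /GRing.scale/= mulrDl mulrA.
pose A' : {linear 'rV[R]_d -> R} := HB.pack A (GRing.isLinear.Build _ _ _ _ _ Alin).
have cA : continuous (A' : 'rV[R]_d -> R).
  exact: dotrV_continuous.
have diffU := @diff_unique R 'rV[R]_d R f A' x cA.
suff Af : ltac:(match type of diffU with ?P -> _ => exact P end).
  by apply/diff_locallyP; rewrite (diffU Af).
move=> {diffU}.
apply/eqaddoP => _/posnumP[eps].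
  have Kd : 0 <= `|K| * d%:R ^+ 2 by rewrite mulr_ge0// exprn_ge0.
  have e0 : 0 < eps%:num / (`|K| * d%:R ^+ 2 + 1) by rewrite divr_gt0// ltr_wpDl.
  have nv : \forall v \near (0 : 'rV[R]_d),
      `|v| <= eps%:num / (`|K| * d%:R ^+ 2 + 1).
    exact: pseudometric_normed_Zmodule.nbhs0_le.
  apply: filterS nv => v vle; rewrite /= !fctE/=.
  have -> : f (v + x) - (f x + A v) = f (x + v) - f x - A v.
    by rewrite opprD addrA (addrC v x).
  rewrite (le_trans (fK v))//.
  have H1 : l1norm v ^+ 2 <= d%:R ^+ 2 * `|v| * `|v|.
    rewrite -mulrA -expr2 -exprMn ler_pXn2r ?nnegrE ?mulr_ge0// ?l1norm_ge0//.
    exact: l1norm_le_norm.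
  rewrite (@le_trans _ _ (`|K| * l1norm v ^+ 2))//.
    by rewrite ler_wpM2r ?exprn_ge0 ?l1norm_ge0// ler_norm.
  rewrite (@le_trans _ _ (`|K| * (d%:R ^+ 2 * `|v| * `|v|)))// ?ler_wpM2l//.
  rewrite !mulrA ler_wpM2r//.
  move: vle; rewrite ler_pdivlMr ?ltr_wpDl// => H2.
  rewrite (le_trans _ H2)// mulrDr mulr1 [`|v| * _]mulrC expr2 !mulrA lerDl//.
Qed.

End partial_derivatives.

(** * Functions with bounded partial derivatives of all orders *)

Section smooth.
Context {R : realType} {d : nat}.
Implicit Types (f g : 'rV[R]_d -> R) (x v : 'rV[R]_d).

Local Notation e i := (delta_mx 0 i : 'rV[R]_d).

Lemma is_derive_line0 f x v (df : R) :
  is_derive (0 : R) 1 (fun t : R => f (x + t *: v)) df -> is_derive x v f df.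
Proof.
move=> [h <-].
have E : (fun h : R => h^-1 *: (((fun s : R => f (x + s *: v)) \o shift 0) (h *: 1) - f (x + 0 *: v)))
  = (fun h => h^-1 *: ((f \o shift x) (h *: v) - f x)).
  apply/funext => t /=; congr (_ *: (f _ - f _)).
    by rewrite addr0 /GRing.scale/= mulr1 addrC.
  by rewrite scale0r addr0.
split; first by rewrite /derivable -E.
by rewrite /derive -E.
Qed.

Lemma is_derive_expR_comp f x v (df : R) : is_derive x v f df ->
  is_derive x v (expR \o f) (df * expR (f x)).
Proof.
move=> dff; apply: is_derive_line0.
have := @is_derive_line _ _ f x v 0.
rewrite scale0r addr0 => /(_ _)/[!derive_val]-/(_ _) h.
have {}h : is_derive (0 : R) 1 (fun t : R => f (x + t *: v)) df.
  by apply: h; case: dff.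
have := @is_derive1_comp _ expR (fun t : R => f (x + t *: v)) 0 _ _ (is_derive_expR _) h.
by rewrite scale0r addr0 mulrC.
Qed.

(** Boundedness and derivability along the axes, by recursion on the order:
stability under sums, products and exponentials is then an induction. *)
Fixpoint smooth_upto (n : nat) f : Prop :=
  (exists M : R, forall x, `|f x| <= M) /\
  if n is n'.+1 then
    forall i, (forall x, derivable f x (e i)) /\ smooth_upto n' ('D_(e i) f)
  else True.

Definition smooth f := forall n, smooth_upto n f.

Lemma smooth_upto_bounded n f : smooth_upto n f ->
  exists M : R, forall x, `|f x| <= M.
Proof. by case: n => [|n] []. Qed.

Lemma smooth_uptoW n f : smooth_upto n.+1 f -> smooth_upto n f.
Proof.
elim: n f => [|n IH] f [fM fd]; first by split.
by split=> // i; have [fi] := fd i; split=> //; exact: IH.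
Qed.

Lemma smooth_upto_ext n f g : (forall x, f x = g x) ->
  smooth_upto n f -> smooth_upto n g.
Proof. by move=> /funext ->. Qed.

Lemma smooth_upto_partials f :
  smooth_upto 1 f -> has_partials f.
Proof. by move=> [_ fd] i; case: (fd i). Qed.

Lemma uniform_bound (P : 'I_d -> 'rV[R]_d -> R) :
  (forall i, exists M : R, forall x, `|P i x| <= M) ->
  exists2 M : R, 0 <= M & forall i x, `|P i x| <= M.
Proof.
move=> /choice[M PM]; exists (\sum_i `|M i|); first exact: sumr_ge0.
move=> i x; apply: (le_trans (PM i x)); apply: (le_trans (ler_norm _)).
by rewrite (bigD1 i)//= lerDl sumr_ge0.
Qed.

Lemma smooth_upto_grad_bounded n f : smooth_upto n.+1 f ->
  exists2 M : R, 0 <= M & forall i x, `|'D_(e i) f x| <= M.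
Proof.
move=> [_ fd]; apply: uniform_bound => i; have [_] := fd i.
exact: smooth_upto_bounded.
Qed.

Lemma smooth_upto_lipschitz n f : smooth_upto n.+1 f ->
  exists2 M : R, 0 <= M & forall x v, `|f (x + v) - f x| <= M * l1norm v.
Proof.
move=> fn; have [M M0 fM] := smooth_upto_grad_bounded fn; exists M => // x v.
by apply: partials_bounded_lipschitz => // i y; case: fn => _ /(_ i)[].
Qed.

Lemma smooth_upto_taylor f : smooth_upto 2 f ->
  exists2 K : R, 0 <= K & forall x v,
    `|f (x + v) - f x - dotrV v (grad f x)| <= K * l1norm v ^+ 2.
Proof.
move=> /[dup] /smooth_uptoW f1 f2.
have /choice[K fK] : forall i, exists K : R, 0 <= K /\
    forall x v, `|'D_(e i) f (x + v) - 'D_(e i) f x| <= K * l1norm v.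
  by case: f2 => _ fd i; have [_ h] := fd i;
    have [K K0 fK] := @smooth_upto_lipschitz 0 _ h; exists K.
exists (\sum_i K i); first by apply: sumr_ge0 => i _; case: (fK i).
apply: partials_lipschitz_taylor => [|i x v]; first exact: smooth_upto_partials.
have [_ h] := fK i; apply: (le_trans (h x v)); rewrite ler_wpM2r ?l1norm_ge0//.
by rewrite (bigD1 i)//= lerDl sumr_ge0// => j _; case: (fK j).
Qed.

Lemma smooth_upto_iter n f s : smooth_upto (n + size s) f ->
  smooth_upto n (iter_partial s f).
Proof.
elim: s n => [|i s IH] n; first by rewrite addn0.
by rewrite /= addnS -addSn => /IH[_ /(_ i)[]].
Qed.

(** An iterated partial derivative is differentiable because two further orders of
partial derivatives bound its Taylor remainder. *)
Lemma smooth_smooth_bounded f : smooth f -> smooth_bounded f.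
Proof.
move=> fs s; have fi n := smooth_upto_iter (fs (n + size s)%N).
split; last exact: smooth_upto_bounded (fi 0%N).
have [K K0 fK] := smooth_upto_taylor (fi 2%N).
by move=> x; exact: taylor_differentiable (fK x).
Qed.

Lemma smooth_upto_cst n (a : R) : smooth_upto n (fun=> a).
Proof.
elim: n a => [|n IH] a; split=> //; try by exists `|a|.
move=> i; split=> [x|]; first exact: derivable_cst.
rewrite (_ : 'D_(e i) _ = fun=> 0)//; apply/funext => x; exact: derive_cst.
Qed.

Lemma smooth_uptoD n f g : smooth_upto n f -> smooth_upto n g ->
  smooth_upto n (fun x => f x + g x).
Proof.
elim: n f g => [|n IH] f g [[M fM] fd] [[N gN] gd];
  (split; first by exists (M + N) => x; rewrite (le_trans (ler_normD _ _))// lerD) => //.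
move=> i; have [fi fdi] := fd i; have [gi gdi] := gd i; split.
  by move=> x; apply: derivableD.
apply: smooth_upto_ext (IH _ _ fdi gdi) => x /=.
by rewrite deriveD.
Qed.

Lemma smooth_uptoM n f g : smooth_upto n f -> smooth_upto n g ->
  smooth_upto n (fun x => f x * g x).
Proof.
elim: n f g => [|n IH] f g /[dup] f0 [[M fM] fd] /[dup] g0 [[N gN] gd];
  (split; first by exists (M * N) => x; rewrite normrM ler_pM) => //.
move=> i; have [fi fdi] := fd i; have [gi gdi] := gd i; split.
  by move=> x; apply: derivableM.
have := smooth_uptoD (IH _ _ (smooth_uptoW f0) gdi) (IH _ _ (smooth_uptoW g0) fdi).
apply: smooth_upto_ext => x /=.
by rewrite deriveM.
Qed.

Lemma smooth_upto_expR n f : smooth_upto n f -> smooth_upto n (expR \o f).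
Proof.
elim: n f => [|n IH] f /[dup] f0 [[M fM] fd];
  (split; first by exists (expR M) => x /=;
    rewrite ger0_norm ?expR_ge0// ler_expR (le_trans (ler_norm _))) => //.
move=> i; have [fi fdi] := fd i.
have dexp x := is_derive_expR_comp (derivableP (fi x)).
split; first by move=> x; case: (dexp x).
have := smooth_uptoM fdi (IH _ (smooth_uptoW f0)).
by apply: smooth_upto_ext => x /=; case: (dexp x).
Qed.

Lemma smoothD f g : smooth f -> smooth g -> smooth (fun x => f x + g x).
Proof. by move=> fs gs n; exact: smooth_uptoD. Qed.

Lemma smoothM f g : smooth f -> smooth g -> smooth (fun x => f x * g x).
Proof. by move=> fs gs n; exact: smooth_uptoM. Qed.

Lemma smoothZ a f : smooth f -> smooth (fun x => a * f x).
Proof. by move=> fs n; apply: smooth_uptoM => //; exact: smooth_upto_cst. Qed.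

Lemma smooth_expR f : smooth f -> smooth (expR \o f).
Proof. by move=> fs n; exact: smooth_upto_expR. Qed.

Lemma smooth_continuous f : smooth f -> continuous f.
Proof.
move=> /smooth_smooth_bounded/(_ [::])[fd _] x.
exact: differentiable_continuous.
Qed.

Lemma continuous_measurable_rV f : continuous f ->
  measurable_fun [set: 'rV[R]_d] f.
Proof.
move=> cf; apply: (measurability (RGenOpens.G (R := R)) (RGenOpens.measurableE R)).
move=> _ [_ [a [b ->]] <-]; rewrite setTI; apply: rV_open_measurable.
by apply: open_comp => //= v _; exact: cf.
Qed.

End smooth.

(** * Flat bumps *)

Section flat_function.
Context {R : realType}.

Lemma is_derive_quadratic (f : R -> R) (x df K : R) :
  (forall h, `|f (x + h) - f x - h * df| <= K * h ^+ 2) -> is_derive x 1 f df.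
Proof.
move=> fK.
have cv : h^-1 *: ((f \o shift x) (h *: 1) - f x) @[h --> 0^'] --> df.
  apply/cvgrPdist_le => e e0.
  have K0 : 0 <= K.
    by have := fK 1; rewrite expr1n mulr1; exact: le_trans (normr_ge0 _).
  have e1 : 0 < e / (K + 1) by rewrite divr_gt0// ltr_wpDl.
  near=> h.
  have h0 : h != 0 by near: h; exact: nbhs_dnbhs_neq.
  rewrite /= [h *: 1]mulr1 (addrC h).
  have -> : df - h^-1 *: (f (x + h) - f x) = - (h^-1 * (f (x + h) - f x - h * df)).
    by rewrite /GRing.scale/= [in RHS]mulrBr mulKf// opprB.
  rewrite normrN normrM normfV ler_pdivrMl ?normr_gt0//.
  rewrite (le_trans (fK h))// -real_normK ?num_real// expr2 mulrA mulrC ler_wpM2l//.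
  have : `|h| <= e / (K + 1) by near: h; apply: dnbhs0_le.
  rewrite ler_pdivlMr ?ltr_wpDl// mulrDr mulr1 mulrC; apply: le_trans.
  by rewrite lerDl.
split; first by apply/cvg_ex; exists df.
exact/cvg_lim.
Unshelve. all: by end_near. Qed.

Lemma polyexp_bounded (p : {poly R}) :
  exists2 C : R, 0 <= C & forall u : R, 0 <= u -> `|p.[u]| * expR (- u) <= C.
Proof.
suff : forall n : nat, exists2 C : R, 0 <= C & forall u : R, 0 <= u ->
    u ^+ n * `|p.[u]| * expR (- u) <= C.
  move=> /(_ 0%N)[C C0 H]; exists C => // u u0; have := H u u0; rewrite expr0 mul1r; exact.
elim/poly_ind: p => [|p c IH] n.
  by exists 0 => // u _; rewrite horner0 normr0 mulr0 mul0r.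
have [C C0 HC] := IH n.+1.
(* u ^ n exp (- u) is bounded because t <= exp t at t = u / (n + 1). *)
have [D D0 HD] : exists2 D : R, 0 <= D & forall u : R, 0 <= u -> u ^+ n * expR (- u) <= D.
  exists ((n.+1)%:R ^+ n); first by rewrite exprn_ge0.
  move=> u u0; rewrite expRN -ler_pdivlMr ?invr_gt0 ?expR_gt0// invrK.
  have h : u / n.+1%:R <= expR (u / n.+1%:R).
    by apply: le_trans (expR_ge1Dx _); rewrite lerDr.
  have -> : u ^+ n = n.+1%:R ^+ n * (u / n.+1%:R) ^+ n.
    by rewrite -exprMn mulrC divfK.
  rewrite ler_wpM2l ?exprn_ge0//.
  apply: (@le_trans _ _ (expR (u / n.+1%:R) ^+ n)).
    by rewrite lerXn2r ?nnegrE ?expR_ge0// divr_ge0.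
  rewrite -expRM_natl ler_expR mulrA ler_pdivrMr// mulrC ler_wpM2l// ler_nat//.
exists (C + `|c| * D) => [|u u0]; first by rewrite addr_ge0// mulr_ge0.
rewrite hornerD hornerMX hornerC.
apply: (@le_trans _ _ (u ^+ n.+1 * `|p.[u]| * expR (- u) + `|c| * (u ^+ n * expR (- u)))).
  have -> : u ^+ n.+1 * `|p.[u]| * expR (- u) + `|c| * (u ^+ n * expR (- u)) =
      u ^+ n * (`|p.[u] * u| + `|c|) * expR (- u).
    by rewrite normrM (ger0_norm u0) exprS; ring.
  by rewrite ler_wpM2r ?expR_ge0// ler_wpM2l ?exprn_ge0// ler_normD.
by rewrite lerD ?HC// ler_wpM2l ?HD.
Qed.

(** The flat function p (1 / s) exp (- 1 / s), extended by 0 to s <= 0. With an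
arbitrary polynomial p the family is stable under differentiation. *)
Definition flat (p : {poly R}) (s : R) : R :=
  if 0 < s then p.[s^-1] * expR (- s^-1) else 0.

Lemma flat_le0 p s : s <= 0 -> flat p s = 0.
Proof. by rewrite /flat leNgt => /negPf ->. Qed.

(** In the variable u = 1 / s one has du/ds = - u ^ 2. *)
Definition flat_deriv (p : {poly R}) := ((p - p^`()) * 'X^2)%R.

Lemma is_derive_flat p (s : R) : is_derive s 1 (flat p) (flat (flat_deriv p) s).
Proof.
have [s0|s0|->] := ltgtP s 0.
- rewrite (flat_le0 _ (ltW s0)).
  apply: (@near_eq_is_derive _ _ _ (cst 0)) => //; near=> t.
  rewrite /= flat_le0//; near: t.
  by apply: filterS (lt_nbhsl s0) => t /ltW.
- rewrite {2}/flat s0.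
  apply: (@near_eq_is_derive _ _ _ (fun t : R => p.[t^-1] * expR (- t^-1))).
  + near=> t; rewrite /flat ifT//; near: t; exact: lt_nbhsr.
  + have s00 : s != 0 by rewrite gt_eqF.
    have dV : is_derive s (1 : R) (fun t : R => t^-1) (- s ^- 2).
      have [h1 h2] := is_derive_id s (1 : R).
      split; first exact: (@derivableV _ _ id s 1).
      by rewrite (@deriveV _ _ id s 1)//= derive_id /GRing.scale/= mulr1.
    have dp := @is_derive1_comp _ (horner p) (fun t : R => t^-1) s _ _ _ dV.
    have dN : is_derive s 1 (fun t : R => - t^-1) (s ^- 2).
      by apply: is_derive_eq; rewrite opprK.
    have de := @is_derive1_comp _ expR (fun t : R => - t^-1) s _ _ (is_derive_expR _) dN.
    apply: is_derive_eq.
    rewrite /flat_deriv hornerM hornerD hornerN hornerXn /GRing.scale/=.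
    rewrite exprVn; ring.
- rewrite flat_le0//.
  have [C C0 HC] := polyexp_bounded (p * 'X^2).
  apply: (@is_derive_quadratic _ _ _ C) => h.
  rewrite add0r mulr0 subr0 (flat_le0 _ (lexx 0)) subr0 /flat.
  case: ifPn => h0; last by rewrite normr0 mulr_ge0// sqr_ge0.
  have := HC h^-1; rewrite invr_ge0 (ltW h0) => /(_ isT).
  rewrite hornerM hornerXn !normrM (ger0_norm (expR_ge0 _)) => le.
  rewrite -ler_pdivrMr ?exprn_gt0//; apply: le_trans le.
  by rewrite normfV (gtr0_norm h0) expr2 invfM mulrAC.
Unshelve. all: by end_near. Qed.

(** Smooth functions vanishing outside [0, eps], flat at both ends. The family is
closed under differentiation ([kernel_derive]), hence derivatives of all orders of
a mollified function are mollifications by kernels of the same family. *)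
Inductive kernel (eps : R) : (R -> R) -> Prop :=
| kernel_flat p q : kernel eps (fun s => flat p s * flat q (eps - s))
| kernelD k1 k2 : kernel eps k1 -> kernel eps k2 ->
    kernel eps (fun s => k1 s + k2 s)
| kernelZ c k : kernel eps k -> kernel eps (fun s => c * k s).

Lemma kernel_derive eps k : kernel eps k ->
  exists2 k', kernel eps k' & forall s : R, is_derive s 1 k (k' s).
Proof.
elim=> [p q|k1 k2 _ [k1' K1 d1] _ [k2' K2 d2]|c k1 _ [k' K d1]].
- exists (fun s => flat (flat_deriv p) s * flat q (eps - s) +
      (- 1) * (flat p s * flat (flat_deriv q) (eps - s))).
    by apply: kernelD; [|apply: kernelZ]; exact: kernel_flat.
  move=> s; have dp := is_derive_flat p s.
  have dN : is_derive s (1 : R) (fun t : R => eps - t) (- 1).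
    by have := is_deriveB (is_derive_cst eps s (1 : R)) (is_derive_id s (1 : R)); rewrite sub0r.
  have dq := @is_derive1_comp _ _ (fun t : R => eps - t) s _ _ (is_derive_flat q _) dN.
  apply: is_derive_eq; rewrite /GRing.scale/=; ring.
- exists (fun s => k1' s + k2' s); first exact: kernelD.
  by move=> s; have := d1 s; have := d2 s; move=> ? ?; exact: is_deriveD.
- exists (fun s => c * k' s); first exact: kernelZ.
  move=> s; have := d1 s => ?; exact: is_deriveZ.
Qed.

Lemma kernel_out eps k : kernel eps k -> forall s, s <= 0 \/ eps <= s -> k s = 0.
Proof.
elim=> [p q s [s0|es]|k1 k2 _ h1 _ h2 s hs|c k1 _ h s hs].
- by rewrite flat_le0// mul0r.
- by rewrite [X in _ * X]flat_le0 ?mulr0// subr_le0.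
- by rewrite h1// h2// addr0.
- by rewrite h// mulr0.
Qed.

Lemma kernel_continuous eps k : kernel eps k -> continuous k.
Proof.
move=> /kernel_derive[k' _ dk] s.
by apply: differentiable_continuous; apply/derivable1_diffP; case: (dk s).
Qed.

End flat_function.

(** * Convolution along a line *)

Section line_convolution.
Context {R : realType}.
Variable eps : R.
Hypothesis eps0 : 0 < eps.
Local Notation mu := (@lebesgue_measure R).
Local Notation I := (`[0, eps]%classic : set R).

Lemma continuous_integrable (f : R -> R) : continuous f ->
  mu.-integrable I (EFin \o f).
Proof.
move=> cf; apply: continuous_compact_integrable; first exact: segment_compact.
exact: continuous_subspaceT.
Qed.

Lemma within_integrable (f : R -> R) : {within I, continuous f} ->
  mu.-integrable I (EFin \o f).
Proof.
by move=> cf; apply: continuous_compact_integrable; first exact: segment_compact.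
Qed.

Lemma is_derive_Rintegral (G g : R -> R -> R) (M t0 : R) :
  (forall t s : R, t0 - 1 < t < t0 + 1 -> 0 <= s <= eps ->
     is_derive t 1 (G ^~ s) (g t s)) ->
  (forall t : R, t0 - 1 < t < t0 + 1 -> mu.-integrable I (EFin \o G t)) ->
  (forall t s : R, t0 - 1 < t < t0 + 1 -> 0 <= s <= eps -> `|g t s| <= M) ->
  is_derive t0 1 (fun t => \int[mu]_(s in I) G t s) (\int[mu]_(s in I) g t0 s).
Proof.
move=> dG cG gM.
have t0I : `]t0 - 1, t0 + 1[%classic t0 by rewrite /= in_itv/=; lra.
have d1 t s : `]t0 - 1, t0 + 1[%classic t -> I s -> ((G ^~ s)^`())%classic t = g t s.
  rewrite /= !in_itv/= => tI sI; rewrite derive1E.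
  by have [_ ->] := dG t s tI sI.
have intG : forall t, `]t0 - 1, t0 + 1[%classic t -> mu.-integrable I (EFin \o G t).
  by move=> t; rewrite /= in_itv/=; exact: cG.
have derG : forall t s, `]t0 - 1, t0 + 1[%classic t -> I s -> derivable (G ^~ s) t 1.
  by move=> t s; rewrite /= !in_itv/= => tI sI; have [] := dG t s tI sI.
have intM : mu.-integrable I (EFin \o cst `|M|).
  by apply: continuous_integrable => x; exact: cvg_cst.
have bd : forall t s, `]t0 - 1, t0 + 1[%classic t -> I s -> `|partial1of2 G t s| <= cst `|M| s.
  move=> t s tI sI; rewrite /partial1of2 d1//.
  move: tI sI; rewrite /= !in_itv/= => tI sI.
  by rewrite (le_trans (gM _ _ tI sI))// ler_norm.
have mI : measurable (I : set (measurableTypeR R)) by exact: measurable_itv.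
have M0 : forall s : R, 0 <= cst `|M| s by move=> s /=.
split.
  exact: (@derivable_under_integral R _ _ mu G I mI t0 _ _ t0I intG derG _ M0 intM bd).
rewrite -derive1E (@differentiation_under_integral R _ _ mu G I mI t0 _ _ t0I intG derG _ M0 intM bd).
by apply: eq_Rintegral => s /set_mem sI; rewrite /partial1of2 d1.
Qed.

Lemma continuous_primitive (u : R -> R) (a : R) : continuous u ->
  exists U : R -> R, forall x : R, a < x -> is_derive x 1 U (u x).
Proof.
move=> cu; exists (fun x => \int[mu]_(t in `[a, x]) u t) => x ax.
have xx : x < x + 1 by rewrite ltrDl.
have iu : mu.-integrable `[a, x + 1] (EFin \o u).
  apply: continuous_compact_integrable; first exact: segment_compact.
  exact: continuous_subspaceT.
have [h1 h2] := continuous_FTC1_closed xx iu ax (cu x).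
split; first exact: h1.
by rewrite -derive1E; exact: h2.
Qed.

Lemma is_derive_continuous (f : R -> R) (df x : R) : is_derive x 1 f df ->
  {for x, continuous f}.
Proof.
by move=> [df' _]; apply: differentiable_continuous; apply/derivable1_diffP.
Qed.

Lemma is_derive_LR (f df : R -> R) :
  (forall x : R, 0 <= x <= eps -> is_derive x 1 f (df x)) ->
  derivable_oo_LRcontinuous f 0 eps.
Proof.
move=> fd; split.
- move=> x /[!in_itv]/= /andP[x0 x1].
  by case: (fd x) => //; rewrite !ltW.
- apply: cvg_at_right_filter; apply: is_derive_continuous (fd 0 _).
  by rewrite lexx ltW.
- apply: cvg_at_left_filter; apply: is_derive_continuous (fd eps _).
  by rewrite lexx ltW.
Qed.

Lemma continuous_bounded_segment (k : R -> R) : continuous k ->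
  exists2 K : R, 0 <= K & forall s : R, 0 <= s <= eps -> `|k s| <= K.
Proof.
move=> ck.
have : compact (k @` I).
  by apply: continuous_compact; [exact: continuous_subspaceT|exact: segment_compact].
move=> /compact_bounded[N [Nr NP]]; exists (`|N| + 1); first by rewrite addr_ge0.
move=> s sI; apply: (NP (`|N| + 1)); first by rewrite ltr_pwDr// ler_norm.
by exists s => //; rewrite /= in_itv.
Qed.

(** As u is only continuous, it is replaced by a primitive U: integration by parts
turns u k into - U k', without boundary term since k vanishes at 0 and eps, and
differentiation under the integral applies to U k'. *)
Lemma is_derive_convolution (u k k' : R -> R) (M t0 : R) : continuous u ->
  (forall x, `|u x| <= M) ->
  (forall s : R, is_derive s 1 k (k' s)) -> continuous k' ->
  k 0 = 0 -> k eps = 0 ->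
  is_derive t0 1 (fun t => \int[mu]_(s in I) (u (t + s) * k s))
    (- \int[mu]_(s in I) (u (t0 + s) * k' s)).
Proof.
move=> cu uM dk ck' k0 k1.
have [U dU] := continuous_primitive (t0 - 2) cu.
have cut t : continuous (fun s => u (t + s)).
  by move=> s; apply: continuous_comp; [apply: cvgD; [exact: cvg_cst|exact: cvg_id]|exact: cu].
have dUs t s : t0 - 1 < t < t0 + 1 -> 0 <= s <= eps ->
    is_derive s 1 (fun s => U (t + s)) (u (t + s)).
  move=> tI sI; have ts : t0 - 2 < t + s by lra.
  have dD : is_derive s (1 : R) (fun s : R => t + s) 1.
    by have := is_deriveD (is_derive_cst t s (1 : R)) (is_derive_id s (1 : R)); rewrite add0r.
  by have := @is_derive1_comp _ U (fun s : R => t + s) s _ _ (dU _ ts) dD; rewrite mulr1.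
have dUt t s : t0 - 1 < t < t0 + 1 -> 0 <= s <= eps ->
    is_derive t 1 (fun t => U (t + s)) (u (t + s)).
  move=> tI sI; have ts : t0 - 2 < t + s by lra.
  have dD : is_derive t (1 : R) (fun t : R => t + s) 1.
    by have := is_deriveD (is_derive_id t (1 : R)) (is_derive_cst s t (1 : R)); rewrite addr0.
  by have := @is_derive1_comp _ U (fun t : R => t + s) t _ _ (dU _ ts) dD; rewrite mulr1.
have intUk t : t0 - 1 < t < t0 + 1 ->
    mu.-integrable I (EFin \o (fun s => U (t + s) * k' s)).
  move=> tI; apply: within_integrable; apply: continuous_in_subspaceT => s.
  rewrite inE /= in_itv/= => sI; apply: continuousM; last exact: ck'.
  exact: is_derive_continuous (dUs t s tI sI).
have [K K0 kM] := continuous_bounded_segment ck'.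
have key : is_derive t0 1 (fun t => - \int[mu]_(s in I) (U (t + s) * k' s))
    (- \int[mu]_(s in I) (u (t0 + s) * k' s)).
  apply: is_deriveN.
  apply: (@is_derive_Rintegral (fun t s => U (t + s) * k' s) (fun t s => u (t + s) * k' s) (M * K) t0) => [t s tI sI|//|t s tI sI].
    have h := dUt t s tI sI.
    have := @is_deriveM _ _ (fun t : R => U (t + s)) (cst (k' s)) t 1 _ _ h (is_derive_cst _ _ _).
    by move=> h'; apply: (is_derive_eq h'); rewrite scaler0 add0r /GRing.scale/= mulrC.
  by rewrite normrM ler_pM ?kM.
apply: (@near_eq_is_derive _ _ _ (fun t => - \int[mu]_(s in I) (U (t + s) * k' s))).
have t0I : t0 \in `]t0 - 1, t0 + 1[ by rewrite in_itv/=; lra.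
apply: filterS (near_in_itvoo t0I) => t /[!in_itv]/= tI; apply/esym.
under eq_Rintegral do rewrite mulrC.
rewrite (@Rintegration_by_parts _ k (fun s => U (t + s)) k')//.
- rewrite k0 k1 !mul0r subrr sub0r; congr (- _).
  by apply: eq_Rintegral => s _; rewrite mulrC.
- exact: continuous_subspaceT.
- exact: is_derive_LR (fun s _ => dk s).
- by move=> s _; rewrite derive1E; case: (dk s).
- exact: continuous_subspaceT.
- by apply: is_derive_LR => s sI; exact: dUs.
- move=> s /[!in_itv]/= /andP[s0 s1]; rewrite derive1E.
  by case: (dUs t s tI) => //; rewrite !ltW.
Qed.

End line_convolution.

(** * Mollification along the coordinate axes *)

Section mollifier.
Context {R : realType} {d : nat}.
Variable eps : R.
Hypothesis eps0 : 0 < eps.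
Local Notation mu := (@lebesgue_measure R).
Local Notation I := (`[0, eps]%classic : set R).
Local Notation e i := (delta_mx 0 i : 'rV[R]_d).
Implicit Types (v w : 'rV[R]_d -> R) (x y u : 'rV[R]_d) (k : R -> R) (B C M K Lam eta : R).

(** Bounded and uniformly continuous functions. *)
Definition buc v :=
  (exists M : R, forall x, `|v x| <= M) /\
  (forall eta : R, 0 < eta -> exists2 del : R, 0 < del &
    forall x u, l1norm u < del -> `|v (x + u) - v x| <= eta).

Lemma buc_line v y (i : 'I_d) : buc v -> continuous (fun s : R => v (y + s *: e i)).
Proof.
move=> [_ vu] s; apply/cvgrPdist_le => eta /vu[del del0 H].
near=> t.
have -> : y + t *: e i = y + s *: e i + (t - s) *: e i.
  by rewrite -addrA -scalerDl [s + _]addrCA subrr addr0.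
rewrite distrC; apply: H; rewrite l1norm_delta distrC.
by near: t; exact: cvgr_dist_lt.
Unshelve. all: by end_near. Qed.

(** Averaging along one coordinate axis. Composed over all axes, it smooths in all
directions by means of one-dimensional integrals only. *)
Definition conv (p : 'I_d * (R -> R)) v y : R :=
  \int[mu]_(s in I) (v (y + s *: e p.1) * p.2 s).

Lemma buc_integrable v y i k : continuous k -> buc v ->
  mu.-integrable I (EFin \o (fun s => v (y + s *: e i) * k s)).
Proof.
move=> ck bv; apply: continuous_integrable => s.
by apply: continuousM; [exact: buc_line|exact: ck].
Qed.

Lemma continuous_cstM B (f : R -> R) : continuous f ->
  continuous (fun s => B * f s).
Proof. by move=> cf s; apply: cvgM; [exact: cvg_cst|exact: cf]. Qed.

Lemma continuous_norm_integrable (f : R -> R) : continuous f ->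
  mu.-integrable I (EFin \o (fun s => `|f s|)).
Proof.
move=> cf; apply: continuous_integrable => s.
by apply: continuous_comp; [exact: cf|exact: norm_continuous].
Qed.

Definition knorm k : R := \int[mu]_(s in I) `|k s|.

Lemma conv_bound v y i k B : continuous k -> buc v ->
  (forall s : R, 0 <= s <= eps -> `|v (y + s *: e i)| <= B) ->
  `|conv (i, k) v y| <= B * knorm k.
Proof.
move=> ck bv vB.
apply: le_trans (le_normr_Rintegral _ (buc_integrable y i ck bv)) _ => //.
have ik := continuous_norm_integrable ck.
have cvk : continuous (fun s : R => v (y + s *: e i) * k s).
  by move=> s; apply: continuousM; [exact: buc_line|exact: ck].
rewrite -RintegralZl//; apply: le_Rintegral => //.
- exact: (continuous_norm_integrable cvk).
- have cBk : continuous (fun s : R => B * `|k s|).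
    apply: continuous_cstM => s.
    by apply: continuous_comp; [exact: ck|exact: norm_continuous].
  exact: (continuous_integrable eps cBk).
- by move=> s; rewrite /= in_itv/= => sI; rewrite normrM ler_wpM2r// vB.
Qed.

Lemma convB p v w y : continuous p.2 -> buc v -> buc w ->
  conv p (fun x => v x - w x) y = conv p v y - conv p w y.
Proof.
move=> ck bv bw; rewrite /conv -RintegralB//; try exact: buc_integrable.
by apply: eq_Rintegral => s _; rewrite mulrBl.
Qed.

Lemma conv_translate p v y b : conv p (fun x => v (x + b)) y = conv p v (y + b).
Proof. by apply: eq_Rintegral => s _; rewrite addrAC. Qed.

Lemma buc_translate v b : buc v -> buc (fun x => v (x + b)).
Proof.
move=> [[M vM] vu]; split; first by exists M.
move=> eta /vu[del del0 H]; exists del => // x u ux.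
by rewrite addrAC; exact: H.
Qed.

Lemma bucD v w : buc v -> buc w -> buc (fun x => v x + w x).
Proof.
move=> [[M vM] vu] [[N wN] wu]; split.
  by exists (M + N) => x; rewrite (le_trans (ler_normD _ _))// lerD.
move=> eta eta0; have e20 : 0 < eta / 2 by lra.
have [d1 d10 H1] := vu _ e20; have [d2 d20 H2] := wu _ e20.
exists (Num.min d1 d2); first by rewrite lt_min d10.
move=> x u; rewrite lt_min => /andP[u1 u2].
have -> : v (x + u) + w (x + u) - (v x + w x) = (v (x + u) - v x) + (w (x + u) - w x).
  by ring.
by rewrite (le_trans (ler_normD _ _))// [leRHS]splitr lerD ?H1 ?H2.
Qed.

Lemma bucN v : buc v -> buc (fun x => - v x).
Proof.
move=> [[M vM] vu]; split; first by exists M => x; rewrite normrN.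
move=> eta /vu[del del0 H]; exists del => // x u ux.
by rewrite -opprD normrN H.
Qed.

Lemma bucB v w : buc v -> buc w -> buc (fun x => v x - w x).
Proof. by move=> bv bw; apply: bucD => //; exact: bucN. Qed.

Lemma knorm_ge0 k : 0 <= knorm k.
Proof. by apply: Rintegral_ge0. Qed.

Lemma conv_buc p v : continuous p.2 -> buc v -> buc (conv p v).
Proof.
case: p => i k /= ck bv; have [[M vM] vu] := bv; split.
  by exists (M * knorm k) => x; exact: conv_bound.
move=> eta eta0; have [|del del0 H] := vu (eta / (knorm k + 1)).
  by rewrite divr_gt0// ltr_wpDl// knorm_ge0.
exists del => // x u ux.
rewrite -conv_translate -(@convB (i, k))//; last exact: buc_translate.
rewrite (le_trans (@conv_bound _ _ _ _ (eta / (knorm k + 1)) _ _ _))//.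
- by apply: bucB => //; exact: buc_translate.
- by move=> s _; apply: H.
- rewrite mulrAC ler_pdivrMr ?ltr_wpDl ?knorm_ge0//.
  by apply: ler_wpM2l; [exact: ltW|rewrite lerDl].
Qed.

(** Along the axis of the average the derivative falls on the kernel. *)
Lemma conv_partial_same i k k' v y : buc v -> kernel eps k -> kernel eps k' ->
  (forall s : R, is_derive s 1 k (k' s)) ->
  is_derive y (e i) (conv (i, k) v) (conv (i, fun s => -1 * k' s) v y).
Proof.
move=> bv kk kk' dk; apply: is_derive_line0; have [[M vM] _] := bv.
have h := @is_derive_convolution R eps eps0 (fun s => v (y + s *: e i)) k k' M 0
  (@buc_line v y i bv) (fun s => vM _) dk (kernel_continuous kk')
  (kernel_out kk (or_introl (lexx 0))) (kernel_out kk (or_intror (lexx eps))).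
have E : (fun t : R => conv (i, k) v (y + t *: e i)) =
    (fun t => \int[mu]_(s in I) (v (y + (t + s) *: e i) * k s)).
  by apply/funext => t; apply: eq_Rintegral => s _; rewrite -addrA -scalerDl.
rewrite E; apply: (is_derive_eq h).
have -> : conv (i, fun s => -1 * k' s) v y =
    -1 * \int[mu]_(s in I) (v (y + s *: e i) * k' s).
  rewrite -RintegralZl//; last exact: buc_integrable (kernel_continuous kk') bv.
  by apply: eq_Rintegral => s _; rewrite mulrCA.
by rewrite mulN1r; congr (- _); apply: eq_Rintegral => s _; rewrite add0r.
Qed.

(** Along another axis it falls on the averaged function. *)
Lemma conv_partial_other i j k v w y : buc v -> buc w -> continuous k ->
  (forall x, is_derive x (e i) v (w x)) ->
  is_derive y (e i) (conv (j, k) v) (conv (j, k) w y).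
Proof.
move=> bv bw ck dv; apply: is_derive_line0; have [[M wM] _] := bw.
have [K K0 kK] := continuous_bounded_segment eps ck.
have h := @is_derive_Rintegral R eps (fun t s => v (y + t *: e i + s *: e j) * k s)
  (fun t s => w (y + t *: e i + s *: e j) * k s) (M * K) 0.
have {}h := h _ _ _.
have : is_derive (0 : R) 1
    (fun t : R => \int[mu]_(s in I) (v (y + t *: e i + s *: e j) * k s))
    (\int[mu]_(s in I) (w (y + 0 *: e i + s *: e j) * k s)).
  apply: h => [t s _ _|t _|t s _ sI].
  - have dl : is_derive t 1 (fun t : R => v (y + s *: e j + t *: e i)) (w (y + s *: e j + t *: e i)).
      have [h1 h2] := dv (y + s *: e j + t *: e i).
      by have := is_derive_line h1; rewrite h2.
    have := @is_deriveM _ _ (fun t : R => v (y + s *: e j + t *: e i)) (cst (k s)) t 1 _ _ dl (is_derive_cst _ _ _).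
    rewrite scaler0 add0r /GRing.scale/= => h'.
    have E : (fun t : R => v (y + t *: e i + s *: e j) * k s) =
        ((fun t : R => v (y + s *: e j + t *: e i)) \* cst (k s)).
      by apply/funext => r /=; rewrite addrAC.
    by rewrite E; apply: (is_derive_eq h'); rewrite mulrC addrAC.
  - exact: buc_integrable.
  - by rewrite normrM ler_pM// kK.
by move=> h'; apply: (is_derive_eq h'); rewrite scale0r addr0.
Qed.

Fixpoint mollify (ks : seq ('I_d * (R -> R))) v : 'rV[R]_d -> R :=
  if ks is p :: ks' then conv p (mollify ks' v) else v.

Fixpoint kernels (ks : seq ('I_d * (R -> R))) : Prop :=
  if ks is p :: ks' then kernel eps p.2 /\ kernels ks' else True.

Lemma mollify_buc ks v : kernels ks -> buc v -> buc (mollify ks v).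
Proof.
elim: ks => //= p ks IH [kp kks] bv; apply: conv_buc; last exact: IH.
exact: kernel_continuous kp.
Qed.

(** A derivative replaces one kernel of the list and keeps the axes. *)
Lemma mollify_partial ks i : kernels ks -> i \in unzip1 ks ->
  exists ks', [/\ kernels ks', unzip1 ks' = unzip1 ks &
    forall v y, buc v -> is_derive y (e i) (mollify ks v) (mollify ks' v y)].
Proof.
elim: ks => //= -[j k] ks IH [/= kk kks]; rewrite in_cons.
case: eqVneq => [<- _|_ /= iks].
  have [k' kk' dk] := kernel_derive kk.
  exists ((i, fun s => -1 * k' s) :: ks); split => //=.
    by split => //; exact: kernelZ.
  by move=> v y bv; apply: conv_partial_same => //; exact: mollify_buc.
have [ks' [kks' E H]] := IH kks iks.
exists ((j, k) :: ks'); split => //=; first by rewrite E.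
move=> v y bv; apply: conv_partial_other.
- exact: mollify_buc.
- exact: mollify_buc.
- exact: kernel_continuous kk.
- by move=> x; exact: H.
Qed.

Lemma mollify_bound ks : kernels ks -> exists2 M : R, 0 <= M &
  forall v B y, buc v -> (forall x, `|v x| <= B) -> `|mollify ks v y| <= M * B.
Proof.
elim: ks => [_|[i k] ks IH /= [/= kk kks]].
  by exists 1 => // v B y _ vB; rewrite mul1r.
have [M M0 H] := IH kks; exists (M * knorm k); first by rewrite mulr_ge0// knorm_ge0.
move=> v B y bv vB; rewrite mulrAC; apply: conv_bound.
- exact: kernel_continuous kk.
- exact: mollify_buc.
- by move=> s _; exact: H.
Qed.

Lemma mollify_smooth ks v : kernels ks -> (forall i, i \in unzip1 ks) -> buc v ->
  smooth (mollify ks v).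
Proof.
move=> + + bv n; elim: n ks => [|n IH] ks kks full;
  (split; first by have [[M HM] _] := mollify_buc kks bv; exists M) => //.
move=> i; have [ks' [kks' E H]] := mollify_partial kks (full i).
split; first by move=> x; case: (H v x bv).
apply: smooth_upto_ext (IH _ kks' _) => [x|]; last by rewrite E.
by case: (H v x bv).
Qed.

(** The constants depend on the kernels only and multiply the bound on v: they
serve for all value functions at once, and for their time differences. *)
Lemma mollify_estimates ks : kernels ks -> (forall i, i \in unzip1 ks) ->
  exists Lam K : R, [/\ 0 <= Lam, 0 <= K & forall v B, buc v ->
    (forall x, `|v x| <= B) ->
    (forall i x, `|'D_(e i) (mollify ks v) x| <= Lam * B) /\
    (forall x u, `|mollify ks v (x + u) - mollify ks v x -
       dotrV u (grad (mollify ks v) x)| <= K * B * l1norm u ^+ 2)].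
Proof.
move=> kks full.
have fM ks1 : kernels ks1 -> unzip1 ks1 = unzip1 ks ->
    exists2 M : R, 0 <= M & forall v B i x, buc v -> (forall x, `|v x| <= B) ->
      `|'D_(e i) (mollify ks1 v) x| <= M * B.
  move=> kks1 E1.
  have /choice[M HM] : forall i, exists M : R, 0 <= M /\ forall v B x, buc v ->
      (forall x, `|v x| <= B) -> `|'D_(e i) (mollify ks1 v) x| <= M * B.
    move=> i; have [|ks' [kks' E H]] := mollify_partial (i := i) kks1; first by rewrite E1.
    have [M M0 HM] := mollify_bound kks'; exists M; split => // v B x bv vB.
    by case: (H v x bv) => _ ->; exact: HM.
  exists (\sum_i M i); first by apply: sumr_ge0 => i _; case: (HM i).
  move=> v B i x bv vB; have [M0 HM'] := HM i.
  apply: le_trans (HM' v B x bv vB) _.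
  apply: ler_wpM2r; first exact: le_trans (normr_ge0 _) (vB x).
  by rewrite (bigD1 i)//= lerDl sumr_ge0// => j _; case: (HM j).
have [Lam Lam0 HL] := fM _ kks erefl.
have /choice[K HK] : forall i, exists K : R, 0 <= K /\ forall v B x u, buc v ->
    (forall x, `|v x| <= B) ->
    `|'D_(e i) (mollify ks v) (x + u) - 'D_(e i) (mollify ks v) x| <= K * B * l1norm u.
  move=> i; have [ks' [kks' E H]] := mollify_partial kks (full i).
  have [K K0 HK] := fM _ kks' E; exists K; split => // v B x u bv vB.
  case: (H v x bv) => _ ->; case: (H v (x + u) bv) => _ ->.
  apply: partials_bounded_lipschitz => [j y|j y]; last exact: HK.
  have [ks'' [_ _ H']] := mollify_partial (i := j) kks' ltac:(by rewrite E).
  by case: (H' v y bv).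
have K0 : 0 <= \sum_i K i by apply: sumr_ge0 => i _; case: (HK i).
exists Lam, (\sum_i K i); split => // v B bv vB; split; first by move=> i x; exact: HL.
apply: partials_lipschitz_taylor => [i x|i x u].
  have [ks' [_ _ H]] := mollify_partial kks (full i).
  by case: (H v x bv).
have [_ HK'] := HK i; apply: le_trans (HK' v B x u bv vB) _.
apply: ler_wpM2r; first exact: l1norm_ge0.
apply: ler_wpM2r; first exact: le_trans (normr_ge0 _) (vB x).
by rewrite (bigD1 i)//= lerDl sumr_ge0// => j _; case: (HK j).
Qed.

Lemma mollifyB ks v w y : kernels ks -> buc v -> buc w ->
  mollify ks (fun x => v x - w x) y = mollify ks v y - mollify ks w y.
Proof.
move=> + bv bw; elim: ks y => //= p ks IH y [kp kks].
rewrite -convB; [|exact: kernel_continuous kp|exact: mollify_buc..].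
by apply: eq_Rintegral => s _; rewrite IH.
Qed.

Lemma mollify_translate ks v b y :
  mollify ks (fun x => v (x + b)) y = mollify ks v (y + b).
Proof.
elim: ks y => //= p ks IH y; rewrite -conv_translate.
by apply: eq_Rintegral => s _; rewrite IH.
Qed.

Definition averaging k :=
  [/\ kernel eps k, forall s, 0 <= k s & \int[mu]_(s in I) k s = 1].

Lemma conv_le i k v y C : averaging k -> buc v ->
  (forall s : R, 0 <= s <= eps -> v (y + s *: e i) <= C) ->
  conv (i, k) v y <= C.
Proof.
move=> [kk k0 k1] bv vC.
have ik := continuous_integrable eps (kernel_continuous kk).
rewrite -[leRHS]mulr1 -k1 -RintegralZl//; apply: le_Rintegral => //.
- exact: buc_integrable (kernel_continuous kk) bv.
- exact: continuous_integrable (continuous_cstM (kernel_continuous kk)).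
- by move=> s; rewrite /= in_itv/= => sI; rewrite ler_wpM2r// vC.
Qed.

Definition axes k : seq ('I_d * (R -> R)) := [seq (i, k) | i <- enum 'I_d].

Lemma axes_full k i : i \in unzip1 (axes k).
Proof. by rewrite /unzip1 -map_comp map_id_in// mem_enum. Qed.

Lemma axes_kernels k : kernel eps k -> kernels (axes k).
Proof. by move=> kk; rewrite /axes; elim: (enum _) => //= i s IH; split. Qed.

(** Each of the d averages moves the point by at most eps. *)
Lemma mollify_le k v y C : averaging k -> buc v ->
  (forall u, l1norm u <= d%:R * eps -> v (y + u) <= C) ->
  mollify (axes k) v y <= C.
Proof.
move=> ak bv; have [kk _ _] := ak.
have -> : d%:R = (size (enum 'I_d))%:R :> R by rewrite -cardE card_ord.
rewrite /axes.
elim: (enum _) y => [|i s IH] y vC /=.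
  by rewrite -[y]addr0; apply: vC; rewrite l1norm0 mul0r.
apply: conv_le => //.
  by apply: mollify_buc => //; elim: s {IH vC} => //= j s IH; split.
move=> t tI; apply: IH => u us; rewrite -addrA; apply: vC.
apply: le_trans (l1normD _ _) _; rewrite l1norm_delta ger0_norm; last by case/andP: tI.
by rewrite /= mulrSr mulrDl mul1r addrC lerD//; case/andP: tI.
Qed.

Lemma mollify_ge k v y C : averaging k -> buc v ->
  (forall u, l1norm u <= d%:R * eps -> C <= v (y + u)) ->
  C <= mollify (axes k) v y.
Proof.
move=> ak bv vC; have [kk _ _] := ak.
have b0 : buc (fun=> 0).
  split; first by exists 0 => x; rewrite normr0.
  by move=> eta eta0; exists 1 => // x u _; rewrite subrr normr0 ltW.
have b2 : buc (fun x => 0 - v x) by exact: bucB.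
have : mollify (axes k) (fun x => 0 - v x) y <= - C.
  by apply: mollify_le => // u uS; rewrite sub0r lerN2 vC.
have e0 : mollify (axes k) (fun=> 0) y = 0.
  have [M M0 H] := mollify_bound (axes_kernels kk).
  have := H (fun=> 0) 0 y b0 (fun=> ltac:(by rewrite normr0)).
  by rewrite mulr0 normr_le0 => /eqP.
rewrite mollifyB//; last exact: axes_kernels.
by rewrite e0 sub0r lerN2.
Qed.

Lemma averaging_exists : exists k, averaging k.
Proof.
have h3 : eps / 3 < 2 * eps / 3 by move: eps0; lra.
pose b : R -> R := fun s => flat 1 s * flat 1 (eps - s).
have kb : kernel eps b by exact: kernel_flat.
have f0 (s : R) : 0 <= flat 1 s.
  by rewrite /flat; case: ifP => // _; rewrite hornerC mul1r expR_ge0.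
have b0 s : 0 <= b s by rewrite mulr_ge0.
have ib := continuous_integrable eps (kernel_continuous kb).
suff J0 : 0 < \int[mu]_(s in I) b s.
  exists (fun s => (\int[mu]_(s in I) b s)^-1 * b s); split.
  - exact: kernelZ.
  - by move=> s; rewrite mulr_ge0// invr_ge0 ltW.
  - by rewrite RintegralZl// mulVf// gt_eqF.
pose K := (`[eps / 3, 2 * eps / 3]%classic : set R).
pose c := expR (- (3 / eps)) ^+ 2.
have c0 : 0 < c by rewrite exprn_gt0// expR_gt0.
have fc (s : R) : eps / 3 <= s -> expR (- (3 / eps)) <= flat 1 s.
  move=> es; have s0 : 0 < s by apply: lt_le_trans es; rewrite divr_gt0.
  rewrite /flat s0 hornerC mul1r ler_expR lerN2 -invf_div lef_pV2 ?posrE ?divr_gt0//.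
have mK : measurable (K : set (measurableTypeR R)) by exact: measurable_itv.
have KI : K `<=` I.
  by move=> s; rewrite /K /= !in_itv/= => /andP[h1 h2]; lra.
have iK : mu.-integrable K (EFin \o b) by exact: integrableS ib.
apply: (@lt_le_trans _ _ (\int[mu]_(s in K) b s)).
  apply: (@lt_le_trans _ _ (\int[mu]_(s in K) c)).
    rewrite Rintegral_cst// mulr_gt0//.
    have muK : lebesgue_measure (`[eps / 3, 2 * eps / 3]%classic : set R) =
        (2 * eps / 3 - eps / 3)%:E.
      by rewrite lebesgue_measure_itv/= lte_fin h3.
    rewrite [X in fine X](_ : _ = (2 * eps / 3 - eps / 3)%:E); last exact: muK.
    by rewrite /= subr_gt0.
  apply: le_Rintegral => //.
    have ic : mu.-integrable I (EFin \o cst c).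
      by apply: continuous_integrable => s; exact: cvg_cst.
    have iKc : mu.-integrable K (EFin \o cst c) by exact: integrableS ic.
    exact: iKc.
  move=> s; rewrite /K /= in_itv/= => /andP[h1 h2].
  by rewrite /c expr2 ler_pM ?expR_ge0// fc//; lra.
rewrite /Rintegral fine_le//.
- exact: integrable_fin_num.
- exact: integrable_fin_num.
- apply: ge0_subset_integral => //.
  + by case/integrableP: ib.
  + by move=> s _; rewrite lee_fin.
Qed.

End mollifier.

Lemma mollify_partialB (R : realType) (d : nat) (eps : R) (ks : seq ('I_d * (R -> R)))
    (v w : 'rV[R]_d -> R) (i : 'I_d) (x : 'rV[R]_d) : 0 < eps ->
  kernels eps ks -> (forall i, i \in unzip1 ks) -> buc v -> buc w ->
  'D_(delta_mx 0 i : 'rV[R]_d) (mollify eps ks (fun z => v z - w z)) x =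
  'D_(delta_mx 0 i : 'rV[R]_d) (mollify eps ks v) x -
  'D_(delta_mx 0 i : 'rV[R]_d) (mollify eps ks w) x.
Proof.
move=> eps0 kks full bv bw.
have [ks' [kks' _ H]] := mollify_partial eps0 kks (full i).
have [_ ->] := H v x bv; have [_ ->] := H w x bw.
have [_ ->] := H _ x (bucB bv bw).
exact: mollifyB.
Qed.

(** * Exponential moments of the jumps *)

Section exponential_inequalities.
Context {R : realType}.
Implicit Types s t x : R.

(** The integrand of the Hamiltonian. *)
Definition cexp s : R := expR s - 1 - s.

Lemma cexp_ge0 s : 0 <= cexp s.
Proof. by rewrite /cexp; have := expR_ge1Dx s; lra. Qed.

Lemma expR_tangent s t : expR s * (1 + (t - s)) <= expR t.
Proof.
have {2}-> : t = s + (t - s) by ring.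
by rewrite expRD ler_wpM2l ?expR_ge0// expR_ge1Dx.
Qed.

Lemma cexp_tangent s t : (t - s) * (expR s - 1) <= cexp t - cexp s.
Proof. by rewrite /cexp; have := expR_tangent s t; lra. Qed.

(** Both (exp x - 1) ^ 2 <= exp (2 x) - 1 - 2 x and
exp x - 1 >= (x / 2) exp (x / 2) follow from the tangent inequality. *)
Lemma cexp_ge_sqr x : 0 <= x -> x ^+ 2 * expR x <= 4 * cexp (2 * x).
Proof.
move=> x0.
have E2 : expR x = expR (x / 2) ^+ 2.
  by rewrite -expRM_natl; congr expR; field.
have E4 : expR (2 * x) = expR x ^+ 2 by rewrite -expRM_natl.
have h1 := expR_ge1Dx (x / 2); have h2 := expR_ge1Dx x.
have h0 := expR_gt0 (x / 2).
rewrite /cexp E4.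
apply: (@le_trans _ _ (4 * (expR x - 1) ^+ 2)); last by nra.
have : x / 2 * expR (x / 2) <= expR x - 1 by rewrite E2; nra.
move=> h; have h' : 0 <= x / 2 * expR (x / 2) by rewrite mulr_ge0 ?divr_ge0// ltW.
have : (x / 2 * expR (x / 2)) ^+ 2 <= (expR x - 1) ^+ 2.
  by rewrite lerXn2r ?nnegrE// (le_trans h').
by rewrite exprMn -E2; lra.
Qed.

Lemma expR_sub_le s t M del : t - s <= del -> 0 <= del -> t <= M ->
  expR t - expR s <= del * expR M.
Proof.
move=> ts del0 tM; have h := expR_tangent t s.
have h1 : expR t <= expR M by rewrite ler_expR.
have h0 := expR_gt0 t.
by apply: (@le_trans _ _ (del * expR t)); nra.
Qed.

Lemma normr_expRB1 s : `|expR s - 1| <= `|s| * expR `|s|.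
Proof.
have h1 := expR_ge1Dx s; have h2 := expR_tangent s 0; rewrite expR0 in h2.
have [s0|s0] := leP 0 s.
  have e1 : 1 <= expR s by lra.
  by rewrite !ger0_norm; lra.
have e1 : expR s <= 1 by rewrite -expR0 ler_expR ltW.
have e2 : 1 <= expR (- s) by rewrite -[leLHS]expR0 ler_expR; lra.
by rewrite !ler0_norm; nra.
Qed.

Lemma cexp_le_sqr s : cexp s <= s ^+ 2 * expR `|s|.
Proof.
have h2 := expR_tangent s 0; rewrite expR0 in h2.
have h : cexp s <= `|s| * `|expR s - 1|.
  by rewrite -normrM; apply: le_trans (ler_norm _); rewrite /cexp; lra.
apply: (le_trans h); rewrite -[s ^+ 2]real_normK ?num_real// expr2 -mulrA.
by rewrite ler_wpM2l// normr_expRB1.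
Qed.

Lemma cexp_continuous : continuous cexp.
Proof.
move=> s; apply: cvgB; last exact: cvg_id.
by apply: cvgB; [exact: continuous_expR|exact: cvg_cst].
Qed.

End exponential_inequalities.

Section hamiltonian.
Context {R : realType} {d : nat}.
Variable mu : 'rV[R]_d -> {measure set 'rV[R]_d -> \bar R}.
Variable H1 : 'rV[R]_d -> R.
Hypothesis HH1 : forall x xi, (hamiltonian mu x xi <= (H1 xi)%:E)%E.
Implicit Types (x y z xi a : 'rV[R]_d) (Lam K B h : R).

Definition hamR x xi : R := fine (hamiltonian mu x xi).

Lemma hamiltonian_ge0 x xi : (0 <= hamiltonian mu x xi)%E.
Proof. by apply: integral_ge0 => z _; rewrite lee_fin cexp_ge0. Qed.

Lemma hamRE x xi : hamiltonian mu x xi = (hamR x xi)%:E.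
Proof.
rewrite fineK// ge0_fin_numE ?hamiltonian_ge0//.
exact: le_lt_trans (HH1 x xi) (ltry _).
Qed.

Lemma cexp_measurable xi :
  measurable_fun [set: 'rV[R]_d] (fun z => cexp (dotrV z xi)).
Proof.
apply: continuous_measurable_rV => z.
have c := @dotrV_continuous R d xi z.
exact: continuous_comp c (@cexp_continuous R _).
Qed.

Lemma cexp_integrable x xi :
  (mu x).-integrable setT (EFin \o (fun z => cexp (dotrV z xi))).
Proof.
apply/integrableP; split.
  apply/measurable_EFinP.
  exact: cexp_measurable.
apply: le_lt_trans (ltry (H1 xi)); apply: le_trans (HH1 x xi).
rewrite le_eqVlt; apply/orP; left; apply/eqP.
by apply: eq_integral => z _; rewrite /= ger0_norm// cexp_ge0.
Qed.

(** The sign vectors: the l1 norm of z is the largest of its products with them. *)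
Definition corner (s : {ffun 'I_d -> bool}) : 'rV[R]_d := \row_i (-1) ^+ s i.

Lemma l1norm_corner z : exists s, dotrV z (corner s) = l1norm z.
Proof.
exists [ffun i => z 0 i < 0]; apply: eq_bigr => i _; rewrite mxE ffunE.
by rewrite mulrC; case: ltP => h /=; rewrite ?expr1 ?expr0 ?mulN1r ?mul1r;
  [rewrite ltr0_norm|rewrite ger0_norm].
Qed.

Lemma dotrVZr z c xi : dotrV z (c *: xi) = c * dotrV z xi.
Proof. by rewrite /dotrV mulr_sumr; apply: eq_bigr => i _; rewrite mxE mulrCA. Qed.

(** The weight of second-order errors: quadratic in the jump, and exponential
because gradients bounded by Lam enter through exponentials. *)
Definition moment Lam z : R := l1norm z ^+ 2 * expR (Lam * l1norm z).

Definition moment_bound Lam : R :=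
  4 * \sum_s H1 ((2 * Num.max 1 Lam) *: corner s).

Lemma moment_ge0 Lam z : 0 <= moment Lam z.
Proof. by rewrite mulr_ge0 ?expR_ge0// exprn_ge0// l1norm_ge0. Qed.

(** For the sign vector s with <z, s> equal to the l1 norm, one term of the sum
is already large enough. *)
Lemma moment_le Lam z :
  moment Lam z <= 4 * \sum_s cexp (dotrV z ((2 * Num.max 1 Lam) *: corner s)).
Proof.
set c := Num.max 1 Lam; have c1 : 1 <= c by rewrite le_max lexx.
have cL : Lam <= c by rewrite le_max lexx orbT.
have [s zs] := l1norm_corner z; have l0 := l1norm_ge0 z.
rewrite (bigD1 s)//=; apply: (@le_trans _ _ (4 * cexp (dotrV z ((2 * c) *: corner s)))).
  rewrite dotrVZr zs -mulrA; apply: le_trans (cexp_ge_sqr _); last by rewrite mulr_ge0//; lra.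
  rewrite /moment exprMn ler_pM ?expR_ge0 ?exprn_ge0//.
    by rewrite ler_peMl ?exprn_ge0// exprn_ege1.
  by rewrite ler_expR ler_wpM2r.
by rewrite ler_wpM2l// lerDl sumr_ge0// => j _; exact: cexp_ge0.
Qed.

Lemma l1norm_continuous : continuous (@l1norm R d).
Proof.
apply: continuous_big => [|i _]; first exact: add_continuous.
by move=> v; exact: (continuous_comp (@coord_continuous R 1 d 0 i v) (@norm_continuous _ _ _)).
Qed.

Lemma moment_continuous Lam : continuous (moment Lam).
Proof.
move=> z; have c := @l1norm_continuous z.
have cm : continuous (fun t : R => t ^+ 2 * expR (Lam * t)).
  move=> t; apply: cvgM; first exact: exprn_continuous.
  apply: continuous_comp; last exact: continuous_expR.
  by apply: cvgM; [exact: cvg_cst|exact: cvg_id].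
exact: continuous_comp c (cm _).
Qed.

Lemma moment_measurable Lam : measurable_fun [set: 'rV[R]_d] (moment Lam).
Proof. by apply: continuous_measurable_rV; exact: moment_continuous. Qed.

(** The bound is uniform in x, as H <= H1 at the finitely many points used. *)
Lemma moment_integral Lam x : (\int[mu x]_z (moment Lam z)%:E <= (moment_bound Lam)%:E)%E.
Proof.
apply: (@le_trans _ _ (\int[mu x]_z
    (4 * \sum_s cexp (dotrV z ((2 * Num.max 1 Lam) *: corner s)))%:E)%E).
  apply: ge0_le_integral => //.
  - by move=> z _; rewrite lee_fin moment_ge0.
  - by apply/measurable_EFinP; exact: moment_measurable.
  - apply/measurable_EFinP/measurable_funM => //; apply: measurable_sum => s.
    exact: cexp_measurable.
  - by move=> z _; rewrite lee_fin moment_le.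
under eq_integral do rewrite EFinM -sumEFin.
rewrite ge0_integralZl//; last 2 first.
- by apply: emeasurable_sum => s; apply/measurable_EFinP; exact: cexp_measurable.
- by move=> z _; apply: sume_ge0 => s _; rewrite lee_fin cexp_ge0.
rewrite /moment_bound EFinM lee_wpmul2l// -sumEFin ge0_integral_sum//; last 2 first.
- by move=> s; apply/measurable_EFinP; exact: cexp_measurable.
- by move=> s z _; rewrite lee_fin cexp_ge0.
by apply: lee_sum => s _; exact: HH1.
Qed.

Lemma moment_integrable Lam x : (mu x).-integrable setT (EFin \o moment Lam).
Proof.
apply/integrableP; split.
  by apply/measurable_EFinP; exact: moment_measurable.
apply: le_lt_trans (ltry (moment_bound Lam)); apply: le_trans (moment_integral Lam x).
rewrite le_eqVlt; apply/orP; left; apply/eqP.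
by apply: eq_integral => z _; rewrite /= ger0_norm// moment_ge0.
Qed.

Lemma moment_Rintegral Lam x : \int[mu x]_z moment Lam z <= moment_bound Lam.
Proof.
rewrite -lee_fin fineK; first exact: moment_integral.
exact: integrable_fin_num (moment_integrable Lam x).
Qed.

Lemma moment_bound_ge0 Lam : 0 <= moment_bound Lam.
Proof.
apply: le_trans (moment_Rintegral Lam 0); apply: Rintegral_ge0 => z _.
exact: moment_ge0.
Qed.

Lemma integrable_moment x (f : 'rV[R]_d -> R) C Lam : continuous f ->
  (forall z, `|f z| <= C * moment Lam z) -> (mu x).-integrable setT (EFin \o f).
Proof.
move=> cf fC.
apply: (@le_integrable _ _ _ _ setT measurableT _ (fun z => (C * moment Lam z)%:E)).
- by apply/measurable_EFinP; exact: continuous_measurable_rV.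
- by move=> z _; rewrite /= lee_fin (le_trans (fC z))// ler_norm.
- by have := integrableZl measurableT C (moment_integrable Lam x).
Qed.

End hamiltonian.

(** * Legendre duality and the jump operator on exponentials *)

Section Rintegral_finite_sum.
Context {R : realType} {d0} {T : measurableType d0}.
Variable nu : {measure set T -> \bar R}.

Lemma Rintegral_sum (J : Type) (s : seq J) (f : J -> T -> R) :
  (forall j, nu.-integrable setT (EFin \o f j)) ->
  \int[nu]_z (\sum_(j <- s) f j z) = \sum_(j <- s) \int[nu]_z f j z.
Proof.
move=> fi; elim: s => [|j s IH].
  by rewrite big_nil; under eq_Rintegral do rewrite big_nil; rewrite /Rintegral integral0.
rewrite big_cons -IH -RintegralD//; first by apply: eq_Rintegral => z _; rewrite big_cons.
have := @integrable_sum _ _ _ nu setT measurableT _ s xpredT (fun j => EFin \o f j) (fun j _ => fi j).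
by apply: eq_integrable => // z _; rewrite /= sumEFin.
Qed.

End Rintegral_finite_sum.

Section duality.
Context {R : realType} {d : nat}.
Variable mu : 'rV[R]_d -> {measure set 'rV[R]_d -> \bar R}.
Variable H1 : 'rV[R]_d -> R.
Hypothesis HH1 : forall x xi, (hamiltonian mu x xi <= (H1 xi)%:E)%E.
Hypothesis Lfin : forall x a, lagrangian mu x a \is a fin_num.
Implicit Types (x y z u v xi eta a : 'rV[R]_d) (Lam K B h Xi U : R).

Local Notation moment_bound := (moment_bound H1).

Definition lagR x a : R := fine (lagrangian mu x a).

Lemma lagRE x a : lagrangian mu x a = (lagR x a)%:E.
Proof. by rewrite fineK. Qed.

Lemma lagR_ge x a xi : dotrV a xi - hamR mu x xi <= lagR x a.
Proof.
rewrite -lee_fin -lagRE EFinB -(hamRE HH1); apply: ereal_sup_ubound.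
by exists xi.
Qed.

Lemma dotrVDr z u v : dotrV z (u + v) = dotrV z u + dotrV z v.
Proof. by rewrite -big_split; apply: eq_bigr => i _; rewrite mxE mulrDr. Qed.

Lemma dotrVNr z u : dotrV z (- u) = - dotrV z u.
Proof. by rewrite -scaleN1r dotrVZr mulN1r. Qed.

Lemma dotrVBr z u v : dotrV z (u - v) = dotrV z u - dotrV z v.
Proof. by rewrite dotrVDr dotrVNr. Qed.

(** The gradient of the Hamiltonian in xi, which enters below as a subgradient. *)
Definition tilted_mean x xi : 'rV[R]_d :=
  \row_i \int[mu x]_z (z 0 i * (expR (dotrV z xi) - 1)).

Lemma tilt_continuous xi u :
  continuous (fun z : 'rV[R]_d => dotrV z u * (expR (dotrV z xi) - 1)).
Proof.
move=> z; apply: (@continuousM _ _ (fun z => dotrV z u) (fun z => expR (dotrV z xi) - 1)).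
  exact: dotrV_continuous.
have ce : continuous (fun t : R => expR t - 1).
  by move=> t; apply: cvgB; [exact: continuous_expR|exact: cvg_cst].
exact: continuous_comp (@dotrV_continuous R d xi z) (ce _).
Qed.

Lemma tilt_bound xi Xi u U z : (forall i, `|xi 0 i| <= Xi) -> (forall i, `|u 0 i| <= U) ->
  0 <= Xi -> 0 <= U ->
  `|dotrV z u * (expR (dotrV z xi) - 1)| <= (U * Xi) * moment Xi z.
Proof.
move=> xiX uU X0 U0; rewrite normrM; have l0 := l1norm_ge0 z.
have h1 := dotrV_le_l1norm z uU; have h2 := dotrV_le_l1norm z xiX.
have h3 := normr_expRB1 (dotrV z xi).
have e1 : expR `|dotrV z xi| <= expR (Xi * l1norm z) by rewrite ler_expR.
have := ler_pM (normr_ge0 _) (normr_ge0 _) h1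
  (le_trans h3 (ler_pM (normr_ge0 _) (expR_ge0 _) h2 e1)).
by move/le_trans; apply; rewrite /moment; rewrite le_eqVlt; apply/orP; left; apply/eqP; ring.
Qed.

Lemma tilt_integrable x xi u :
  (mu x).-integrable setT (EFin \o (fun z => dotrV z u * (expR (dotrV z xi) - 1))).
Proof.
pose X := l1norm xi; pose U := l1norm u.
apply: (@integrable_moment _ _ _ _ HH1 x _ (U * X) X); first exact: tilt_continuous.
by move=> z; apply: tilt_bound => [i|i||]; rewrite ?coord_le_l1norm ?l1norm_ge0.
Qed.

Lemma dotrV_delta z i : dotrV z (delta_mx 0 i) = z 0 i.
Proof.
rewrite /dotrV (bigD1 i)//= big1 ?addr0 ?mxE ?eqxx ?mulr1// => j /negPf ji.
by rewrite mxE ji andbF mulr0.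
Qed.

Lemma tilted_mean_dotrV x xi u : dotrV (tilted_mean x xi) u =
  \int[mu x]_z (dotrV z u * (expR (dotrV z xi) - 1)).
Proof.
have fi i : (mu x).-integrable setT
    (EFin \o (fun z : 'rV[R]_d => z 0 i * (expR (dotrV z xi) - 1))).
  by have := tilt_integrable x xi (delta_mx 0 i); apply: eq_integrable => // z _ /=;
    rewrite dotrV_delta.
under eq_Rintegral do rewrite /dotrV mulr_suml.
rewrite (@Rintegral_sum _ _ _ (mu x) _ _ (fun i z => z 0 i * u 0 i * (expR (dotrV z xi) - 1))).
  apply: eq_bigr => i _; rewrite mxE mulrC -RintegralZl//.
  by apply: eq_Rintegral => z _; ring.
move=> i; have := integrableZl measurableT (u 0 i) (fi i).
by apply: eq_integrable => // z _ /=; rewrite -EFinM; congr EFin; ring.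
Qed.

(** The inequality holds under the integral sign, for the convex integrand. *)
Lemma hamR_subgradient x xi eta :
  hamR mu x xi + dotrV (tilted_mean x xi) (eta - xi) <= hamR mu x eta.
Proof.
have i1 := cexp_integrable HH1 x xi; have i2 := tilt_integrable x xi (eta - xi).
have i3 := cexp_integrable HH1 x eta.
rewrite tilted_mean_dotrV /hamR -!/(Rintegral _ _ _) -RintegralD//.
apply: le_Rintegral => //.
  by have := integrableD measurableT i1 i2.
move=> z _; rewrite dotrVBr; have := cexp_tangent (dotrV z xi) (dotrV z eta).
by rewrite /cexp; lra.
Qed.

(** The tilted mean attains the supremum that defines L from H, and its size is
bounded by an exponential moment, uniformly in x. *)
Lemma lagrangian_duality x xi Xi : 0 <= Xi -> (forall i, `|xi 0 i| <= Xi) ->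
  exists a, l1norm a <= d%:R * (Xi * moment_bound Xi) /\
    hamR mu x xi <= dotrV a xi - lagR x a.
Proof.
move=> X0 xiX; exists (tilted_mean x xi); split.
  have -> : d%:R = \sum_(i < d) (1 : R) by rewrite sumr_const card_ord.
  rewrite mulr_suml; apply: ler_sum => i _; rewrite mul1r mxE.
  have ti := tilt_integrable x xi (delta_mx 0 i).
  apply: (@le_trans _ _ `|\int[mu x]_z (dotrV z (delta_mx 0 i) * (expR (dotrV z xi) - 1))|).
    by under eq_Rintegral do rewrite -dotrV_delta.
  apply: le_trans (le_normr_Rintegral measurableT ti) _.
  apply: (@le_trans _ _ (\int[mu x]_z (Xi * moment Xi z))).
    apply: le_Rintegral => //.
    - by have := integrable_abse ti.
    - by have := integrableZl measurableT Xi (moment_integrable HH1 Xi x).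
    - move=> z _; rewrite -[Xi * _]mul1r mulrA; apply: tilt_bound => // j.
      by rewrite mxE eqxx/=; case: eqP => _; rewrite ?normr1 ?normr0.
  rewrite RintegralZl//; last exact: moment_integrable HH1 Xi x.
  by rewrite ler_wpM2l// (moment_Rintegral HH1).
suff : lagR x (tilted_mean x xi) <= dotrV (tilted_mean x xi) xi - hamR mu x xi by lra.
rewrite -lee_fin -lagRE; apply: ge_ereal_sup => _ [eta _ <-].
rewrite (hamRE HH1) -EFinB lee_fin.
by have := hamR_subgradient x xi eta; rewrite dotrVBr; lra.
Qed.

Lemma hamR0 x : hamR mu x 0 = 0.
Proof.
have d0 (z : 'rV[R]_d) : dotrV z 0 = 0.
  by rewrite /dotrV big1// => i _; rewrite mxE mulr0.
rewrite /hamR /hamiltonian (eq_integral (fun=> 0%E)) ?integral0// => z _.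
by rewrite d0 expR0 !subr0 subrr.
Qed.

Lemma lagR_ge0 x a : 0 <= lagR x a.
Proof.
apply: le_trans (lagR_ge x a 0); rewrite hamR0 subr0.
by rewrite /dotrV big1// => i _; rewrite mxE mulr0.
Qed.

Lemma lagR0 x : lagR x 0 = 0.
Proof.
apply/le_anti; rewrite lagR_ge0 andbT -lee_fin -lagRE.
apply: ge_ereal_sup => _ [xi _ <-]; rewrite (hamRE HH1) -EFinB lee_fin.
have -> : dotrV 0 xi = 0 by rewrite /dotrV big1// => i _; rewrite mxE mul0r.
by rewrite sub0r oppr_le0 -lee_fin -(hamRE HH1) hamiltonian_ge0.
Qed.

End duality.

Section generator_estimate.
Context {R : realType} {d : nat}.
Variable mu : 'rV[R]_d -> {measure set 'rV[R]_d -> \bar R}.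
Variable H1 : 'rV[R]_d -> R.
Hypothesis HH1 : forall x xi, (hamiltonian mu x xi <= (H1 xi)%:E)%E.
Implicit Types (x y z xi eta a : 'rV[R]_d) (Lam K B h : R).
Local Notation e i := (delta_mx 0 i : 'rV[R]_d).
Local Notation moment_bound := (moment_bound H1).

(** A jump of size h z multiplies exp (W / h) by the exponential of
(W (y + h z) - W y) / h, which is <z, W' y> up to h K |z| ^ 2; the difference of
the exponentials is integrated with [moment]. *)
Lemma jump_operator_expR_le (W : 'rV[R]_d -> R) Lam K h y :
  smooth W -> 0 < h -> 0 <= K -> 0 <= Lam ->
  (forall i x, `|'D_(e i) W x| <= Lam) ->
  (forall x v, `|W (x + v) - W x - dotrV v (grad W x)| <= K * l1norm v ^+ 2) ->
  jump_operator mu h (expR \o (fun x => h^-1 * W x)) y <=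
  expR (h^-1 * W y) * (hamR mu y (grad W y) + h * K * moment_bound Lam).
Proof.
move=> Ws h0 K0 Lam0 WLam WK.
have h00 : h != 0 by rewrite gt_eqF.
set F := expR \o _; set p := grad W y.
have pd : has_partials W.
  by move=> i x; exact: smooth_upto_partials (Ws 1%N) i x.
have gF : grad F y = (h^-1 * F y) *: p.
  apply/rowP => i; rewrite !mxE.
  have dW := derivableP (pd i y).
  have dhW : is_derive y (e i) (fun x => h^-1 * W x) (h^-1 * 'D_(e i) W y).
    by have := is_deriveZ h^-1 dW.
  have [_ ->] := is_derive_expR_comp dhW.
  by rewrite /F /=; ring.
pose D z := h^-1 * (W (y + h *: z) - W y).
have lz z : l1norm (h *: z) = h * l1norm z by rewrite l1normZ gtr0_norm.
have DLam z : `|D z| <= Lam * l1norm z.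
  rewrite normrM gtr0_norm ?invr_gt0// ler_pdivrMl//.
  by apply: le_trans (partials_bounded_lipschitz pd WLam y _) _; rewrite lz mulrCA.
have pLam i : `|p 0 i| <= Lam by rewrite mxE.
have pz z : `|dotrV z p| <= Lam * l1norm z by exact: dotrV_le_l1norm.
have DK z : `|D z - dotrV z p| <= h * K * l1norm z ^+ 2.
  have -> : D z - dotrV z p = h^-1 * (W (y + h *: z) - W y - dotrV (h *: z) p).
    have -> : dotrV (h *: z) p = h * dotrV z p.
      by rewrite /dotrV mulr_sumr; apply: eq_bigr => i _; rewrite mxE mulrA.
    by rewrite mulrBr mulKf.
  rewrite normrM gtr0_norm ?invr_gt0// ler_pdivrMl//.
  by apply: le_trans (WK y _) _; rewrite lz exprMn; lra.
have FE z : F (y + h *: z) - F y - h * dotrV z (grad F y) =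
    F y * (expR (D z) - 1 - dotrV z p).
  have -> : F (y + h *: z) = F y * expR (D z).
    by rewrite /F /= -expRD; congr expR; rewrite /D; ring.
  by rewrite gF dotrVZr mulrA mulrA mulfV// mul1r; ring.
have l0 z := @l1norm_ge0 R d z.
have cD : continuous D.
  have cs : continuous (fun z : 'rV[R]_d => y + h *: z).
    by move=> z; apply: (@continuousD R 'rV[R]_d 'rV[R]_d (cst y) (fun z => h *: z) z);
      [exact: cst_continuous|exact: scaler_continuous].
  have cW : continuous (fun t : R => h^-1 * (t - W y)).
    move=> t; apply: cvgM; first exact: cvg_cst.
    by apply: cvgB; [exact: cvg_id|exact: cvg_cst].
  move=> z; have c1 := continuous_comp (cs z) (@smooth_continuous R d W Ws (y + h *: z)).
  exact: continuous_comp c1 (cW _).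
have cG : continuous (fun z => expR (D z) - 1 - dotrV z p).
  move=> z; have ce : continuous (fun t : R => expR t - 1).
    by move=> t; apply: cvgB; [exact: continuous_expR|exact: cvg_cst].
  apply: (@continuousB _ _ _ (fun z => expR (D z) - 1) (fun z => dotrV z p)).
    exact: continuous_comp (cD z) (ce _).
  exact: dotrV_continuous.
have eL z t : `|t| <= Lam * l1norm z -> expR t <= expR (Lam * l1norm z).
  by move=> tz; rewrite ler_expR (le_trans (ler_norm _)).
have e1 z : 1 <= expR (Lam * l1norm z).
  by rewrite -[leLHS]expR0 ler_expR mulr_ge0.
have iG : (mu y).-integrable setT (EFin \o (fun z => expR (D z) - 1 - dotrV z p)).
  apply: (@integrable_moment _ _ _ _ HH1 y _ (Lam ^+ 2 + h * K) Lam) => // z.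
  have -> : expR (D z) - 1 - dotrV z p = cexp (D z) + (D z - dotrV z p).
    by rewrite /cexp; ring.
  apply: le_trans (ler_normD _ _) _; rewrite ger0_norm ?cexp_ge0// mulrDl lerD//.
    apply: le_trans (cexp_le_sqr _) _; rewrite /moment mulrA.
    rewrite ler_pM ?sqr_ge0 ?expR_ge0//; last by rewrite eL// normr_id.
    by rewrite -[D z ^+ 2]real_normK ?num_real// -exprMn lerXn2r ?nnegrE// mulr_ge0.
  apply: le_trans (DK z) _; rewrite /moment mulrA ler_peMr//.
  by rewrite mulr_ge0 ?mulr_ge0 ?exprn_ge0// ltW.
rewrite /jump_operator; under eq_Rintegral do rewrite FE.
rewrite RintegralZl// ler_wpM2l ?expR_ge0//.
have ic := cexp_integrable HH1 y p.
have im := integrableZl measurableT (h * K) (moment_integrable HH1 Lam y).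
apply: (@le_trans _ _ (\int[mu y]_z (cexp (dotrV z p) + h * K * moment Lam z))).
  apply: le_Rintegral => //; first by have := integrableD measurableT ic im.
  move=> z _; have := expR_sub_le (s := dotrV z p) (t := D z)
      (le_trans (ler_norm _) (DK z)) _ (le_trans (ler_norm _) (DLam z)).
  rewrite !mulr_ge0 ?exprn_ge0 ?(ltW h0)// => /(_ isT).
  by rewrite /cexp /moment; lra.
rewrite RintegralD// lerD// RintegralZl//; last exact: moment_integrable HH1 Lam y.
by rewrite ler_wpM2l ?(moment_Rintegral HH1)// mulr_ge0// ltW.
Qed.

End generator_estimate.

(** * Decay of exponential supersolutions under the semigroup *)

Section semigroup_facts.
Context {R : realType} {d : nat}.
Variable Q : R -> R.-pker 'rV[R]_d ~> 'rV[R]_d.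
Hypothesis Qmarkov : markov_semigroup Q.
Implicit Types (f g : 'rV[R]_d -> R) (s t M : R) (x y : 'rV[R]_d).

Local Notation PQ := (semigroup_op Q).

Definition bmeas f := measurable_fun [set: 'rV[R]_d] f /\
  exists M : R, forall x, `|f x| <= M.

Lemma bmeas_integrable t x f : bmeas f -> (Q t x).-integrable setT (EFin \o f).
Proof.
move=> [mf [M fM]]; apply: measurable_bounded_integrable => //.
  by rewrite prob_kernel ltry.
exists M; split; first exact: num_real.
by move=> N MN y _ /=; rewrite (le_trans (fM y))// ltW.
Qed.

Lemma bmeas_cst (c : R) : bmeas (fun=> c).
Proof. by split; [exact: measurable_cst|exists `|c|]. Qed.

Lemma bmeasD f g : bmeas f -> bmeas g -> bmeas (fun x => f x + g x).
Proof.
move=> [mf [M fM]] [mg [N gN]]; split; first exact: measurable_funD.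
by exists (M + N) => x; rewrite (le_trans (ler_normD _ _))// lerD.
Qed.

Lemma bmeasZ (c : R) f : bmeas f -> bmeas (fun x => c * f x).
Proof.
move=> [mf [M fM]]; split; first exact: measurable_funM.
by exists (`|c| * M) => x; rewrite normrM ler_wpM2l.
Qed.

Lemma bmeasB f g : bmeas f -> bmeas g -> bmeas (fun x => f x - g x).
Proof.
move=> bf bg; have := bmeasD bf (bmeasZ (-1) bg).
by under [X in bmeas X -> _]eq_fun do rewrite mulN1r.
Qed.

Lemma smooth_bmeas f : smooth f -> bmeas f.
Proof.
move=> fs; split; first by apply: continuous_measurable_rV; exact: smooth_continuous.
exact: smooth_upto_bounded (fs 0%N).
Qed.

Lemma PQ_cst t x c : PQ t (fun=> c) x = c.
Proof. by rewrite /semigroup_op Rintegral_cst// prob_kernel mulr1. Qed.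

Lemma PQD t x f g : bmeas f -> bmeas g ->
  PQ t (fun y => f y + g y) x = PQ t f x + PQ t g x.
Proof. by move=> bf bg; rewrite /semigroup_op RintegralD//; exact: bmeas_integrable. Qed.

Lemma PQZ t x c f : bmeas f -> PQ t (fun y => c * f y) x = c * PQ t f x.
Proof. by move=> bf; rewrite /semigroup_op RintegralZl//; exact: bmeas_integrable. Qed.

Lemma PQ_le t x f g : bmeas f -> bmeas g -> (forall y, f y <= g y) ->
  PQ t f x <= PQ t g x.
Proof. by move=> bf bg fg; apply: le_Rintegral => //; exact: bmeas_integrable. Qed.

Lemma PQ_norm_le t x f M : bmeas f -> (forall y, `|f y| <= M) -> `|PQ t f x| <= M.
Proof.
move=> bf fM; rewrite ler_norml; apply/andP; split.
  rewrite -(PQ_cst t x (- M)); apply: PQ_le => //; first exact: bmeas_cst.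
  by move=> y; have := fM y; rewrite ler_norml => /andP[].
rewrite -(PQ_cst t x M); apply: PQ_le => //; first exact: bmeas_cst.
by move=> y; rewrite (le_trans (ler_norm _)).
Qed.

Lemma PQE t x f : bmeas f -> (\int[Q t x]_y (f y)%:E = (PQ t f x)%:E)%E.
Proof.
by move=> bf; rewrite /semigroup_op /Rintegral fineK//;
  exact: integrable_fin_num (bmeas_integrable t x bf).
Qed.

Lemma PQ_bmeas t f : bmeas f -> bmeas (PQ t f).
Proof.
move=> bf; have [mf [M fM]] := bf; split; last first.
  by exists M => x; exact: PQ_norm_le.
have bfM : bmeas (fun x => f x + M) by apply: bmeasD => //; exact: bmeas_cst.
have mg : measurable_fun setT (fun x => \int[Q t x]_y ((f y + M)%:E))%E.
  apply: (@measurable_fun_integral_kernel _ _ _ _ _ (Q t) _ (fun y => (f y + M)%:E)).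
  - by move=> U mU; exact: measurable_kernel.
  - by move=> y; rewrite lee_fin; have := fM y; rewrite ler_norml => /andP[]; lra.
  - by apply/measurable_EFinP; case: bfM.
have -> : PQ t f = (fun x => fine (\int[Q t x]_y ((f y + M)%:E))%E - M).
  apply/funext => x; rewrite (PQE _ _ bfM)/= PQD// ?PQ_cst ?addrK//.
  exact: bmeas_cst.
apply: measurable_funB; last exact: measurable_cst.
exact: measurableT_comp.
Qed.

Lemma PQ0 f x : bmeas f -> PQ 0 f x = f x.
Proof.
move=> bf; have [mf _] := bf.
have h := bmeas_integrable 0 x bf.
rewrite /semigroup_op /Rintegral (@eq_measure_integral _ _ _ setT \d_x); last first.
  by move=> A mA _; rewrite Qmarkov.1.
by rewrite integral_dirac// ?diracT ?mul1e//; exact/measurable_EFinP.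
Qed.

Lemma PQ_add s t f x : 0 <= s -> 0 <= t -> bmeas f ->
  PQ (s + t) f x = PQ s (PQ t f) x.
Proof.
move=> s0 t0 bf; have [mf [M fM]] := bf.
have bM := bmeas_cst M; have bfM := bmeasD bf bM.
have fM0 y : (0 <= (f y + M)%:E)%E.
  by rewrite lee_fin; have := fM y; rewrite ler_norml => /andP[]; lra.
have h : (\int[Q (s + t) x]_y (f y + M)%:E = \int[Q s x]_y \int[Q t y]_z (f z + M)%:E)%E.
  have := @integral_kcomp _ _ _ _ _ _ R (Q s) (kernel.kernel_snd (T0 := 'rV[R]_d) (Q t)) x
    (fun z => (f z + M)%:E) fM0.
  move=> /(_ (ltac:(apply/measurable_EFinP; exact: bfM.1))) <-.
  apply: eq_measure_integral => A mA _ /=.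
  by rewrite Qmarkov.2.
move: h; rewrite (PQE _ _ bfM); under eq_integral do rewrite (PQE _ _ bfM).
rewrite (PQE _ _ (PQ_bmeas t bfM)) => -[].
rewrite PQD// PQ_cst => h; apply: (addIr M); rewrite h.
have -> : PQ t (fun y => f y + M) = (fun y => PQ t f y + M).
  by apply/funext => y; rewrite PQD// PQ_cst.
by rewrite PQD// ?PQ_cst//; exact: PQ_bmeas.
Qed.

Lemma PQ_cvg t x (F : nat -> 'rV[R]_d -> R) f M : (forall n, bmeas (F n)) ->
  (forall n y, `|F n y| <= M) -> (forall y, F n y @[n --> \oo] --> f y) ->
  bmeas f /\ PQ t (F n) x @[n --> \oo] --> PQ t f x.
Proof.
move=> bF FM Ff.
have bf : bmeas f.
  split.
    apply: (@measurable_fun_cvg _ _ _ setT F) => //.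
    by move=> n; case: (bF n).
  exists M => y; have cn : `|F n y| @[n --> \oo] --> `|f y|.
    by apply: cvg_norm; exact: Ff.
  rewrite -(cvg_lim _ cn)//; apply: limr_le; first exact: cvgP cn.
  by apply: nearW => n; exact: FM.
split => //.
have := @dominated_convergence _ _ _ (Q t x) setT measurableT
  (fun n y => (F n y)%:E) (EFin \o f) (EFin \o cst M).
case.
- by move=> n; apply/measurable_EFinP; case: (bF n).
- by apply/measurable_EFinP; case: bf.
- apply: aeW => y _; apply: cvg_EFin; last exact: Ff.
  exact: nearW.
- exact: bmeas_integrable (bmeas_cst M).
- by apply: aeW => y n _; rewrite /= lee_fin.
move=> _ _; rewrite /= (PQE _ _ bf).
rewrite (_ : (fun _ => _) = (fun n => (PQ t (F n) x)%:E)); last first.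
  by apply/funext => n; rewrite PQE.
by move=> /fine_cvgP[].
Qed.

End semigroup_facts.

Section dini.
Context {R : realType}.

(** The set of times s with psi s <= psi 0 + eta s contains its supremum, by
one-sided continuity, and a step from there would leave it. *)
Lemma dini_nonincreasing (psi : R -> R) (T : R) : 0 <= T ->
  (forall s e : R, 0 <= s <= T -> 0 < e -> exists2 del : R, 0 < del &
     forall r : R, 0 <= r <= s -> s - del < r -> psi s <= psi r + e) ->
  (forall s eta : R, 0 <= s < T -> 0 < eta ->
     exists2 t : R, 0 < t <= T - s & psi (s + t) <= psi s + eta * t) ->
  psi T <= psi 0.
Proof.
move=> T0 cpsi step.
suff H (eta : R) : 0 < eta -> psi T <= psi 0 + eta * T.
  have [->//|TN0] := eqVneq T 0.
  have Tp : 0 < T by rewrite lt_neqAle eq_sym TN0.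
  apply/ler_addgt0Pr => e e0.
  by have := H (e / T) (divr_gt0 e0 Tp); rewrite divfK// gt_eqF.
move=> eta0.
pose S : set R := [set s | 0 <= s <= T /\ psi s <= psi 0 + eta * s].
have S0 : S 0 by rewrite /S /= lexx T0 mulr0 addr0.
have Sub : ubound S T by move=> s [/andP[]].
have hS : has_sup S by split; [exists 0|exists T].
pose m := sup S.
have m0 : 0 <= m by exact: (ub_le_sup hS.2 S0).
have mT : m <= T by apply: ge_sup => //; exists 0.
have mS : psi m <= psi 0 + eta * m.
  apply/ler_addgt0Pr => e e0.
  have [|del del0 H] := cpsi m e _ e0; first by rewrite m0.
  have [r [/andP[r0 rT] Sr] rm] := sup_adherent del0 hS.
  have rm' : r <= m by apply: (ub_le_sup hS.2); split=> //; rewrite r0.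
  apply: le_trans (H r _ rm) _; first by rewrite r0.
  rewrite lerD2r; apply: le_trans Sr _.
  by rewrite lerD2l ler_wpM2l// ltW.
have [mlt|] := ltP m T; last by move=> Tm; rewrite (_ : T = m)//; apply/le_anti/andP.
have [|t /andP[t0 tT] ht] := step m eta _ eta0; first by rewrite m0.
have : m + t <= m.
  apply: (ub_le_sup hS.2); split; first by rewrite addr_ge0 ?(ltW t0)//= addrC -lerBrDr.
  by apply: le_trans ht _; rewrite mulrDr addrA lerD2r.
by rewrite gerDl leNgt t0.
Qed.

End dini.

Section dynkin.
Context {R : realType} {d : nat}.
Variable Q : R -> R.-pker 'rV[R]_d ~> 'rV[R]_d.
Hypothesis Qmarkov : markov_semigroup Q.
Variable A : ('rV[R]_d -> R) -> 'rV[R]_d -> R.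
Hypothesis QA : generated_by Q A.
Implicit Types (f V D : 'rV[R]_d -> R) (s t : R) (x y : 'rV[R]_d).

Local Notation PQ := (semigroup_op Q).

Lemma generator_bound f : smooth f -> exists2 M : R, 0 <= M &
  forall t x, 0 < t -> `|PQ t f x - f x| <= M * t.
Proof.
move=> /smooth_smooth_bounded/QA[_ [M HM]]; exists `|M| => // t x t0.
have := HM t x t0; rewrite normrM gtr0_norm ?invr_gt0// ler_pdivrMl// => h.
by rewrite (le_trans h)// mulrC ler_wpM2r ?ler_norm// ltW.
Qed.

(** The function s |-> P_s f_s is nonincreasing, as its right derivative is
P_s (D f_s + A f_s). The limit that defines A f_s is pointwise and bounded, so it
passes under P_s by dominated convergence, along the steps 1 / (n + 1). *)
Lemma supersolution_decay V D (tau : R) x : 0 <= tau -> smooth V -> smooth D ->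
  let f s := fun y => expR (V y + s * D y) in
  (forall s y, 0 <= s < tau -> D y * f s y + A (f s) y <= 0) ->
  PQ tau (f tau) x <= f 0 x.
Proof.
move=> tau0 Vs Ds f fA.
have fs s : smooth (f s).
  by have := smooth_expR (smoothD Vs (smoothZ s Ds)).
have bf s := smooth_bmeas (fs s).
have [a Va] := smooth_upto_bounded (Vs 0%N).
have [b0 Db0] := smooth_upto_bounded (Ds 0%N).
pose b := `|b0|; have b_ge0 : 0 <= b by exact: normr_ge0.
have Db y : `|D y| <= b by rewrite (le_trans (Db0 y))// ler_norm.
pose E := expR (a + tau * b).
have E0 : 0 < E by exact: expR_gt0.
have expE s y : 0 <= s <= tau -> f s y <= E.
  move=> /andP[s0 st]; rewrite ler_expR lerD//; first exact: le_trans (ler_norm _) (Va y).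
  by apply: le_trans (ler_norm _) _; rewrite normrM (ger0_norm s0) ler_pM.
have f_ge0 s y : 0 <= f s y by exact: expR_ge0.
have lip s r y : 0 <= r <= s -> s <= tau -> f s y - f r y <= b * E * (s - r).
  move=> /andP[r0 rs] st.
  have s0 : 0 <= s by exact: le_trans rs.
  have h := expR_tangent (V y + s * D y) (V y + r * D y).
  have h1 := expE s y; rewrite s0 st in h1; have {}h1 := h1 isT.
  have := Db y; rewrite ler_norml => /andP[h2 h3].
  have h4 := f_ge0 s y.
  have h5 : f s y - f r y <= f s y * ((s - r) * D y) by rewrite /f; lra.
  apply: (le_trans h5).
  apply: (@le_trans _ _ (f s y * ((s - r) * b))).
    by rewrite ler_wpM2l// ler_wpM2l// subr_ge0.
  have -> : b * E * (s - r) = E * ((s - r) * b) by ring.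
  by rewrite ler_wpM2r// mulr_ge0// subr_ge0.
have second s t y : 0 <= s -> 0 <= t -> s + t <= tau ->
    f (s + t) y - f s y <= t * (D y * f s y) + t ^+ 2 * (b ^+ 2 * (E * expR (tau * b))).
  move=> s0 t0 stt.
  have -> : f (s + t) y = f s y * expR (t * D y) by rewrite /f -expRD; congr expR; ring.
  have h := cexp_le_sqr (t * D y).
  have h1 : f s y <= E by apply: expE; rewrite s0 (le_trans _ stt)// lerDl.
  have h2 : (t * D y) ^+ 2 * expR `|t * D y| <= t ^+ 2 * b ^+ 2 * expR (tau * b).
    rewrite ler_pM ?sqr_ge0 ?expR_ge0//.
      rewrite exprMn ler_wpM2l ?sqr_ge0// -[D y ^+ 2]real_normK ?num_real//.
      by rewrite lerXn2r ?nnegrE.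
    rewrite ler_expR normrM (ger0_norm t0) ler_pM// (le_trans _ stt)// lerDr//.
  have h3 : f s y * cexp (t * D y) <= E * (t ^+ 2 * b ^+ 2 * expR (tau * b)).
    by rewrite ler_pM ?cexp_ge0 ?(le_trans h).
  by rewrite /cexp in h3; lra.
pose psi s := PQ s (f s) x.
suff : psi tau <= psi 0 by rewrite /psi PQ0.
apply: dini_nonincreasing => //.
  move=> s e /andP[s0 st] e0.
  have [M M0 HM] := generator_bound (fs s).
  pose c := M + b * E.
  have c0 : 0 <= c by rewrite addr_ge0// mulr_ge0// ltW.
  exists (e / (c + 1)); first by rewrite divr_gt0// ltr_wpDl.
  move=> r /andP[r0 rs] sr.
  have [->|rNs] := eqVneq r s; first by rewrite lerDl ltW.
  have t0 : 0 < s - r by rewrite subr_gt0 lt_neqAle rNs.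
  have -> : psi s = PQ r (PQ (s - r) (f s)) x.
    by rewrite /psi -PQ_add ?subrKC// ltW.
  (* psi s - psi r is P_r of P_(s - r) f_s - f_r, which is O(s - r) because the
   difference quotients of P at f_s are bounded. *)
have le1 : forall y, PQ (s - r) (f s) y <= f r y + c * (s - r).
    move=> y; have := HM (s - r) y t0; rewrite ler_norml => /andP[_ h1].
    have h2 := lip s r y; rewrite r0 rs st in h2; have {}h2 := h2 isT isT.
    by rewrite /c; lra.
  have bc : @bmeas R d (fun=> c * (s - r)) by exact: bmeas_cst.
  have := PQ_le Q r x (PQ_bmeas Q (s - r) (bf s)) (bmeasD (bf r) bc) le1.
  rewrite PQD// PQ_cst => h; apply: (le_trans h); rewrite lerD2l.
  have : (s - r) * (c + 1) <= e.
    by rewrite -ler_pdivlMr ?ltr_wpDl// ltW// ltrBlDl -ltrBlDr.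
  by move: t0; nra.
move=> s eta /andP[s0 st] eta0.
have [Af_cvg [M0 HM0]] := QA (smooth_smooth_bounded (fs s)).
pose tn n : R := n.+1%:R^-1.
have tn0 n : 0 < tn n by rewrite invr_gt0.
pose G n y := (tn n)^-1 * (PQ (tn n) (f s) y - f s y) + D y * f s y.
have bDf : bmeas (fun y => D y * f s y) by exact: smooth_bmeas (smoothM Ds (fs s)).
have bG n : bmeas (G n).
  apply: bmeasD => //; apply: bmeasZ; apply: bmeasB => //.
  exact: PQ_bmeas.
have [K DfK] := bDf.2.
have GM n y : `|G n y| <= M0 + K.
  by rewrite (le_trans (ler_normD _ _))// lerD// HM0.
have Gcvg y : G n y @[n --> \oo] --> A (f s) y + D y * f s y.
  apply: cvgD; last exact: cvg_cst.
  have := Af_cvg y => /cvg_at_rightP/(_ tn); apply; split => //.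
  exact: cvg_harmonic.
have [bGoo PG] := PQ_cvg Q s x bG GM Gcvg.
have Goo0 : PQ s (fun y => A (f s) y + D y * f s y) x <= 0.
  rewrite -(PQ_cst Q s x 0); apply: PQ_le => //; first exact: bmeas_cst.
  by move=> y; rewrite addrC fA// s0.
have [M1 M10 HM1] := generator_bound (smoothM Ds (fs s)).
pose C := b ^+ 2 * (E * expR (tau * b)).
have C0 : 0 <= C by rewrite mulr_ge0 ?sqr_ge0// mulr_ge0 ?expR_ge0// ltW.
have eta2 : 0 < eta / 2 by rewrite divr_gt0.
have tst : 0 < tau - s by rewrite subr_gt0.
have c2 : 0 < eta / 2 / (M1 + C + 1) by rewrite divr_gt0// ltr_wpDl// addr_ge0.
near \oo => n.
have n1 : tn n <= tau - s by near: n; apply: (cvgr_le _ cvg_harmonic).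
have n2 : tn n <= eta / 2 / (M1 + C + 1) by near: n; apply: (cvgr_le _ cvg_harmonic).
have n3 : PQ s (G n) x <= eta / 2.
  by near: n; apply: (cvgr_le _ PG); exact: le_lt_trans Goo0 _.
exists (tn n); first by rewrite tn0.
have t0 := tn0 n; have t0' := ltW t0.
set t := tn n in n1 n2 t0 t0' *.
have stt : s + t <= tau by rewrite addrC -lerBrDr.
rewrite /psi PQ_add//.
(* Under P_t, f (s + t) is replaced by f s + t D f s; with the difference
   quotient of P at f s this makes up t G n, and the remainders are O(t^2). *)
have pt y : PQ t (f (s + t)) y <= f s y + (t * G n y + t ^+ 2 * (M1 + C)).
  have b1 : bmeas (fun z => t * (D z * f s z) + t ^+ 2 * C).
    by apply: bmeasD; [exact: bmeasZ|exact: bmeas_cst].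
  have h1 : PQ t (f (s + t)) y <= PQ t (fun z => f s z + (t * (D z * f s z) + t ^+ 2 * C)) y.
    apply: PQ_le => //; first exact: bmeasD.
    by move=> z; have := second s t z s0 t0' stt; rewrite -/C; lra.
  apply: (le_trans h1); rewrite PQD// PQD//; last 2 first.
    exact: bmeasZ.
    exact: bmeas_cst.
  rewrite PQZ// PQ_cst.
  have := HM1 t y t0; rewrite ler_norml => /andP[_ h2].
  have -> : t * G n y = PQ t (f s) y - f s y + t * (D y * f s y).
    by rewrite /G -/t mulrDr mulVKf// gt_eqF.
  have h3 : t * (PQ t (fun z => D z * f s z) y - D y * f s y) <= t * (M1 * t).
    by rewrite ler_wpM2l.
  by lra.
have b2 : bmeas (fun y => t * G n y + t ^+ 2 * (M1 + C)).
  by apply: bmeasD; [exact: bmeasZ|exact: bmeas_cst].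
have := PQ_le Q s x (PQ_bmeas Q t (bf (s + t))) (bmeasD (bf s) b2) pt.
rewrite PQD// PQD//; last 2 first.
  exact: bmeasZ.
  exact: bmeas_cst.
rewrite PQZ// PQ_cst => h; apply: (le_trans h); rewrite lerD2l.
have h4 : t * (M1 + C) <= eta / 2.
  have : t * (M1 + C + 1) <= eta / 2.
    by rewrite -ler_pdivlMr// ltr_wpDl// addr_ge0.
  by apply: le_trans; rewrite ler_wpM2l// lerDl.
have h5 : t * PQ s (G n) x <= t * (eta / 2) by rewrite ler_wpM2l.
have h6 : t * (t * (M1 + C)) <= t * (eta / 2) by rewrite ler_wpM2l.
by rewrite expr2; lra.
Unshelve. all: by end_near. Qed.

End dynkin.

(** * The discrete value function and its averages *)

Section value_function.
Context {R : realType} {d : nat}.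
Variable l : 'rV[R]_d -> 'rV[R]_d -> R.
Implicit Types (x y a u : 'rV[R]_d) (kap del eta C : R).

(** Relative continuity in the position, uniformly in position and speed. *)
Definition uniform_modulus := forall kap, 0 < kap -> exists2 del : R, 0 < del &
  forall x u a, l1norm u < del -> l (x + u) a <= l x a + kap * (1 + l x a).

Hypothesis l_ge0 : forall x a, 0 <= l x a.
Hypothesis l0 : forall x, l x 0 = 0.
Hypothesis lmod : uniform_modulus.

Variables (J G tau : R) (gg : 'rV[R]_d -> R).
Hypothesis gg01 : forall x, 0 <= gg x <= J.
Hypothesis G0 : 0 <= G.
Hypothesis ggG : forall x u, `|gg (x + u) - gg x| <= G * l1norm u.
Hypothesis tau01 : 0 < tau <= 1.

(** Dynamic programming: the least discretised action over j steps of length tau,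
plus the terminal cost gg. *)
Fixpoint value (j : nat) : 'rV[R]_d -> R :=
  if j is j'.+1 then
    fun y => inf [set tau * l y a + value j' (y + tau *: a) | a in [set: 'rV[R]_d]]
  else gg.

Lemma value_ge0 j y : 0 <= value j y.
Proof.
have t0 : 0 <= tau by case/andP: tau01 => /ltW.
elim: j y => [|j IH] y /=; first by case/andP: (gg01 y).
apply: lb_le_inf => [|_ [a _ <-]]; last by rewrite addr_ge0// mulr_ge0.
by exists (tau * l y 0 + value j (y + tau *: 0)); exists 0.
Qed.

Lemma value_inf j y : has_inf [set tau * l y a + value j (y + tau *: a) | a in [set: 'rV[R]_d]].
Proof.
split; first by exists (tau * l y 0 + value j (y + tau *: 0)); exists 0.
exists 0 => _ [a _ <-]; rewrite addr_ge0 ?value_ge0// mulr_ge0//.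
by case/andP: tau01 => /ltW.
Qed.

Lemma value_step j y a : value j.+1 y <= tau * l y a + value j (y + tau *: a).
Proof. by apply: (ge_inf (value_inf j y).2); exists a. Qed.

Lemma value_step_adherent j y eta : 0 < eta ->
  exists a, tau * l y a + value j (y + tau *: a) <= value j.+1 y + eta.
Proof.
move=> eta0; have [_ [a _ <-] h] := inf_adherent eta0 (value_inf j y).
by exists a; exact: ltW.
Qed.

Lemma value_nonincreasing j y : value j.+1 y <= value j y.
Proof. by have := value_step j y 0; rewrite l0 mulr0 add0r scaler0 addr0. Qed.

Lemma value_le_sub j i y : value j y <= value (j - i) y.
Proof.
elim: i => [|i IH]; first by rewrite subn0.
apply: (le_trans IH); rewrite subnS; case: (j - i)%N => //= k.
exact: value_nonincreasing.
Qed.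

Lemma value_leJ j y : value j y <= J.
Proof. by apply: le_trans (value_le_sub j j y) _; rewrite subnn; case/andP: (gg01 y). Qed.

Lemma value_norm_le j y : `|value j y| <= J.
Proof. by rewrite ger0_norm ?value_ge0// value_leJ. Qed.

(** A near-optimal speed at x costs at most J + 1, and at x + u it costs hardly
more. *)
Lemma value_buc j : buc (value j).
Proof.
have [t0 t1] := andP tau01; have t0' := ltW t0.
split; first by exists J; exact: value_norm_le.
elim: j => [|j IH] eta eta0.
  exists (eta / (G + 1)); first by rewrite divr_gt0// ltr_wpDl.
  move=> x u; rewrite ltr_pdivlMr ?ltr_wpDl// => h.
  apply: (le_trans (ggG x u)); apply: le_trans (ltW h).
  have := l1norm_ge0 u; nra.
have J0 : 0 <= J by have := gg01 0; case/andP; exact: le_trans.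
pose e := Num.min eta 1.
have e0 : 0 < e by rewrite lt_min eta0 ltr01.
have e_eta : e <= eta by rewrite ge_min lexx.
have e1 : e <= 1 by rewrite ge_min lexx orbT.
have e30 : 0 < e / 3 by rewrite divr_gt0.
have [d1 d10 H1] := IH _ e30.
have k0 : 0 < e / 3 / (J + 3) by rewrite !divr_gt0//; lra.
have [d2 d20 H2] := lmod k0.
have half x u : l1norm u < Num.min d1 d2 -> value j.+1 (x + u) <= value j.+1 x + e.
  rewrite lt_min => /andP[u1 u2].
  have [a ha] := value_step_adherent j x e30.
  have h1 := value_step j (x + u) a.
  have h2 := H1 (x + tau *: a) u u1; rewrite ler_norml in h2; case/andP: h2 => _ h2.
  have h3 := H2 x u a u2.
  rewrite addrAC in h1.
  have h4 : tau * l x a <= J + 1.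
    by have := value_leJ j.+1 x; have := value_ge0 j (x + tau *: a); lra.
  have h5 : tau * (e / 3 / (J + 3) * (1 + l x a)) <= e / 3.
    have -> : tau * (e / 3 / (J + 3) * (1 + l x a)) =
        e / 3 * ((tau + tau * l x a) / (J + 3)) by field; lra.
    by rewrite ler_piMr ?(ltW e30)// ler_pdivrMr; lra.
  have h6 : tau * l (x + u) a <= tau * l x a + tau * (e / 3 / (J + 3) * (1 + l x a)).
    by rewrite -mulrDr ler_wpM2l.
  by lra.
exists (Num.min d1 d2); first by rewrite lt_min d10.
move=> x u u12; rewrite ler_norml; have h1 := half x u u12.
have := half (x + u) (- u); rewrite l1normN addrK => /(_ u12) h2.
by apply/andP; split; lra.
Qed.

Definition path_pos y (a : nat -> 'rV[R]_d) k := y + tau *: \sum_(i < k) a i.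

Lemma value_path j y eta : 0 < eta -> exists a : nat -> 'rV[R]_d,
  \sum_(k < j) (tau * l (path_pos y a k) (a k)) + gg (path_pos y a j) <=
  value j y + eta.
Proof.
elim: j y eta => [|j IH] y eta eta0.
  exists (fun=> 0); rewrite !big_ord0 add0r /path_pos big_ord0 scaler0 addr0 /=.
  by rewrite lerDl ltW.
have e2 : 0 < eta / 2 by rewrite divr_gt0.
have [a0 h0] := value_step_adherent j y e2.
have [a ha] := IH (y + tau *: a0) _ e2.
exists (fun k => if k is k'.+1 then a k' else a0).
have E k : path_pos y (fun k => if k is k'.+1 then a k' else a0) k.+1 =
    path_pos (y + tau *: a0) a k.
  by rewrite /path_pos big_ord_recl/= scalerDr addrA.
rewrite big_ord_recl/= E.
have -> : path_pos y (fun k => if k is k'.+1 then a k' else a0) 0 = y.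
  by rewrite /path_pos big_ord0 scaler0 addr0.
under eq_bigr do rewrite E.
by rewrite -addrA; lra.
Qed.

Variables (eps Cg kap : R) (k : R -> R) (m : nat).
Hypothesis ak : averaging eps k.
Hypothesis eps0 : 0 < eps.
Hypothesis m0 : (0 < m)%N.
Hypothesis GCg : forall x a, G * l1norm a <= l x a + Cg.
Hypothesis lkap : forall x u a, l1norm u <= d%:R * eps ->
  l (x + u) a <= l x a + kap * (1 + l x a).
Hypothesis Cg0 : 0 <= Cg.

Local Notation S := (mollify eps (axes k)).

(** The average of the values over m consecutive times, where negative times are
truncated to 0; the sign turns values into subsolutions. *)
Definition time_average j z : R := - (m%:R^-1 * \sum_(i < m) value (j - i) z).

Definition subsolution j : 'rV[R]_d -> R := S (time_average j).

Let kk : kernels eps (axes (d := d) k).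
Proof. by case: ak => kk _ _; exact: axes_kernels. Qed.

Let mR : 0 < m%:R :> R.
Proof. by rewrite ltr0n. Qed.

Lemma sum_cst_ord (C : R) : \sum_(i < m) C = m%:R * C.
Proof. by rewrite sumr_const card_ord mulr_natl. Qed.

Lemma time_average_buc j : buc (time_average j).
Proof.
apply: bucN; split.
  exists J => x; rewrite normrM gtr0_norm ?invr_gt0// ler_pdivrMl//.
  apply: le_trans (ler_norm_sum _ _ _) _; rewrite -sum_cst_ord.
  by apply: ler_sum => i _; exact: value_norm_le.
move=> eta eta0.
have : forall n, exists2 del : R, 0 < del & forall x u, l1norm u < del -> forall i, (i < n)%N ->
    `|value (j - i) (x + u) - value (j - i) x| <= eta.
  elim=> [|n [d1 d10 IH]]; first by exists 1.
  have [_ /(_ _ eta0)[d2 d20 H]] := value_buc (j - n).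
  exists (Num.min d1 d2); first by rewrite lt_min d10.
  move=> x u; rewrite lt_min => /andP[u1 u2] i; rewrite ltnS leq_eqVlt.
  by case/orP => [/eqP ->|ilt]; [exact: H|exact: IH].
move=> /(_ m)[del del0 H]; exists del => // x u ux.
rewrite -mulrBr -sumrB normrM gtr0_norm ?invr_gt0// ler_pdivrMl//.
apply: le_trans (ler_norm_sum _ _ _) _; rewrite -sum_cst_ord.
by apply: ler_sum => i _; exact: H.
Qed.

Lemma time_average_norm_le j z : `|time_average j z| <= J.
Proof.
rewrite normrN normrM gtr0_norm ?invr_gt0// ler_pdivrMl//.
apply: le_trans (ler_norm_sum _ _ _) _; rewrite -sum_cst_ord.
by apply: ler_sum => i _; exact: value_norm_le.
Qed.

(** Dynamic programming survives both averages. The mollifier shifts y by at most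
d eps, which the modulus of l absorbs in kap; truncation at time 0 affects only
j < m, where the Lipschitz constant G of gg is covered by coercivity. *)
Lemma subsolution_step j y a :
  subsolution j (y + tau *: a) - subsolution j.+1 y <=
  tau * ((1 + kap) * l y a + kap + (if (j < m)%N then Cg else 0)).
Proof.
have [t0 t1] := andP tau01; have t0' := ltW t0.
have bj := time_average_buc j; have bj1 := time_average_buc j.+1.
rewrite /subsolution -mollify_translate -mollifyB//; last exact: buc_translate.
apply: mollify_le => //; first by apply: bucB => //; exact: buc_translate.
set B := tau * _ => u ue.
rewrite /time_average opprK addrC -mulrBr -sumrB ler_pdivrMl// -sum_cst_ord.
apply: ler_sum => i _.
have h := lkap y a ue.
apply: (@le_trans _ _ (tau * (l (y + u) a + (if (j < m)%N then Cg else 0)))); last first.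
  by rewrite /B ler_wpM2l//; lra.
(* For i > j both indices are truncated to 0, and the terminal cost is
   compared with itself at distance tau |a|. *)
have [ij|ij] := leqP i j.
  rewrite subSn// lerBlDr; apply: le_trans (value_step _ _ a) _.
  rewrite lerD2r ler_wpM2l// lerDl; by case: ifP.
have -> : (j.+1 - i)%N = 0%N by apply/eqP; rewrite subn_eq0.
have -> : (j - i)%N = 0%N by apply/eqP; rewrite subn_eq0 ltnW.
rewrite (ltn_trans ij (ltn_ord i))/=.
have := ggG (y + u + tau *: a) (- (tau *: a)); rewrite addrK l1normN l1normZ (ger0_norm t0') => h1.
apply: le_trans (ler_norm _) _; apply: (le_trans h1).
by rewrite mulrCA ler_wpM2l.
Qed.

(** The sums telescope to their extreme terms, whence the factor 1 / m. *)
Lemma time_average_diff j z : time_average j z - time_average j.+1 z =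
  m%:R^-1 * (value j.+1 z - value (j - m.-1) z).
Proof.
rewrite /time_average opprK addrC -mulrBr; congr (_ * _).
case: m m0 => // m' _.
rewrite [X in X - _]big_ord_recl [X in _ - X]big_ord_recr/= ?subn0.
under [X in _ + X - _]eq_bigr do rewrite /bump/= add1n subSS.
by ring.
Qed.

Lemma time_average_diff_norm_le j z :
  `|time_average j z - time_average j.+1 z| <= J / m%:R.
Proof.
rewrite time_average_diff normrM gtr0_norm ?invr_gt0// mulrC ler_wpM2r ?invr_ge0//.
have := value_ge0 j.+1 z; have := value_leJ j.+1 z.
have := value_ge0 (j - m.-1) z; have := value_leJ (j - m.-1) z.
by rewrite ler_norml; lra.
Qed.

Lemma subsolution_le j y C :
  (forall u, l1norm u <= d%:R * eps -> C <= value j (y + u)) ->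
  subsolution j y <= - C.
Proof.
move=> H; apply: mollify_le => //; first exact: time_average_buc.
move=> u ue; rewrite lerN2 ler_pdivlMl// -sum_cst_ord.
by apply: ler_sum => i _; apply: le_trans (H u ue) _; exact: value_le_sub.
Qed.

Lemma subsolution0_ge y : gg y = 0 -> - (G * (d%:R * eps)) <= subsolution 0 y.
Proof.
move=> gy; apply: mollify_ge => //; first exact: time_average_buc.
move=> u ue; rewrite lerN2 ler_pdivrMl// -sum_cst_ord.
apply: ler_sum => i _; rewrite sub0n /=; have := ggG y u; rewrite gy subr0 => h.
apply: le_trans (ler_norm _) _; apply: (le_trans h).
by rewrite ler_wpM2l.
Qed.

End value_function.

(** * The semigroup over one time step *)

Section combination.
Context {R : realType} {d : nat}.
Implicit Types (f g : 'rV[R]_d -> R) (a b c : R) (x v : 'rV[R]_d).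
Local Notation e i := (delta_mx 0 i : 'rV[R]_d).

Lemma smooth_comb f g a b c : smooth f -> smooth g ->
  smooth (fun x => a * f x + b * g x + c).
Proof.
move=> fs gs; apply: smoothD; last by move=> n; exact: smooth_upto_cst.
by apply: smoothD; exact: smoothZ.
Qed.

Lemma derive_comb f g a b c i x : smooth f -> smooth g ->
  'D_(e i) (fun x => a * f x + b * g x + c) x = a * 'D_(e i) f x + b * 'D_(e i) g x.
Proof.
move=> fs gs.
have /derivableP df : derivable f x (e i) by exact: smooth_upto_partials (fs 1%N) i x.
have /derivableP dg : derivable g x (e i) by exact: smooth_upto_partials (gs 1%N) i x.
have := is_deriveD (is_deriveD (is_deriveZ a df) (is_deriveZ b dg)) (is_derive_cst c x (e i)).
by rewrite addr0 => -[_].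
Qed.

Lemma dotrV_grad_comb f g a b c x v : smooth f -> smooth g ->
  dotrV v (grad (fun x => a * f x + b * g x + c) x) =
  a * dotrV v (grad f x) + b * dotrV v (grad g x).
Proof.
move=> fs gs; rewrite !dotrV_grad !mulr_sumr -big_split/=.
by apply: eq_bigr => i _; rewrite derive_comb//; ring.
Qed.

Lemma convex_norm_le (a b p q M : R) : 0 <= a -> 0 <= b -> a + b <= 1 ->
  `|p| <= M -> `|q| <= M -> `|a * p + b * q| <= M.
Proof.
move=> a0 b0 ab pM qM; have M0 : 0 <= M by apply: le_trans pM.
apply: le_trans (ler_normD _ _) _; rewrite !normrM (ger0_norm a0) (ger0_norm b0).
by nra.
Qed.

End combination.

Section one_step.
Context {R : realType} {d : nat}.
Variable mu : 'rV[R]_d -> {measure set 'rV[R]_d -> \bar R}.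
Variable H1 : 'rV[R]_d -> R.
Hypothesis HH1 : forall x xi, (hamiltonian mu x xi <= (H1 xi)%:E)%E.
Hypothesis Lfin : forall x a, lagrangian mu x a \is a fin_num.
Variable h : R.
Hypothesis h0 : 0 < h.
Variable Q : R -> R.-pker 'rV[R]_d ~> 'rV[R]_d.
Hypothesis Qmarkov : markov_semigroup Q.
Hypothesis QA : generated_by Q (fun f x => h^-1 * jump_operator mu h f x).
Implicit Types (x y a v : 'rV[R]_d).
Local Notation e i := (delta_mx 0 i : 'rV[R]_d).
Local Notation l := (lagR mu).
Local Notation moment_bound := (moment_bound H1).

Variables (W0 W1 : 'rV[R]_d -> R) (Lam K kap del tau err : R).
Hypothesis W0s : smooth W0.
Hypothesis W1s : smooth W1.
Hypothesis Lam0 : 0 <= Lam.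
Hypothesis K0 : 0 <= K.
Hypothesis kap0 : 0 <= kap.
Hypothesis tau0 : 0 < tau.
Hypothesis W0Lam : forall i x, `|'D_(e i) W0 x| <= Lam.
Hypothesis W1Lam : forall i x, `|'D_(e i) W1 x| <= Lam.
Hypothesis W0K : forall x v, `|W0 (x + v) - W0 x - dotrV v (grad W0 x)| <= K * l1norm v ^+ 2.
Hypothesis W1K : forall x v, `|W1 (x + v) - W1 x - dotrV v (grad W1 x)| <= K * l1norm v ^+ 2.
Hypothesis del_ge0 : 0 <= del.
Hypothesis Wdel : forall i x, `|'D_(e i) W1 x - 'D_(e i) W0 x| <= del.
Hypothesis Wstep : forall y a,
  W1 (y + tau *: a) - W0 y <= tau * ((1 + kap) * l y a + kap + err).
Hypothesis err0 : 0 <= err.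

(** A bound on the dual speeds of gradients of size Lam. *)
Definition speed_bound (Lam : R) : R := d%:R * (Lam * moment_bound Lam).

(** The admissible growth of h log of the test function per unit of time. *)
Definition step_rate : R := kap + err + tau * K * speed_bound Lam ^+ 2 +
  del * speed_bound Lam + h * K * moment_bound Lam.

Let beta : R := (1 + kap)^-1.

(** In the course of the step, W1 replaces W0 linearly:
U_s = beta ((1 - s / tau) W0 + (s / tau) W1) - s c, c being the rate. If a is dual
to the gradient of U_s, then H(z, U_s') <= <a, U_s'> - L(z, a). As the gradients of
W0 and W1 are close, <a, U_s'> is about beta <a, W1'>, which is
beta (W1 (z + tau a) - W1 z) / tau up to the Taylor remainder. The discrete
inequality bounds this by L(z, a) - beta (W1 z - W0 z) / tau, and the last term is
the time derivative of U_s; the factor beta = 1 / (1 + kap) cancels the one in front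
of L. *)
Lemma one_step_bound y :
  semigroup_op Q tau (fun z => expR (h^-1 * (beta * W1 z))) y <=
  expR (h^-1 * (tau * step_rate)) * expR (h^-1 * (beta * W0 y)).
Proof.
have k1 : 0 < 1 + kap by rewrite ltr_wpDr.
have b0 : 0 < beta by rewrite invr_gt0.
have b1 : beta <= 1 by rewrite invf_le1// lerDl.
have bk : beta * (1 + kap) = 1 by rewrite mulVf// gt_eqF.
have h00 : h != 0 by rewrite gt_eqF.
have t00 : tau != 0 by rewrite gt_eqF.
set c := step_rate.
pose V z := h^-1 * beta * W0 z.
(* V + s D = U_s / h is the interpolation, written as an affine function of s. *)
pose D z := h^-1 * beta / tau * W1 z + (- (h^-1 * beta / tau)) * W0 z + (- (h^-1 * c)).
have Vs : smooth V by exact: smoothZ.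
have Ds : smooth D by exact: smooth_comb.
pose U s z := beta * (1 - s / tau) * W0 z + beta * (s / tau) * W1 z + (- (s * c)).
have fU s z : V z + s * D z = h^-1 * U s z.
  rewrite /V /D /U; move: (beta) => b; field.
  by rewrite h00 t00.
have := @supersolution_decay R d Q Qmarkov _ QA V D tau y (ltW tau0) Vs Ds.
move=> H; have {}H := H _.
suff {H} key : forall (s : R) z, 0 <= s < tau -> D z * expR (V z + s * D z) +
    h^-1 * jump_operator mu h (fun z => expR (V z + s * D z)) z <= 0.
  have := H key; rewrite mul0r addr0.
  have -> : (fun z => expR (V z + tau * D z)) =
      (fun z => expR (- (h^-1 * (tau * c))) * expR (h^-1 * (beta * W1 z))).
    apply/funext => z; rewrite -expRD; congr expR; rewrite fU /U divff// subrr; ring.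
  rewrite PQZ; last first.
    apply: smooth_bmeas; have := smooth_expR (smoothZ h^-1 (smoothZ beta W1s)); exact.
  rewrite /V expRN -ler_pdivlMl ?invr_gt0 ?expR_gt0// invrK => hh.
  by rewrite [h^-1 * (beta * W0 y)]mulrA.
move=> s z /andP[s0 st].
have st1 : 0 <= s / tau <= 1.
  by rewrite divr_ge0 ?(ltW tau0)//= ler_pdivrMr// mul1r ltW.
have [r0 r1] := andP st1.
have Us : smooth (U s) by exact: smooth_comb.
have a0 : 0 <= beta * (1 - s / tau) by rewrite mulr_ge0 ?(ltW b0)// subr_ge0.
have a1 : 0 <= beta * (s / tau) by rewrite mulr_ge0 ?(ltW b0).
have a01 : beta * (1 - s / tau) + beta * (s / tau) <= 1 by rewrite -mulrDr subrK mulr1.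
have ULam i x : `|'D_(e i) (U s) x| <= Lam.
  by rewrite derive_comb//; exact: convex_norm_le.
have UK x v : `|U s (x + v) - U s x - dotrV v (grad (U s) x)| <= K * l1norm v ^+ 2.
  rewrite dotrV_grad_comb// /U.
  have -> : beta * (1 - s / tau) * W0 (x + v) + beta * (s / tau) * W1 (x + v) + - (s * c) -
      (beta * (1 - s / tau) * W0 x + beta * (s / tau) * W1 x + - (s * c)) -
      (beta * (1 - s / tau) * dotrV v (grad W0 x) + beta * (s / tau) * dotrV v (grad W1 x)) =
      beta * (1 - s / tau) * (W0 (x + v) - W0 x - dotrV v (grad W0 x)) +
      beta * (s / tau) * (W1 (x + v) - W1 x - dotrV v (grad W1 x)) by ring.
  exact: convex_norm_le.
have fE : (fun z => expR (V z + s * D z)) = expR \o (fun x => h^-1 * U s x).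
  by apply/funext => x /=; rewrite fU.
have gen := jump_operator_expR_le HH1 z Us h0 K0 Lam0 ULam UK.
rewrite fE fU; set F := expR (h^-1 * U s z) in gen *.
have F0 : 0 < F by exact: expR_gt0.
have gLam i : `|grad (U s) z 0 i| <= Lam by rewrite mxE.
have [al [alA hal]] := lagrangian_duality HH1 Lfin z Lam0 gLam.
rewrite -/(speed_bound Lam) in alA.
have al0 := l1norm_ge0 al.
rewrite /U dotrV_grad_comb// -/(U s) in hal.
set g0 := dotrV al (grad W0 z) in hal; set g1 := dotrV al (grad W1 z) in hal.
have gdel : `|g1 - g0| <= del * l1norm al.
  have -> : g1 - g0 = dotrV al (grad W1 z - grad W0 z) by rewrite dotrVBr.
  by apply: dotrV_le_l1norm => i; rewrite !mxE.
have del0 : 0 <= del * l1norm al by exact: le_trans gdel.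
have tay := W1K z (tau *: al).
have dZ : dotrV (tau *: al) (grad W1 z) = tau * g1.
  by rewrite /g1 /dotrV mulr_sumr; apply: eq_bigr => i _; rewrite mxE mulrA.
rewrite dZ l1normZ (ger0_norm (ltW tau0)) in tay.
have stp := Wstep z al.
set A := speed_bound Lam in alA *; set m := l1norm al in alA al0 gdel del0 tay.
have delA : del * m <= del * A by rewrite ler_wpM2l.
have mA2 : K * (tau * m) ^+ 2 <= tau * (tau * K * A ^+ 2).
  have : m ^+ 2 <= A ^+ 2 by rewrite lerXn2r ?nnegrE// (le_trans al0).
  have : 0 <= tau ^+ 2 * K by rewrite mulr_ge0// sqr_ge0.
  by rewrite exprMn; nra.
move: tay; rewrite ler_norml => /andP[tay _].
(* The displacement tau al has size at most tau A, so that the Taylor remainder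
   is of order tau^2 and survives division by tau as tau K A^2. *)
have e1 : tau * g1 <= W1 (z + tau *: al) - W1 z + tau * (tau * K * A ^+ 2) by lra.
have e2 : beta * (W1 z - W0 z) + tau * (beta * g1) <=
    tau * l z al + tau * (kap + err) + tau * (tau * K * A ^+ 2).
  have q1 : beta * (W1 z - W0 z + tau * g1) <=
      beta * (tau * ((1 + kap) * l z al + kap + err) + tau * (tau * K * A ^+ 2)).
    by rewrite ler_wpM2l ?(ltW b0)//; lra.
  have q2 : beta * (tau * ((1 + kap) * l z al + kap + err) + tau * (tau * K * A ^+ 2)) =
      tau * l z al * (beta * (1 + kap)) + beta * (tau * (kap + err) + tau * (tau * K * A ^+ 2)).
    by ring.
  rewrite q2 bk mulr1 in q1.
  have q3 : beta * (tau * (kap + err) + tau * (tau * K * A ^+ 2)) <=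
      tau * (kap + err) + tau * (tau * K * A ^+ 2).
    rewrite ler_piMl// addr_ge0// mulr_ge0 ?(ltW tau0)//; first exact: addr_ge0.
    exact: (mulr_ge0 (mulr_ge0 (ltW tau0) K0) (sqr_ge0 A)).
  by lra.
(* The gradient of U_s differs from beta times that of W1 by at most del. *)
have e3 : beta * (1 - s / tau) * g0 + beta * (s / tau) * g1 <= beta * g1 + del * A.
  have : beta * (1 - s / tau) * (g0 - g1) <= del * A.
    apply: (@le_trans _ _ `|g0 - g1|); last by rewrite distrC (le_trans gdel).
    apply: le_trans (ler_norm _) _; rewrite normrM (ger0_norm a0) ler_piMl//.
    by apply: le_trans a01; rewrite lerDl.
  by lra.
have e4 : beta / tau * (W1 z - W0 z) + hamR mu z (grad (U s) z) <= c - h * K * moment_bound Lam.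
  apply: (@le_trans _ _ (beta / tau * (W1 z - W0 z) + (beta * g1 + del * A - l z al))).
    by rewrite lerD2l; apply: (le_trans hal); rewrite lerD2r.
  rewrite /c /step_rate -/A.
  have q : beta / tau * (W1 z - W0 z) + beta * g1 <= l z al + (kap + err) + tau * K * A ^+ 2.
    rewrite -(ler_pM2l tau0); apply: le_trans (le_trans _ e2) _; last by rewrite !mulrDr.
    rewrite le_eqVlt; apply/orP; left; apply/eqP; move: (beta) => b; field.
    exact: t00.
  by lra.
have e5 : h^-1 * jump_operator mu h (expR \o (fun x => h^-1 * U s x)) z <=
    h^-1 * (F * (hamR mu z (grad (U s) z) + h * K * moment_bound Lam)).
  by rewrite ler_wpM2l// invr_ge0 ltW.
apply: (@le_trans _ _ (h^-1 * F * (beta / tau * (W1 z - W0 z) - c +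
    (hamR mu z (grad (U s) z) + h * K * moment_bound Lam)))).
  rewrite [leRHS](_ : _ = D z * F +
    h^-1 * (F * (hamR mu z (grad (U s) z) + h * K * moment_bound Lam))) ?lerD2l//.
  by rewrite /D; ring.
have hF : 0 <= h^-1 * F by rewrite ltW// mulr_gt0// invr_gt0.
apply: mulr_ge0_le0 => //; move: e4.
move: (beta / tau * _) (hamR _ _ _) (h * K * _) => X Y Z; lra.
Qed.

End one_step.

(** * The exponential bound *)

Lemma large_nat (R : realType) (x : R) : exists n : nat, x < n%:R.
Proof.
exists (Num.bound `|x|); apply: le_lt_trans (ler_norm x) _.
exact: archi_boundP.
Qed.

Section main_bound.
Context {R : realType} {d : nat}.
Variable mu : 'rV[R]_d -> {measure set 'rV[R]_d -> \bar R}.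
Variable H1 : 'rV[R]_d -> R.
Hypothesis HH1 : forall x xi, (hamiltonian mu x xi <= (H1 xi)%:E)%E.
Hypothesis Lfin : forall x a, lagrangian mu x a \is a fin_num.
Variable P : R -> R -> R.-pker 'rV[R]_d ~> 'rV[R]_d.
Hypothesis PA : forall h : R, 0 < h -> markov_semigroup (P h) /\
  generated_by (P h) (fun f x => h^-1 * jump_operator mu h f x).
Local Notation l := (lagR mu).
Local Notation e i := (delta_mx 0 i : 'rV[R]_d).
Local Notation moment_bound := (moment_bound H1).
Implicit Types (x y a u : 'rV[R]_d).

Hypothesis lmod : uniform_modulus l.
Hypothesis lcoer : forall C : R, 0 <= C -> exists2 C' : R, 0 <= C' &
  forall x a, C * l1norm a <= l x a + C'.

Variables (J G rho : R) (gg : 'rV[R]_d -> R) (O : set 'rV[R]_d) (x0 : 'rV[R]_d) (n0 : nat).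
Hypothesis gg01 : forall x, 0 <= gg x <= J.
Hypothesis G0 : 0 <= G.
Hypothesis ggG : forall x u, `|gg (x + u) - gg x| <= G * l1norm u.
Hypothesis ggO : forall y, O y -> gg y = 0.
Hypothesis mO : measurable O.
Hypothesis rho0 : 0 < rho.
Hypothesis paths_cost : forall n y, (n0 <= n)%N -> (0 < n)%N -> l1norm (y - x0) < rho ->
  forall a : nat -> 'rV[R]_d,
  J <= \sum_(k < n) (n%:R^-1 * l (path_pos n%:R^-1 y a k) (a k)) +
       gg (path_pos n%:R^-1 y a n).

(** Iterating [one_step_bound] from time 0 to time 1, the logarithm of the test
function changes from about 0 on O to at most - J / h at x0. All parameters are
fixed before h, and only the jump error K B is left as a constant. *)
Lemma probability_bound (eta : R) : 0 < eta -> exists K : R, forall h : R, 0 < h ->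
  (P h 1%R x0 O <= (expR (h^-1 * (- J + eta) + K))%:E)%E.
Proof.
move=> eta0.
have J0 : 0 <= J by have /andP[] := gg01 0; exact: le_trans.
pose eta5 := eta / 5.
have e50 : 0 < eta5 by rewrite divr_gt0.
pose kap := eta5 / (J + 1).
have kap0 : 0 < kap by rewrite divr_gt0// ltr_wpDl.
have kapJ : kap * J + kap = eta5 by rewrite /kap; field; rewrite gt_eqF// ltr_wpDl.
have [d1 d10 Hkap] := lmod kap0.
have [Cg Cg0 GCg] := lcoer G0.
(* The mollifier moves a point by at most d eps: this must stay below d1 for the
   modulus of l, below rho for paths_cost, and cost at most eta / 5 at time 0. *)
pose eps : R := Num.min d1 (Num.min rho (eta5 / (G + 1))) / (d%:R + 1).
have D0 : 0 < d%:R + 1 :> R by rewrite ltr_wpDl.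
have min0 : 0 < Num.min d1 (Num.min rho (eta5 / (G + 1))).
  by rewrite !lt_min d10 rho0/= divr_gt0// ltr_wpDl.
have eps0 : 0 < eps by rewrite divr_gt0.
have deps : d%:R * eps < Num.min d1 (Num.min rho (eta5 / (G + 1))).
  rewrite [ltRHS](_ : _ = (d%:R + 1) * eps); last by rewrite /eps mulrCA mulfV ?mulr1// gt_eqF.
  by rewrite ltr_pM2r// ltrDl.
move: (deps); rewrite !lt_min => /andP[deps1 /andP[deps2 deps3]].
have Geps : G * (d%:R * eps) <= eta5.
  apply: (@le_trans _ _ (G * (eta5 / (G + 1)))); first by rewrite ler_wpM2l// ltW.
  rewrite mulrA ler_pdivrMr ?ltr_wpDl// mulrC ler_wpM2l ?(ltW e50)//.
  by rewrite lerDl.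
have [k ak] := averaging_exists eps0.
have kk : kernels eps (axes (d := d) k) by case: ak => kk _ _; exact: axes_kernels.
have full : forall i : 'I_d, i \in unzip1 (axes k) by exact: axes_full.
have [Lam0 [K0 [Lam00 K00 est]]] := mollify_estimates eps0 kk full.
pose Lam := Lam0 * J; pose K := K0 * J.
have LamP : 0 <= Lam by rewrite mulr_ge0.
have KP : 0 <= K by rewrite mulr_ge0.
pose A := speed_bound (d := d) H1 Lam.
have A0 : 0 <= A by rewrite mulr_ge0// mulr_ge0// (moment_bound_ge0 HH1).
(* There are n = q m steps of length tau = 1 / n. The first m of them take a time
   1 / q, during which the rate contains Cg; averaging over m times and steps of
   length at most 1 / m make the Taylor and gradient errors of order 1 / m. *)
have [q hq] := large_nat (Num.max 1 (Cg / eta5)).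
move: hq; rewrite gt_max => /andP[q1 hq].
have q0 : (0 < q)%N by rewrite -(ltr0n R); apply: lt_trans q1.
have [m0 hm0] := large_nat ((K * A ^+ 2 + Lam * A) / eta5).
pose m := (m0 + n0).+1.
have mR : 0 < m%:R :> R by rewrite ltr0n.
have qR : 0 < q%:R :> R by rewrite ltr0n.
have hm : (K * A ^+ 2 + Lam * A) / m%:R <= eta5.
  rewrite ler_pdivrMr// [eta5 * _]mulrC -ler_pdivrMr//; apply: ltW.
  by apply: (lt_le_trans hm0); rewrite ler_nat leqW// leq_addr.
pose n := (q * m)%N.
have n_gt0 : (0 < n)%N by rewrite muln_gt0 q0.
have mn : (m <= n)%N by rewrite leq_pmull.
have nn0 : (n0 <= n)%N by apply: leq_trans mn; rewrite leqW// leq_addl.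
have nR : 0 < n%:R :> R by rewrite ltr0n.
pose tau : R := n%:R^-1.
have tau0 : 0 < tau by rewrite invr_gt0.
have taum : tau <= m%:R^-1 by rewrite lef_pV2 ?posrE// ler_nat.
have tau1 : tau <= 1 by rewrite invf_le1// ler1n.
have tau01 : 0 < tau <= 1 by rewrite tau0.
have mtauq : m%:R * tau = q%:R^-1.
  by rewrite /tau /n natrM; field; rewrite !gt_eqF.
have lkap : forall x u a, l1norm u <= d%:R * eps -> l (x + u) a <= l x a + kap * (1 + l x a).
  by move=> x u a ue; apply: Hkap; exact: le_lt_trans ue _.
have lg0 := lagR_ge0 HH1 Lfin; have lz := lagR0 HH1 Lfin.
pose W j := subsolution l tau gg eps k m j.
have vbuc j : buc (time_average l tau gg m j).
  by apply: (@time_average_buc R d l lg0 lz lmod J G tau gg).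
have vJ j z : `|time_average l tau gg m j z| <= J.
  by apply: (@time_average_norm_le R d l lg0 lz J tau gg).
have Ws j : smooth (W j) by exact: mollify_smooth.
have WLam j i y : `|'D_(e i) (W j) y| <= Lam by have [] := est _ J (vbuc j) (vJ j).
have WK j x v : `|W j (x + v) - W j x - dotrV v (grad (W j) x)| <= K * l1norm v ^+ 2.
  have [_ h] := est _ J (vbuc j) (vJ j); exact: h.
have Wdel j i y : `|'D_(e i) (W j) y - 'D_(e i) (W j.+1) y| <= Lam / m%:R.
  rewrite -mollify_partialB// /Lam -mulrA.
  have [h _] := est _ (J / m%:R) (bucB (vbuc j) (vbuc j.+1))
    (fun z => @time_average_diff_norm_le R d l lg0 lz J tau gg gg01 tau01 m isT j z).
  exact: h.
have Wstep j y a : W j (y + tau *: a) - W j.+1 y <=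
    tau * ((1 + kap) * l y a + kap + (if (j < m)%N then Cg else 0)).
  exact: (@subsolution_step R d l lg0 lz lmod J G tau gg gg01 G0 ggG tau01 eps Cg kap k m).
have Wn : W n x0 <= - J.
  apply: (@subsolution_le R d l lg0 lz lmod J G tau gg gg01 G0 ggG tau01 eps k m) => //.
  move=> u ue; apply/ler_addgt0Pr => z z0.
  have [b hb] := @value_path R d l lg0 J tau gg gg01 tau01 n (x0 + u) z z0.
  apply: le_trans hb; apply: paths_cost => //.
  by rewrite addrC addKr; exact: le_lt_trans ue _.
have W0 y : O y -> - eta5 <= W 0%N y.
  move=> /ggO gy; apply: (@le_trans _ _ (- (G * (d%:R * eps)))); first by rewrite lerN2.
  exact: (@subsolution0_ge R d l lg0 lz lmod J G tau gg gg01 G0 ggG tau01 eps k m).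
pose B := moment_bound Lam.
exists (K * B) => h h0; have [Qm QA] := PA h0.
pose beta := (1 + kap)^-1.
have k1 : 0 < 1 + kap by rewrite ltr_wpDr// ltW.
have b0 : 0 < beta by rewrite invr_gt0.
have b1 : beta <= 1 by rewrite invf_le1// lerDl ltW.
pose c j : R := step_rate H1 h Lam K kap (Lam / m%:R) tau (if (j < m)%N then Cg else 0).
pose f j z : R := expR (h^-1 * (beta * W j z)).
have fs j : smooth (f j).
  by have := smooth_expR (smoothZ h^-1 (smoothZ beta (Ws j))).
have bf j : bmeas (f j) := smooth_bmeas (fs j).
have iter j y : semigroup_op (P h) (j%:R * tau) (f 0%N) y <=
    expR (h^-1 * (\sum_(i < j) tau * c i)) * f j y.
  elim: j y => [|j IH] y.
    by rewrite mul0r PQ0// big_ord0 mulr0 expR0 mul1r.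
  have -> : j.+1%:R * tau = tau + j%:R * tau by rewrite mulrS mulrDl mul1r.
  have t0 := ltW tau0.
  rewrite PQ_add//; last by rewrite mulr_ge0.
  set C := expR (h^-1 * \sum_(i < j) _) in IH.
  have bC : bmeas (fun z => C * f j z) by exact: bmeasZ.
  apply: le_trans (PQ_le (P h) tau y (PQ_bmeas (P h) _ (bf 0%N)) bC IH) _.
  rewrite PQZ// big_ord_recr/= mulrDr expRD -/C -mulrA ler_wpM2l ?expR_ge0//.
  apply: (@one_step_bound R d mu H1 HH1 Lfin h h0 (P h) Qm QA (W j.+1) (W j) Lam K kap
    (Lam / m%:R) tau (if (j < m)%N then Cg else 0)) => //.
  - exact: ltW.
  - by rewrite divr_ge0.
  - by case: (j < m)%N.
have sumc : \sum_(i < n) tau * c i <= 4 * eta5 - kap * J + h * (K * B).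
  have -> : \sum_(i < n) tau * c i = \sum_(i < n) (tau * (kap + tau * K * A ^+ 2 +
      Lam / m%:R * A + h * K * B) + tau * (if (i < m)%N then Cg else 0)).
    by apply: eq_bigr => i _; rewrite /c /step_rate -/A -/B; ring.
  rewrite big_split/= sumr_const card_ord -mulrnAl -mulr_natr mulVf ?gt_eqF// mul1r.
  have -> : \sum_(i < n) tau * (if (i < m)%N then Cg else 0) = m%:R * tau * Cg.
    rewrite -mulr_sumr -big_mkcond/= -(big_ord_widen n (fun=> Cg) mn) sumr_const card_ord.
    by rewrite -[Cg *+ m]mulr_natl; ring.
  have s1 : m%:R * tau * Cg <= eta5.
    by rewrite mtauq mulrC ler_pdivrMr// mulrC -ler_pdivrMr// ltW.
  have s2 : tau * K * A ^+ 2 + Lam / m%:R * A <= eta5.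
    apply: le_trans hm; rewrite mulrDl.
    have : tau * (K * A ^+ 2) <= m%:R^-1 * (K * A ^+ 2).
      by rewrite ler_wpM2r// mulr_ge0// sqr_ge0.
    by lra.
  by lra.
have fO y : O y -> 1 <= expR (h^-1 * eta5) * f 0%N y.
  move=> /W0 Wy; rewrite /f -expRD -mulrDr -[leLHS]expR0 ler_expR mulr_ge0 ?invr_ge0 ?(ltW h0)//.
  have : beta * - W 0%N y <= eta5.
    have [Wp|Wp] := leP 0 (W 0%N y); last first.
      by apply: (@le_trans _ _ (- W 0%N y)); [rewrite ler_piMl// oppr_ge0 ltW|rewrite lerNl].
    by apply: le_trans (ltW e50); rewrite mulrN oppr_le0 mulr_ge0// ltW.
  by lra.
have bF : bmeas (fun y => expR (h^-1 * eta5) * f 0%N y) by exact: bmeasZ.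
have PO : (P h 1%R x0 O <= (semigroup_op (P h) 1 (fun y => expR (h^-1 * eta5) * f 0%N y) x0)%:E)%E.
  rewrite -(PQE (P h) 1 x0 bF).
  have -> : P h 1%R x0 O = (\int[P h 1%R x0]_y (\1_O y)%:E)%E.
    by rewrite integral_indic// setIT.
  apply: ge0_le_integral => //.
  - by apply/measurable_EFinP; exact: measurable_indic.
  - by have [mF _] := bF; apply/measurable_EFinP; exact: mF.
  - move=> y _; rewrite lee_fin indicE; case: (boolP (y \in O)) => /=.
      by move=> /set_mem; exact: fO.
    by move=> _; rewrite mulr_ge0 ?expR_ge0.
apply: (le_trans PO); rewrite lee_fin PQZ//.
have n1 : n%:R * tau = 1 by rewrite mulfV// gt_eqF.
have := iter n x0; rewrite n1 => hit.
apply: (@le_trans _ _ (expR (h^-1 * eta5) *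
    (expR (h^-1 * \sum_(i < n) tau * c i) * f n x0))).
  by rewrite ler_wpM2l ?expR_ge0.
rewrite /f -!expRD ler_expR -!mulrDr.
have -> : h^-1 * (- J + eta) + K * B = h^-1 * (- J + eta + h * (K * B)).
  by rewrite [in RHS]mulrDr mulKf// gt_eqF.
rewrite ler_wpM2l ?invr_ge0 ?(ltW h0)//.
have bW : beta * W n x0 <= - J + kap * J.
  apply: (@le_trans _ _ (beta * - J)); first by rewrite ler_wpM2l// ltW.
  have : (1 - kap) * J <= beta * J.
    rewrite ler_wpM2r// -[leRHS]mul1r ler_pdivlMr//.
    by have := sqr_ge0 kap; lra.
  by lra.
by rewrite /eta5 in sumc kapJ e50 *; lra.
Qed.

End main_bound.

(** * Polygons and their cost *)

Section polygons.
Context {R : realType} {d : nat}.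
Variables (n : nat) (x0 : 'rV[R]_d) (v : nat -> 'rV[R]_d).
Hypothesis n_gt0 : (0 < n)%N.
Local Notation tau := (n%:R^-1 : R).
Local Notation vertex := (path_pos tau x0 v).
Implicit Types (s t : R) (k : nat).

Let tau0 : 0 < tau.
Proof. by rewrite invr_gt0 ltr0n. Qed.

Definition clip s : R := Num.max 0 (Num.min s tau).

(** The time spent on each step is clipped to [0, tau], so that the position is
one finite sum for all t. *)
Definition polygon t : 'rV[R]_d := x0 + \sum_(k < n) clip (t - k%:R * tau) *: v k.

Lemma polygonE k t : (k < n)%N -> k%:R * tau <= t <= k.+1%:R * tau ->
  polygon t = vertex k + (t - k%:R * tau) *: v k.
Proof.
move=> kn /andP[kt tk].
have tk' : t - k%:R * tau <= tau by move: tk; rewrite mulrSr mulrDl mul1r; lra.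
rewrite /polygon /path_pos -addrA; congr (_ + _).
have E (i : 'I_n) : clip (t - i%:R * tau) *: v i =
    (if (i < k)%N then tau *: v i else 0) + (if i == Ordinal kn then (t - k%:R * tau) *: v k else 0).
  have [ik|ki|ik] := ltngtP i k.
  - rewrite ifF; last by apply/eqP => /(congr1 val)/= E; rewrite E ltnn in ik.
    have : i.+1%:R * tau <= k%:R * tau by rewrite ler_wpM2r ?(ltW tau0)// ler_nat.
    rewrite mulrSr mulrDl mul1r addr0 => h; congr (_ *: _).
    have h1 : tau <= t - i%:R * tau by lra.
    by rewrite /clip min_r// max_r// ltW.
  - rewrite ifF; last by apply/eqP => /(congr1 val)/= E; rewrite E ltnn in ki.
    have : k.+1%:R * tau <= i%:R * tau by rewrite ler_wpM2r ?(ltW tau0)// ler_nat.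
    move=> h; have h1 : t - i%:R * tau <= 0 by lra.
    by rewrite /clip max_l ?scale0r ?addr0// ge_min h1.
  - rewrite ifT; last by apply/eqP/val_inj.
    by rewrite add0r ik /clip min_l// max_r// subr_ge0.
under eq_bigr do rewrite E.
rewrite big_split/= -big_mkcond/= -(big_ord_widen n (fun i => tau *: v i) (ltnW kn)).
by rewrite -scaler_sumr -big_mkcond/= big_pred1_eq.
Qed.

Lemma polygon0 : polygon 0 = x0.
Proof.
rewrite (@polygonE 0)//; last by rewrite mul0r lexx mul1r ltW.
by rewrite /path_pos big_ord0 scaler0 mul0r subrr scale0r !addr0.
Qed.

Lemma polygon1 : polygon 1 = vertex n.
Proof.
have nE : n.-1.+1 = n by rewrite prednK.
have n1 : n%:R * tau = 1 by rewrite mulfV// pnatr_eq0 -lt0n.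
have p1 : 1 - n.-1%:R * tau = tau.
  have : (n.-1%:R + 1) * tau = 1 by rewrite -mulrSr nE.
  by move: (tau) => T; lra.
rewrite (@polygonE n.-1) ?nE//; last first.
  by rewrite n1 lexx andbT; move: tau0 p1; lra.
rewrite p1 /path_pos -[in RHS]nE big_ord_recr/= scalerDr addrA.
by rewrite nE.
Qed.

Lemma affine_C1 (w u : 'rV[R]_d) (c : R) : C1_curve (fun t : R => w + (t - c) *: u) /\
  forall t, derive1 (fun t : R => w + (t - c) *: u) t = u.
Proof.
have D t : is_derive t (1 : R) (fun t : R => w + (t - c) *: u) u.
  have E : \forall h \near (0 : R)^', h^-1 *: (((fun t : R => w + (t - c) *: u) \o shift t) (h *: 1)
      - (w + (t - c) *: u)) = u.
    near=> h; have h0 : h != 0 by near: h; exact: nbhs_dnbhs_neq.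
    rewrite /= [h *: 1]mulr1 opprD addrACA subrr add0r -scalerBl.
    by rewrite (_ : h + t - c - (t - c) = h) ?scalerA ?mulVf ?scale1r//; ring.
  split; first exact: (is_cvg_near_cst u).
  exact: lim_near_cst.
have D1 t : derive1 (fun t : R => w + (t - c) *: u) t = u.
  by rewrite derive1E; case: (D t).
split=> //; split; first by move=> t; case: (D t).
rewrite (_ : derive1 _ = cst u); first exact: cst_continuous.
exact/funext.
Unshelve. all: by end_near. Qed.

Lemma polygon_piecewise_C1 : piecewise_C1 polygon.
Proof.
exists [seq k.+1%:R * tau | k <- iota 0 n].
have nthE k : (k <= n)%N -> nth 0 (0 :: [seq k.+1%:R * tau | k <- iota 0 n]) k = k%:R * tau.
  case: k => [|k] kn /=; first by rewrite mul0r.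
  by rewrite (nth_map 0%N) ?size_iota// nth_iota.
split.
- apply/(pathP 0) => k; rewrite size_map size_iota => kn.
  rewrite nthE 1?ltnW// (nth_map 0%N) ?size_iota// nth_iota// add0n.
  by rewrite ltr_pM2r// ltr_nat.
- rewrite -nth_last/= size_map size_iota.
  case: n n_gt0 nthE => // n' _ nthE.
  have := nthE n'.+1 (leqnn _); rewrite /= => ->.
  by rewrite mulfV// pnatr_eq0.
- rewrite size_map size_iota => k kn.
  exists (fun t => vertex k + (t - k%:R * tau) *: v k).
    exact: (affine_C1 _ _ _).1.
  move=> t; rewrite nthE 1?ltnW// (nth_map 0%N) ?size_iota// nth_iota// add0n.
  exact: polygonE.
Qed.

Lemma derive1_polygon k t : (k < n)%N -> k%:R * tau < t < k.+1%:R * tau ->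
  derive1 polygon t = v k.
Proof.
move=> kn tI; have [_ h] := affine_C1 (vertex k) (v k) (k%:R * tau).
rewrite -(h t) !derive1E; apply: near_eq_derive.
have : t \in `]k%:R * tau, k.+1%:R * tau[ by rewrite in_itv.
move=> /near_in_itvoo; apply: filterS => s /[!in_itv]/= /andP[s1 s2].
by apply: polygonE => //; rewrite !ltW.
Qed.

Import HBNNSimple.

(** The integral of F is a supremum over simple functions below F, and each of
these is below the step function off the countable set of multiples of tau. *)
Lemma integral_le_steps (F : R -> \bar R) (B : nat -> R) :
  (forall t, (0 <= F t)%E) -> (forall k, 0 <= B k) ->
  (forall k t, (k < n)%N -> k%:R * tau < t < k.+1%:R * tau -> (F t <= (B k)%:E)%E) ->
  (\int[@lebesgue_measure R]_(t in `[0%R, 1%R]) F t <= (\sum_(k < n) tau * B k)%:E)%E.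
Proof.
move=> F0 B0 FB.
pose I k : set R := `]k%:R * tau, k.+1%:R * tau[%classic.
pose G t := (\sum_(k < n) (B k)%:E * (\1_(I k) t)%:E)%E.
have mI k : measurable (I k : set (measurableTypeR R)) by exact: measurable_itv.
rewrite ge0_integralE//; apply: ge_ereal_sup => _ [h /= hF <-].
have -> : sintegral (@lebesgue_measure R) h =
    (\int[@lebesgue_measure R]_(t in setT) (h t)%:E)%E.
  by rewrite integral_nnsfun// patch_setT.
have m1 k : measurable_fun [set: measurableTypeR R] (EFin \o (\1_(I k) : R -> R)).
  by apply/measurable_EFinP; exact: measurable_indic.
have mG k : measurable_fun [set: measurableTypeR R]
    (fun t : R => ((B k)%:E * (\1_(I k) t)%:E)%E).
  exact: (measurable_funeM (B k)%:E (m1 k)).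
have lamI k : lebesgue_measure (I k) = tau%:E.
  rewrite /I lebesgue_measure_itv/= lte_fin ltr_pM2r// ltr_nat ltnSn.
  by rewrite -EFinB -mulrBl -natrB// subSnn mul1r.
have G0 k t : (0 <= (B k)%:E * (\1_(I k) t)%:E)%E by rewrite mule_ge0// lee_fin.
apply: (@le_trans _ _ (\int[@lebesgue_measure R]_(t in setT) G t)%E); last first.
  rewrite ge0_integral_sum// -sumEFin; apply: lee_sum => k _.
  rewrite (@ge0_integralZl _ _ _ (@lebesgue_measure R) setT measurableT _ (m1 k) (B k)%:E).
  2: by move=> t _; rewrite /= lee_fin.
  2: by rewrite lee_fin.
  rewrite integral_indic// setIT EFinM muleC.
  by rewrite [X in (X * _)%E](_ : _ = tau%:E) ?lexx//; exact: lamI.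
pose N : set R := [set k%:R * tau | k in [set: nat]].
have cN : countable N.
  exact: (card_le_trans (card_image_le _ _)).
have N0 : lebesgue_measure N = 0%E.
  exact: countable_lebesgue_measure0.
apply: ae_ge0_le_integral => //.
- by move=> t _; rewrite lee_fin.
- by apply/measurable_EFinP.
- by move=> t _; apply: sume_ge0 => k _; exact: G0.
- by apply: emeasurable_sum => k; exact: mG.
exists N; split => //.
  exact: countable_measurable.
move=> t /=; apply: contra_notP => Nt _.
apply: (le_trans (hF t)); rewrite patchE; case: ifPn; last first.
  by move=> _; apply: sume_ge0 => k _; exact: G0.
rewrite inE /= in_itv/= => /andP[t0 t1].
have tn0 : 0 <= t * n%:R by rewrite mulr_ge0.
have /andP[k1 k2] := truncn_itv tn0.
set k := Num.truncn (t * n%:R) in k1 k2.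
have nR : 0 < n%:R :> R by rewrite ltr0n.
have k1' : k%:R * tau < t.
  rewrite lt_neqAle ler_pdivrMr// k1 andbT; apply/eqP => E.
  by apply: Nt; exists k.
have k2' : t < k.+1%:R * tau by rewrite ltr_pdivlMr.
have kn : (k < n)%N.
  by rewrite -(ltr_nat R) -[n%:R]mul1r -ltr_pdivrMr// (lt_le_trans k1').
apply: (le_trans (FB k t kn _)); first by rewrite k1'.
rewrite /G (bigD1 (Ordinal kn))//= indicE mem_set/=; last first.
  by rewrite /I /= in_itv/= k1'.
rewrite mule1 leeDl//; apply: sume_ge0 => i _; exact: G0.
Qed.

Lemma cost_path_pos (L : 'rV[R]_d -> 'rV[R]_d -> \bar R) (B : nat -> R) :
  (forall x a, (0 <= L x a)%E) -> (forall k, 0 <= B k) ->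
  (forall k s, (k < n)%N -> 0 < s < tau ->
     (L (vertex k + s *: v k)%R (v k) <= (B k)%:E)%E) ->
  (cost L x0 (vertex n) <= (\sum_(k < n) tau * B k)%:E)%E.
Proof.
move=> L0 B0 LB.
apply: (@le_trans _ _ (action L polygon)).
  apply: ereal_inf_lbound; exists polygon => //; split.
  - exact: polygon_piecewise_C1.
  - exact: polygon0.
  - exact: polygon1.
apply: integral_le_steps => //.
move=> k t kn kt; rewrite (derive1_polygon kn kt).
have /andP[kt1 kt2] := kt.
rewrite (@polygonE k)//; last by rewrite !ltW.
apply: LB => //; rewrite subr_gt0 kt1/=.
by move: kt2; rewrite mulrSr mulrDl mul1r; lra.
Qed.

End polygons.

(** * The Euclidean norm and regularity of the Lagrangian *)

Section euclidean_norm.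
Context {R : realType} {d : nat}.
Implicit Types (u v : 'rV[R]_d) (c : R).

Lemma dotrVC u v : dotrV u v = dotrV v u.
Proof. by apply: eq_bigr => i _; rewrite mulrC. Qed.

Lemma dotrVV_ge0 v : 0 <= dotrV v v.
Proof. by apply: sumr_ge0 => i _; rewrite -expr2 sqr_ge0. Qed.

Lemma enorm_ge0 v : 0 <= enorm v.
Proof. exact: sqrtr_ge0. Qed.

Lemma sqr_enorm v : enorm v ^+ 2 = dotrV v v.
Proof. by rewrite sqr_sqrtr// dotrVV_ge0. Qed.

Lemma coord_le_enorm v i : `|v 0 i| <= enorm v.
Proof.
rewrite -sqrtr_sqr ler_wsqrtr// /dotrV (bigD1 i)//= -expr2 lerDl.
by apply: sumr_ge0 => j _; rewrite -expr2 sqr_ge0.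
Qed.

Lemma enorm_le_l1norm v : enorm v <= l1norm v.
Proof.
rewrite -(ger0_norm (l1norm_ge0 v)) -sqrtr_sqr ler_wsqrtr// expr2 {2}/l1norm mulr_sumr.
apply: ler_sum => i _; rewrite (le_trans (ler_norm _))// normrM ler_wpM2r//.
exact: coord_le_l1norm.
Qed.

Lemma l1norm_le_enorm v : l1norm v <= d%:R * enorm v.
Proof.
apply: (@le_trans _ _ (\sum_(i < d) enorm v)).
  by apply: ler_sum => i _; exact: coord_le_enorm.
by rewrite sumr_const card_ord mulr_natl.
Qed.

Lemma enormZ c v : enorm (c *: v) = `|c| * enorm v.
Proof.
rewrite /enorm dotrVZr dotrVC dotrVZr mulrA -expr2 sqrtrM ?sqr_ge0//.
by rewrite sqrtr_sqr.
Qed.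

Lemma enormN v : enorm (- v) = enorm v.
Proof. by rewrite -scaleN1r enormZ normrN1 mul1r. Qed.

Lemma enorm0_eq0 v : enorm v = 0 -> v = 0.
Proof.
by move=> v0; apply/rowP => i; apply/eqP; rewrite mxE -normr_le0 -v0 coord_le_enorm.
Qed.

Lemma cauchy_schwarz u v : dotrV u v <= enorm u * enorm v.
Proof.
have dot0 w : dotrV w 0 = 0 by rewrite /dotrV big1// => i _; rewrite mxE mulr0.
have [/enorm0_eq0 ->|u0] := eqVneq (enorm u) 0.
  by rewrite dotrVC dot0 mulr_ge0 ?enorm_ge0.
have [/enorm0_eq0 ->|v0] := eqVneq (enorm v) 0.
  by rewrite dot0 mulr_ge0 ?enorm_ge0.
have uv0 : 0 < enorm u * enorm v by rewrite mulr_gt0// lt0r enorm_ge0 andbT.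
(* The square norm of |v| u - |u| v is 2 |u| |v| (|u| |v| - <u, v>). *)
have := dotrVV_ge0 (enorm v *: u - enorm u *: v).
rewrite dotrVBr !dotrVZr ![dotrV (_ - _) _]dotrVC !dotrVBr !dotrVZr.
rewrite -!sqr_enorm (dotrVC v u) => h.
by rewrite -subr_ge0 -(pmulr_rge0 _ uv0); move: h; lra.
Qed.

Lemma enormD u v : enorm (u + v) <= enorm u + enorm v.
Proof.
rewrite -ler_sqr ?nnegrE ?addr_ge0 ?enorm_ge0//.
rewrite sqr_enorm dotrVDr ![dotrV (_ + _) _]dotrVC !dotrVDr -!sqr_enorm (dotrVC v u).
have := cauchy_schwarz u v; lra.
Qed.

Lemma enorm_lipschitz u v : `|enorm (u + v) - enorm u| <= l1norm v.
Proof.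
apply: (le_trans _ (enorm_le_l1norm v)).
have h1 := enormD u v; have := enormD (u + v) (- v).
rewrite addrK enormN ler_norml => h2; apply/andP; split; lra.
Qed.

Lemma enorm_continuous (c : 'rV[R]_d) : continuous (fun y : 'rV[R]_d => enorm (y - c)).
Proof.
have E (y : 'rV[R]_d) : enorm (y - c) = Num.sqrt (\sum_(i < d) (y 0 i - c 0 i) ^+ 2).
  by congr Num.sqrt; apply: eq_bigr => i _; rewrite !mxE expr2.
under eq_fun do rewrite E.
have cs : continuous (fun y : 'rV[R]_d => \sum_(i < d) (y 0 i - c 0 i) ^+ 2).
  apply: continuous_big => [|i _]; first exact: add_continuous.
  move=> v.
  have cp : continuous (fun t : R => (t - c 0 i) ^+ 2).
    move=> t; apply: (@continuous_comp _ _ _ (fun t : R => t - c 0 i) (fun t : R => t ^+ 2)).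
      by apply: cvgB; [exact: cvg_id|exact: cvg_cst].
    exact: exprn_continuous.
  exact: (continuous_comp (@coord_continuous R 1 d 0 i v) (cp _)).
by move=> y; apply: continuous_comp (cs y) _; exact: sqrt_continuous.
Qed.

Lemma eball_measurable (c : 'rV[R]_d) r : measurable (eball c r).
Proof.
apply: rV_open_measurable.
rewrite (_ : eball c r = (fun y : 'rV[R]_d => enorm (y - c)) @^-1` [set t : R | t < r])//.
by apply: open_comp; [move=> y _; exact: enorm_continuous|exact: open_lt].
Qed.

End euclidean_norm.

Section consequences.
Context {R : realType} {d : nat}.
Variable mu : 'rV[R]_d -> {measure set 'rV[R]_d -> \bar R}.
Variable H1 : 'rV[R]_d -> R.
Hypothesis HH1 : forall x xi, (hamiltonian mu x xi <= (H1 xi)%:E)%E.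
Hypothesis Lfin : forall x a, lagrangian mu x a \is a fin_num.
Local Notation l := (lagR mu).
Implicit Types (x a u v : 'rV[R]_d).

Lemma uniform_modulus_relative :
  relative_modulus (lagrangian mu) delta @[delta --> 0^'+] --> 0%E ->
  uniform_modulus l.
Proof.
move=> cv kap kap0.
have n0 : nbhs (0%E : \bar R) [set z | (z < kap%:E)%E].
  rewrite /nbhs/=; apply: (@filterS _ (nbhs (0 : R)) _ [set t : R | t < kap]).
    by move=> t /=; rewrite lte_fin.
  by apply: open_nbhs_nbhs; split; [exact: open_lt|].
have c1 := cv _ n0.
have [del [del0 hdel]] : exists del : R, 0 < del /\
    (relative_modulus (lagrangian mu) del < kap%:E)%E.
  have [del [h1 h2]] := filter_ex (filterI (nbhs_right_gt (0 : R)) c1).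
  by exists del.
exists del => // x u a ul.
have l0 := lagR_ge0 HH1 Lfin x a.
have l1 : 0 < 1 + l x a by rewrite ltr_wpDr.
have : (`|l (x + u) a - l x a| / (1 + l x a) < kap).
  rewrite -lte_fin; apply: le_lt_trans hdel; apply: ereal_sup_ubound.
  exists x, (x + u), a; split => //.
  rewrite opprD addrA subrr sub0r enormN.
  exact: le_lt_trans (enorm_le_l1norm _) ul.
rewrite ltr_pdivrMr// => /ltW/(le_trans (ler_norm _)).
by rewrite lerBlDl.
Qed.

(** Superlinearity of L follows from that of L1 <= L; for small speeds the constant
C' takes over. *)
Lemma lagR_coercive :
  (forall C : R, 0 < C -> exists K : R, forall a, K <= enorm a ->
     ((C * enorm a)%:E <= legendre (EFin \o H1) a)%E) ->
  forall C : R, 0 <= C -> exists2 C' : R, 0 <= C' &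
    forall x a, C * l1norm a <= l x a + C'.
Proof.
move=> hyp C C0.
have D0 : 0 < C * d%:R + 1 by rewrite ltr_wpDl// mulr_ge0.
have [K hK] := hyp _ D0.
exists ((C * d%:R + 1) * Num.max 0 K).
  by rewrite mulr_ge0 ?(ltW D0)// le_max lexx.
move=> x a; apply: (@le_trans _ _ ((C * d%:R + 1) * enorm a)).
  apply: (@le_trans _ _ (C * (d%:R * enorm a))).
    by rewrite ler_wpM2l// l1norm_le_enorm.
  by rewrite mulrA ler_wpM2r ?enorm_ge0// lerDl.
have [Ka|aK] := leP K (enorm a).
  rewrite -[leLHS]addr0 lerD ?mulr_ge0 ?(ltW D0) ?le_max ?lexx//.
  rewrite -lee_fin -lagRE//; apply: le_trans (hK _ Ka) _.
  apply: ge_ereal_sup => _ [xi _ <-].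
  apply: le_trans (ereal_sup_ubound _); last by exists xi.
  by rewrite /= (hamRE HH1) -!EFinB lee_fin lerD2l lerN2 -lee_fin -(hamRE HH1).
rewrite -[leLHS]add0r lerD ?(lagR_ge0 HH1 Lfin)// ler_wpM2l ?(ltW D0)//.
by rewrite le_max (ltW aK) orbT.
Qed.

Lemma derive_dotrV (f : 'rV[R]_d -> R) x v : differentiable f x ->
  'D_v f x = dotrV v (grad f x).
Proof.
move=> df; rewrite dotrV_grad deriveE// [in LHS](row_sum_delta v) linear_sum/=.
by apply: eq_bigr => i _; rewrite linearZ/= deriveE.
Qed.

Lemma lagR_lipschitz :
  (forall x, twice_differentiable (fun a => fine (lagrangian mu x a))) ->
  (forall r : R, 0 < r -> exists M m : R, 0 < m /\
     forall x a, enorm a <= r ->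
       [/\ (lagrangian mu x a <= M%:E)%E,
           enorm (grad (fun b => fine (lagrangian mu x b)) a) <= M &
           hessian_ge (fun b => fine (lagrangian mu x b)) a m]) ->
  forall r : R, 0 <= r -> exists2 M : R, 0 <= M & forall x a v,
    l1norm a <= r -> l1norm v <= 1 -> l x (a + v) <= l x a + M * l1norm v.
Proof.
move=> df grb r r0.
have r10 : 0 < r + 1 by rewrite ltr_wpDl.
have [M [m [_ hM]]] := grb _ r10.
exists M.
  have [|_ h _] := hM 0 0; first by rewrite (le_trans (enorm_le_l1norm _))// l1norm0 ltW.
  exact: le_trans (enorm_ge0 _) h.
move=> x a v ar v1.
have dfx b : differentiable (lagR mu x) b by exact: (df x).1.
have [|th th1] := @mean_value_line R d (lagR mu x) a v 1.
  by move=> s; exact: diff_derivable.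
rewrite normr1 in th1.
rewrite scale1r mul1r derive_dotrV// => /eqP; rewrite subr_eq => /eqP ->.
rewrite addrC lerD2l; apply: le_trans (ler_norm _) _.
apply: dotrV_le_l1norm => i; apply: le_trans (coord_le_enorm _ _) _.
have [|_ //] := hM x (a + th *: v).
apply: le_trans (enorm_le_l1norm _) _; apply: le_trans (l1normD _ _) _.
rewrite lerD// l1normZ; apply: le_trans v1.
by rewrite ler_piMl// l1norm_ge0.
Qed.

End consequences.

(** * Comparison of nearby polygons *)

Section nearby_paths.
Context {R : realType} {d : nat}.
Variable l : 'rV[R]_d -> 'rV[R]_d -> R.
Hypothesis l_ge0 : forall x a, 0 <= l x a.
Hypothesis lmod : uniform_modulus l.
Hypothesis lcoer : forall C : R, 0 <= C -> exists2 C' : R, 0 <= C' &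
  forall x a, C * l1norm a <= l x a + C'.
Hypothesis llip : forall r : R, 0 <= r -> exists2 M : R, 0 <= M & forall x a v,
    l1norm a <= r -> l1norm v <= 1 -> l x (a + v) <= l x a + M * l1norm v.
Implicit Types (x y b u : 'rV[R]_d) (a : nat -> 'rV[R]_d).

(** By Markov's inequality at least half of the n vectors have norm at most
2 A + 1; the weight is constant on these and 0 on the others. *)
Lemma slow_weights (n : nat) a (A : R) : (0 < n)%N -> 0 <= A ->
  \sum_(k < n) l1norm (a k) <= n%:R * A ->
  exists w : nat -> R, [/\ forall k, 0 <= w k <= 2,
    n%:R^-1 * \sum_(k < n) w k = 1 &
    forall k, w k = 0 \/ l1norm (a k) <= 2 * A + 1].
Proof.
move=> n0 A0 aA.
pose s k : R := (l1norm (a k) <= 2 * A + 1)%R%:R.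
pose N : R := \sum_(k < n) s k.
have nR : 0 < n%:R :> R by rewrite ltr0n.
have hN : (n%:R - N) * (2 * A + 1) <= n%:R * A.
  have -> : n%:R - N = \sum_(k < n) (1 - s k) by rewrite sumrB sum_cst_ord mulr1.
  apply: le_trans aA; rewrite mulr_suml.
  apply: ler_sum => k _; rewrite /s; have := l1norm_ge0 (a k).
  by case: (leP (l1norm (a k)) (2 * A + 1)) => /= h; lra.
have N2 : n%:R <= 2 * N :> R.
  rewrite leNgt; apply/negP => h.
  have : n%:R * (2 * A + 1) < 2 * (n%:R - N) * (2 * A + 1).
    by rewrite ltr_pM2r; [move: h; lra|move: A0; lra].
  by move: h hN nR; move: (n%:R : R) N => z t; lra.
have Npos : 0 < N by move: N2 nR; lra.
exists (fun k => n%:R / N * s k); split.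
- move=> k; have nN : n%:R / N <= 2 by rewrite ler_pdivrMr.
  have nN0 : 0 <= n%:R / N by rewrite divr_ge0// ltW.
  by rewrite /s; case: (l1norm (a k) <= _) => /=; rewrite ?mulr1 ?mulr0 ?nN0 ?lexx ?ler0n.
- by rewrite -mulr_sumr -/N divfK ?mulVf// gt_eqF.
- by move=> k; rewrite /s; case: (leP (l1norm (a k)) (2 * A + 1)) => _; [right|left; rewrite mulr0].
Qed.

(** A polygon from y that is cheaper than J and ends near the ball is translated
to start at x0, and a drift of total displacement b, of order rho, is added on its
slow steps so that it ends in the ball. Its vertices move by O(rho), its slow
speeds as well, and its fast speeds do not change; hence its true action is
less than J', which no curve into the ball achieves. *)
Lemma paths_cost_near (J J' r : R) (c x0 : 'rV[R]_d) : 0 <= J -> J < J' -> 0 < r ->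
  (forall y, eball c r y -> (J'%:E <= cost (fun x u => (l x u)%:E) x0 y)%E) ->
  exists2 rho : R, 0 < rho & exists n0 : nat, forall n y, (n0 <= n)%N -> (0 < n)%N ->
    l1norm (y - x0) < rho -> forall a,
    enorm (path_pos n%:R^-1 y a n - c) < r + rho ->
    J <= \sum_(k < n) (n%:R^-1 * l (path_pos n%:R^-1 y a k) (a k)).
Proof.
move=> J0 JJ' r0 costJ.
pose eta := J' - J.
have eta0 : 0 < eta by rewrite subr_gt0.
pose D : R := 6 * d%:R + 1.
have dR0 : 0 <= d%:R :> R by [].
have D0 : 0 < D by rewrite ltr_wpDl// mulr_ge0.
(* By coercivity the speeds have mean at most A along a polygon cheaper than J. *)
have [C1 C10 hC1] := lcoer (ler01 : 0 <= 1 :> R).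
pose A := J + C1.
have A0 : 0 <= A by rewrite addr_ge0.
have R00 : 0 <= 2 * A + 1 by rewrite addr_ge0// mulr_ge0.
have [M M0 hM] := llip R00.
(* The action is multiplied by at most 1 + kap and increased by kap when positions
   change; with rho below it remains less than J + eta = J'. *)
pose kap := Num.min 1 (eta / (2 * (J + 1))).
have J10 : 0 < J + 1 by rewrite ltr_wpDl.
have kap0 : 0 < kap by rewrite lt_min ltr01/= divr_gt0// mulr_gt0.
have kap1 : kap <= 1 by rewrite ge_min lexx.
have kapJ : kap * (J + 1) <= eta / 2.
  apply: (@le_trans _ _ (eta / (2 * (J + 1)) * (J + 1))).
    by rewrite ler_wpM2r ?(ltW J10)// ge_min lexx orbT.
  by rewrite le_eqVlt; apply/orP; left; apply/eqP; field; rewrite gt_eqF.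
have [del del0 hdel] := lmod kap0.
have C20 : 0 <= 2 * (J + 1) / del by rewrite divr_ge0 ?(ltW del0)// mulr_ge0// ltW.
have [C2 C2p hC2] := lcoer C20.
have [n0 hn0] := large_nat C2.
have dM0 : 0 < d%:R * M + 1 by rewrite ltr_wpDl// mulr_ge0.
(* The three bounds keep the added speed 4 d rho below 1, the displacement of a
   vertex and of the drift below del / 2, and the action of the drift below
   eta / 4. *)
pose rho := Num.min (D^-1) (Num.min (del / (2 * D)) (eta / (16 * (d%:R * M + 1)))).
have rho0 : 0 < rho.
  by rewrite !lt_min invr_gt0 D0 !divr_gt0// mulr_gt0.
have rho1 : D * rho <= 1.
  by rewrite mulrC -ler_pdivlMr// div1r ge_min lexx.
have rho2 : D * rho <= del / 2.
  rewrite mulrC -ler_pdivlMr// -mulrA -invfM.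
  by rewrite /rho !ge_min lexx orbT.
have rho3 : (d%:R * M + 1) * rho <= eta / 16.
  rewrite mulrC -ler_pdivlMr// -mulrA -invfM.
  by rewrite /rho !ge_min lexx !orbT.
exists rho => //; exists n0 => n y n0n npos yx0 a aend.
rewrite leNgt; apply/negP => Slt.
pose tau : R := n%:R^-1.
have nR : 0 < n%:R :> R by rewrite ltr0n.
have tau0 : 0 < tau by rewrite invr_gt0.
have tau1 : tau <= 1 by rewrite invf_le1// ler1n.
have ntau : n%:R * tau = 1 by rewrite mulfV// gt_eqF.
pose X k := path_pos tau y a k.
pose Sl : R := \sum_(k < n) tau * l (X k) (a k).
have term0 k : 0 <= tau * l (X k) (a k) by rewrite mulr_ge0// ltW.
have termJ k : (k < n)%N -> tau * l (X k) (a k) < J.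
  move=> kn; apply: le_lt_trans Slt; rewrite (bigD1 (Ordinal kn))//= lerDl.
  by apply: sumr_ge0 => i _; exact: term0.
(* A longer step would by itself cost more than J. *)
have short k : (k < n)%N -> tau * l1norm (a k) <= del / 2.
  move=> kn; rewrite leNgt; apply/negP => far.
  have h1 : tau * (2 * (J + 1) / del * l1norm (a k)) <= tau * (l (X k) (a k) + C2).
    by rewrite ler_wpM2l ?(ltW tau0).
  have h2 : J + 1 <= tau * (2 * (J + 1) / del * l1norm (a k)).
    rewrite [leRHS](_ : _ = (2 * (J + 1) / del) * (tau * l1norm (a k))); last by ring.
    apply: (@le_trans _ _ (2 * (J + 1) / del * (del / 2))); last by rewrite ler_wpM2l ?(ltW far).
    by rewrite le_eqVlt; apply/orP; left; apply/eqP; field; rewrite gt_eqF.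
  have h3 : tau * C2 <= 1.
    rewrite /tau mulrC ler_pdivrMr// mul1r (le_trans (ltW hn0))// ler_nat.
    exact: n0n.
  by have := termJ k kn; move: h1 h2 h3; rewrite mulrDr; lra.
have aA : \sum_(k < n) l1norm (a k) <= n%:R * A.
  apply: (@le_trans _ _ (\sum_(k < n) (l (X k) (a k) + C1))).
    by apply: ler_sum => k _; have := hC1 (X k) (a k); rewrite mul1r.
  rewrite big_split/= sum_cst_ord /A mulrDr lerD2r mulrC -ler_pdivrMr// mulrC.
  by rewrite mulr_sumr ltW.
have [w [w2 w1 wR]] := slow_weights npos A0 aA.
(* After the translation the end e' lies within 2 rho of the ball; b moves it into
   the ball, on the segment to the centre. *)
pose e' := path_pos tau y a n + (x0 - y).
have r2 : 0 < r + 2 * rho by rewrite addr_gt0// mulr_gt0.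
pose b : 'rV[R]_d := (- (2 * rho / (r + 2 * rho))) *: (e' - c).
have e'c : enorm (e' - c) < r + 2 * rho.
  rewrite (_ : e' - c = (path_pos tau y a n - c) + (x0 - y)); last by rewrite /e' addrAC.
  apply: le_lt_trans (enormD _ _) _.
  have := enorm_le_l1norm (x0 - y); rewrite -l1normN opprB.
  by move: yx0 aend; rewrite -/tau; lra.
have bn : l1norm b <= d%:R * (2 * rho).
  apply: le_trans (l1norm_le_enorm _) _; rewrite ler_wpM2l// enormZ normrN.
  have rr0 : 0 <= 2 * rho / (r + 2 * rho) by rewrite divr_ge0 ?(ltW r2)// mulr_ge0// ltW.
  rewrite ger0_norm// mulrAC ler_pdivrMr// ler_wpM2l ?mulr_ge0 ?(ltW rho0)//.
  exact: ltW.
have be : enorm (e' + b - c) < r.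
  rewrite (_ : e' + b - c = (r / (r + 2 * rho)) *: (e' - c)); last first.
    rewrite addrAC -[X in X + _]scale1r -scalerDl; congr (_ *: _).
    by field; rewrite gt_eqF.
  rewrite enormZ ger0_norm; last by rewrite divr_ge0 ?(ltW r2)// ltW.
  by rewrite mulrAC ltr_pdivrMr// ltr_pM2l.
pose a' k := a k + w k *: b.
pose th k : R := tau * \sum_(i < k) w i.
have pos' k : path_pos tau x0 a' k = X k + ((x0 - y) + th k *: b).
  rewrite /X /path_pos big_split/= -scaler_suml scalerDr scalerA -/(th k).
  by rewrite addrACA [y + _]addrC subrK addrA.
have th01 k : (k <= n)%N -> 0 <= th k <= 1.
  move=> kn; apply/andP; split.
    by rewrite mulr_ge0 ?(ltW tau0)//; apply: sumr_ge0 => i _; have /andP[] := w2 i.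
  rewrite -w1 ler_wpM2l ?(ltW tau0)// -(big_mkord xpredT w) -(big_mkord xpredT w).
  rewrite [leRHS](@big_cat_nat _ _ _ k)//= lerDl.
  by apply: sumr_ge0 => i _; have /andP[] := w2 i.
have wb k : l1norm (w k *: b) <= 4 * d%:R * rho.
  rewrite l1normZ ger0_norm; last by have /andP[] := w2 k.
  have /andP[wk0 wk2] := w2 k.
  apply: (@le_trans _ _ (2 * (d%:R * (2 * rho)))); last by lra.
  exact: ler_pM (l1norm_ge0 _) wk2 bn.
pose B k := (1 + kap) * (l (X k) (a k) + M * (4 * d%:R * rho)) + kap.
have B0 k : 0 <= B k.
  rewrite addr_ge0 ?(ltW kap0)// mulr_ge0 ?addr_ge0 ?(ltW kap0)//.
  by rewrite !mulr_ge0// ltW.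
have dr : 4 * d%:R * rho <= 1.
  by move: rho1 rho0 (mulr_ge0 dR0 (ltW rho0)); rewrite /D; move: (d%:R) (rho) => z t; lra.
have LB k s : (k < n)%N -> 0 < s < tau ->
    l (path_pos tau x0 a' k + s *: a' k) (a' k) <= B k.
  move=> kn /andP[s0 st].
    (* A step with w k = 0 keeps its speed; the others are slow. *)
have la : l (X k) (a' k) <= l (X k) (a k) + M * (4 * d%:R * rho).
    have [w0|ak] := wR k.
      by rewrite /a' w0 scale0r addr0 lerDl !mulr_ge0// ltW.
    apply: (le_trans (hM (X k) _ (w k *: b) ak (le_trans (wb k) dr))).
    by rewrite lerD2l ler_wpM2l.
  rewrite pos' -addrA.
  apply: (le_trans (hdel _ _ _ _)); last first.
    by rewrite /B; move: la kap0; move: (l _ _) (l _ _) (M * _) => X1 X2 X3; nra.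
  apply: le_lt_trans (l1normD _ _) _.
  have h1 : l1norm (x0 - y + th k *: b) < rho + d%:R * (2 * rho).
    apply: le_lt_trans (l1normD _ _) _; rewrite ltr_leD//.
      by rewrite -l1normN opprB.
    have /andP[t0 t1] := th01 k (ltnW kn).
    by rewrite l1normZ ger0_norm// (le_trans _ bn)// ler_piMl// l1norm_ge0.
  have h2 : l1norm (s *: a' k) <= del / 2 + 4 * d%:R * rho.
    rewrite l1normZ ger0_norm ?(ltW s0)//.
    apply: (@le_trans _ _ (tau * (l1norm (a k) + l1norm (w k *: b)))).
      by apply: ler_pM (ltW s0) (l1norm_ge0 _) (ltW st) (l1normD _ _).
    rewrite mulrDr lerD ?short//; apply: le_trans (wb k).
    by rewrite ler_piMl// l1norm_ge0.
  move: h1 h2 rho2; rewrite /D; move: (d%:R) (rho) (del) => z t u; lra.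
have endb : eball c r (path_pos tau x0 a' n).
  rewrite /eball/= pos' /th w1 scale1r addrA; exact: be.
have := costJ _ endb.
apply/negP; rewrite -ltNge.
apply: (@le_lt_trans _ _ (\sum_(k < n) tau * B k)%:E).
  exact: cost_path_pos.
rewrite lte_fin (_ : \sum_(k < n) _ = (1 + kap) * (Sl + M * (4 * d%:R * rho)) + kap); last first.
  rewrite -mulr_sumr /B big_split/= sum_cst_ord -mulr_sumr big_split/= sum_cst_ord.
  rewrite /Sl -mulr_sumr; set S1 := \sum_(k < n) _; set E1 := M * _.
  rewrite [LHS](_ : _ = (1 + kap) * (tau * S1 + n%:R * tau * E1) + n%:R * tau * kap).
    by rewrite ntau !mul1r.
  by ring.
have JE : J' = J + eta by rewrite /eta; ring.
have h4 : M * (4 * d%:R * rho) <= eta / 4.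
  by move: rho3 rho0; move: (d%:R) (M) (rho) (eta) => z m t u; lra.
have h5 : 0 <= M * (4 * d%:R * rho) by rewrite !mulr_ge0// ltW.
move: Slt; rewrite -/tau -/Sl JE => Slt.
move: kapJ kap0 kap1 h4 h5 Slt; move: (M * _) (Sl) (kap) (eta) (J) => a1 a2 a3 a4 a5.
nra.
Qed.

End nearby_paths.

(** * The upper bound *)

Section logarithmic_limsup.
Context {R : realType}.
Implicit Types (J eta h K : R).

Lemma mule_lne_le h t (p : \bar R) : 0 < h -> (0 <= p)%E -> (p <= (expR t)%:E)%E ->
  (h%:E * lne p <= (h * t)%:E)%E.
Proof.
move=> h0 p0 pt; rewrite EFinM lee_wpmul2l ?lee_fin ?(ltW h0)//.
rewrite -[t]expRK -lne_EFin ?expR_gt0// lee_lne// in_itv/= ?leey ?andbT//.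
Qed.

Lemma limf_esup_mul_lne_le (p : R -> \bar R) J :
  (forall h, 0 < h -> (0 <= p h)%E) ->
  (forall eta, 0 < eta -> exists K, forall h, 0 < h ->
     (p h <= (expR (h^-1 * (- J + eta) + K))%:E)%E) ->
  (limf_esup (fun h => h%:E * lne (p h)) 0%R^'+ <= (- J)%:E)%E.
Proof.
move=> p0 pJ; apply/lee_addgt0Pr => eta eta0.
have eta20 : 0 < eta / 2 by rewrite divr_gt0.
have [K hK] := pJ _ eta20.
have K0 : 0 < `|K| + 1 by rewrite ltr_wpDl.
pose V := [set h : R | 0 < h < eta / 2 / (`|K| + 1)].
have V0 : nbhs (0 : R)^'+ V.
  near=> h; apply/andP; split; near: h; first exact: nbhs_right_gt.
  by apply: nbhs_right_lt; rewrite divr_gt0.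
apply: (@le_trans _ _ (ereal_sup ((fun h => h%:E * lne (p h))%E @` V))).
  by apply: ereal_inf_lbound; exists V.
apply: ge_ereal_sup => _ [h /andP[h0 hV] <-].
apply: (le_trans (mule_lne_le h0 (p0 _ h0) (hK _ h0))).
rewrite -EFinD lee_fin mulrDr mulrA mulfV ?gt_eqF// mul1r -addrA lerD2l.
rewrite [leRHS](splitr eta) lerD2l.
apply: (@le_trans _ _ (h * (`|K| + 1))); last by rewrite -ler_pdivlMr// ltW.
by rewrite ler_wpM2l ?(ltW h0)// (le_trans (ler_norm _))// lerDl.
Unshelve. all: by end_near. Qed.

End logarithmic_limsup.

Section penalty.
Context {R : realType} {d : nat}.
Variables (J r rho : R) (c : 'rV[R]_d).
Hypotheses (J0 : 0 <= J) (rho0 : 0 < rho).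

(** The terminal cost: 0 on the ball, J beyond distance rho from it. *)
Definition penalty (z : 'rV[R]_d) : R :=
  J * Num.min 1 (Num.max 0 ((enorm (z - c) - r) / rho)).

Lemma penalty_itv z : 0 <= penalty z <= J.
Proof.
rewrite /penalty mulr_ge0//=; last by rewrite le_min ler01 le_max lexx.
by rewrite ler_piMr// ge_min lexx.
Qed.

Lemma penalty_eball z : eball c r z -> penalty z = 0.
Proof.
move=> /ltW zr; rewrite /penalty max_l; last first.
  by rewrite pmulr_lle0 ?invr_gt0// subr_le0.
by rewrite min_r ?mulr0.
Qed.

Lemma penalty_far z : r + rho <= enorm (z - c) -> penalty z = J.
Proof.
move=> zr; rewrite /penalty min_l ?mulr1// le_max; apply/orP; right.
by rewrite ler_pdivlMr// mul1r lerBrDl.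
Qed.

Lemma penalty_lipschitz x u : `|penalty (x + u) - penalty x| <= J / rho * l1norm u.
Proof.
have clamp (s t : R) : `|Num.min 1 (Num.max 0 s) - Num.min 1 (Num.max 0 t)| <= `|s - t|.
  have h1 := ler_norm (s - t); have h2 := ler_norm (t - s); rewrite distrC in h2.
  rewrite ler_norml; move: h1 h2; move: (`|s - t|) => D h1 h2.
  case: (leP 0 s) => hs; case: (leP 0 t) => ht; rewrite ?(min_r (@ler01 R));
    case: (leP 1 s) => hs1; case: (leP 1 t) => ht1; apply/andP; split; lra.
rewrite /penalty -mulrBr normrM ger0_norm// -mulrA ler_wpM2l//.
apply: le_trans (clamp _ _) _.
have rhoV : 0 <= rho^-1 by rewrite invr_ge0 ltW.
rewrite -mulrBl normrM (ger0_norm rhoV) mulrC ler_wpM2l//.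
rewrite (_ : _ - _ = enorm ((x - c) + u) - enorm (x - c)); last first.
  by rewrite (addrAC x u); ring.
exact: enorm_lipschitz.
Qed.

End penalty.

Lemma real_between (R : realType) (x y : \bar R) : (0 <= x)%E -> (x < y)%E ->
  exists J J' : R, [/\ 0 <= J, J < J', (x < J%:E)%E & (J'%:E <= y)%E].
Proof.
case: x => [x| |]// x0; case: y => [y| |]//.
- rewrite lte_fin => xy; exists ((x + y) / 2), y.
  by move: x0; rewrite !lee_fin lte_fin => x0; split => //; lra.
- move=> _; exists (x + 1), (x + 2).
  by move: x0; rewrite !lee_fin lte_fin leey => x0; split => //; lra.
Qed.

Theorem mainTheorem1 (R : realType) (d : nat)
    (mu : 'rV[R]_d -> {measure set 'rV[R]_d -> \bar R})
    (g : 'rV[R]_d -> 'rV[R]_d -> R)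
    (H1 : 'rV[R]_d -> R)
    (P : R -> R -> R.-pker 'rV[R]_d ~> 'rV[R]_d) :
  let H := hamiltonian mu in
  let L := lagrangian mu in
  has_density mu g ->
  (ereal_sup [set \int[mu x]_z (enorm z ^+ 2)%:E | x in [set: 'rV[R]_d]]
     < +oo)%E ->
  (forall x z : 'rV[R]_d, z != 0 ->
     {for (x, z), continuous (fun p : 'rV[R]_d * 'rV[R]_d => g p.1 p.2)}) ->

  continuous (fun p : 'rV[R]_d * 'rV[R]_d => H p.1 p.2) ->
  convex_function [set: 'rV[R]_d] H1 ->
  (forall x xi, (H x xi <= (H1 xi)%:E)%E) ->

  (forall x a, L x a \is a fin_num) ->
  (forall x, twice_differentiable (fun a => fine (L x a))) ->
  (forall r : R, 0 < r -> exists M m : R, 0 < m /\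
     forall x a, enorm a <= r ->
       [/\ (L x a <= M%:E)%E,
           enorm (grad (fun b => fine (L x b)) a) <= M &
           hessian_ge (fun b => fine (L x b)) a m]) ->
  relative_modulus L delta @[delta --> 0^'+] --> 0%E ->

  (forall C : R, 0 < C -> exists K : R, forall a, K <= enorm a ->
     ((C * enorm a)%:E <= legendre (EFin \o H1) a)%E) ->

  (forall h : R, 0 < h ->
     markov_semigroup (P h) /\
     generated_by (P h) (fun f x => h^-1 * jump_operator mu h f x)) ->

  forall (c : 'rV[R]_d) (r : R), 0 < r -> forall x : 'rV[R]_d,
    (limf_esup (fun h : R => h%:E * lne (P h 1%R x (eball c r))) 0%R^'+
       <= - ereal_inf [set cost L x y | y in eball c r])%E.
Proof.
move=> H L _ _ _ _ _ HH1 Lfin Ldiff Lbound Lmod Lsup PA c r r0 x0.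
pose l := lagR mu.
have l_ge0 := lagR_ge0 HH1 Lfin.
have lmod : uniform_modulus l := uniform_modulus_relative HH1 Lfin Lmod.
have lcoer := lagR_coercive HH1 Lfin Lsup.
have llip := lagR_lipschitz Ldiff Lbound.
have LE : L = fun x a => (l x a)%:E.
  by apply/funext => x; apply/funext => a; rewrite /l -lagRE.
set I := ereal_inf _; set Y := limf_esup _ _.
have P_ge0 h : 0 < h -> (0 <= P h 1%R x0 (eball c r))%E by [].
have Y0 : (Y <= 0)%E.
  have := @limf_esup_mul_lne_le R (fun h => P h 1%R x0 (eball c r)) 0 P_ge0.
  rewrite oppr0; apply => eta eta0; exists 0 => h h0.
  apply: (@le_trans _ _ 1%E).
    rewrite -(prob_kernel (s := P h 1%R) x0); apply: le_measure => //; rewrite inE//.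
    exact: eball_measurable.
  by rewrite add0r addr0 lee_fin -expR0 ler_expR mulr_ge0 ?invr_ge0 ?ltW.
rewrite leeNr leNgt; apply/negP => YI.
have [J [J' [J0 JJ' YJ J'I]]] : exists J J' : R,
    [/\ 0 <= J, J < J', (- Y < J%:E)%E & (J'%:E <= I)%E].
  by apply: real_between YI; rewrite oppe_ge0.
have costJ y : eball c r y -> (J'%:E <= cost (fun x u => (l x u)%:E) x0 y)%E.
  by move=> cy; apply: (le_trans J'I); apply: ereal_inf_lbound; rewrite -LE; exists y.
have [rho rho0 [n0 near]] := paths_cost_near l_ge0 lmod lcoer llip J0 JJ' r0 costJ.
move: YJ; apply/negP; rewrite -leNgt leeNr -EFinN.
apply: limf_esup_mul_lne_le => // eta eta0.
apply: (probability_bound HH1 Lfin PA lmod lcoer (G := J / rho) (rho := rho)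
  (gg := penalty J r rho c) (n0 := n0)) => //.
- by move=> z; exact: penalty_itv.
- by rewrite divr_ge0// ltW.
- by move=> z u; exact: penalty_lipschitz.
- by move=> z; exact: penalty_eball.
- exact: eball_measurable.
- move=> n y n0n npos yx a.
  have [far|close] := leP (r + rho) (enorm (path_pos n%:R^-1 y a n - c)).
    rewrite penalty_far// lerDr; apply: sumr_ge0 => k _.
    by rewrite mulr_ge0 ?invr_ge0// l_ge0.
  by rewrite -[leLHS]addr0 lerD ?near//; have /andP[] := penalty_itv r rho c J0 (path_pos n%:R^-1 y a n).
Qed.
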